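(* Let $\varepsilon>0$ and $\delta=(\delta_1,\delta_2)\in\mathbb R^2$. The functions $$\varphi_\varepsilon:(x_1,x_2)\in\overline{\mathbb R_+^2}\mapsto\frac\pi2-\arctan\left(\frac{x_1+\varepsilon a}{x_2+\varepsilon}\right)+\delta_2x_2,\qquad a\in\mathbb R,$$ are local minimizers of $E_\varepsilon^\delta$ in $\mathbb R_+^2$ in the sense of De Giorgi, and they are the only such local minimizers satisfying $$\lim_{x_1\to+\infty}\varphi_\varepsilon(x_1,0)=0,\quad\lim_{x_1\to-\infty}\varphi_\varepsilon(x_1,0)=\pi\quad\text{and}\quad\big[(x_1,x_2)\mapsto\varphi_\varepsilon(x_1,x_2)-\delta_2x_2\big]\in L^\infty(\mathbb R_+^2).$$
   Context: $\mathbb R_+^2=\mathbb R\times(0,+\infty)$, $\overline{\mathbb R_+^2}=\mathbb R\times[0,+\infty)$. For a set $\omega\subset\mathbb R^2$ (open, or compact such as the support of a test function) and a real-valued $\varphi$, $$E_\varepsilon^\delta(\varphi;\omega)=\frac12\int_{\omega\cap\mathbb R_+^2}\left(|\nabla\varphi|^2-2\delta\cdot\nabla\varphi\right)\mathrm dx+\frac1{2\varepsilon}\int_{\omega\cap(\mathbb R\times\{0\})}\sin^2\varphi\,\mathrm d\mathcal H^1,$$ with boundary values on $\mathbb R\times\{0\}$ in the sense of traces. A function $\varphi\in H^1_{\mathrm{loc}}(\overline{\mathbb R_+^2})$ is a local minimizer of $E_\varepsilon^\delta$ in $\mathbb R_+^2$ in the sense of De Giorgi if $E_\varepsilon^\delta(\varphi;\mathrm{Supp}(\psi))\le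 E_\varepsilon^\delta(\varphi+\psi;\mathrm{Supp}(\psi))$ for every $\psi\in C^1(\mathbb R^2)$ with compact support. *)

(* Defs.v *)
From HB Require Import structures.
From mathcomp Require Import all_boot all_order all_algebra.
From mathcomp Require Import all_classical all_reals all_analysis.

Set Implicit Arguments.
Unset Strict Implicit.
Unset Printing Implicit Defensive.

Import Order.TTheory GRing.Theory Num.Theory.
Import numFieldNormedType.Exports.

Local Open Scope classical_set_scope.
Local Open Scope ring_scope.

Section Plane.
Context {R : realType}.
Implicit Types (u g psi eta : R * R -> R) (t : R -> R) (v x : R * R).

Definition lebesgue1 : {measure set (measurableTypeR R) -> \bar R} :=
  @lebesgue_measure R.

Definition lebesgue2 :
    {measure set (measurableTypeR R * measurableTypeR R) -> \bar R} :=
  (@lebesgue_measure R \x @lebesgue_measure R)%E.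

Definition halfplane : set (R * R) := [set x | 0 < x.2].

Definition e1 : R * R := (1, 0).
Definition e2 : R * R := (0, 1).

Definition supp psi : set (R * R) := closure [set x | psi x != 0].

Definition C1 psi : Prop :=
  (forall x, differentiable psi x) /\
  (forall v, continuous (fun x => 'D_v psi x)).

Definition C1c psi : Prop := C1 psi /\ compact (supp psi).

(* L^2_loc of the closed half-plane: square integrability is required near
   boundary points as well, since K may meet the line x.2 = 0. *)
Definition L2loc_halfplane u : Prop :=
  measurable_fun (halfplane : set (measurableTypeR R * measurableTypeR R)) u /\
  forall K : set (R * R), compact K ->
    (\int[lebesgue2]_(x in K `&` halfplane) ((u x) ^+ 2)%:E < +oo)%E.

Definition L2loc_line t : Prop :=
  measurable_fun (setT : set (measurableTypeR R)) t /\
  forall K : set R, compact K ->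
    (\int[lebesgue1]_(s in K) ((t s) ^+ 2)%:E < +oo)%E.

Definition is_weak_partial v u g : Prop :=
  L2loc_halfplane g /\
  forall eta, C1c eta -> supp eta `<=` halfplane ->
    \int[lebesgue2]_(x in halfplane) (u x * 'D_v eta x) =
    - \int[lebesgue2]_(x in halfplane) (g x * eta x).

Definition H1loc u : Prop :=
  [/\ L2loc_halfplane u,
      exists g, is_weak_partial e1 u g &
      exists g, is_weak_partial e2 u g].

(* For u in H1loc the choice is immaterial: weak partial derivatives are
   unique almost everywhere. *)
Definition weak_partial v u : R * R -> R :=
  xget (cst 0) [set g | is_weak_partial v u g].

(* The trace is the boundary value for which Green's formula holds; the outward
   unit normal of the half-plane is - e2.  The test functions eta need not
   vanish on the boundary line. *)
Definition is_trace u t : Prop :=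
  L2loc_line t /\
  forall eta, C1c eta ->
    \int[lebesgue2]_(x in halfplane)
        (u x * 'D_e2 eta x + weak_partial e2 u x * eta x) =
    - \int[lebesgue1]_s (t s * eta (s, 0)).

(* Again unique almost everywhere when u is in H1loc. *)
Definition trace u : R -> R := xget (cst 0) [set t | is_trace u t].

(* The integrals are extended-real valued.  The Hausdorff measure H^1 on
   R x {0} is the image of Lebesgue measure under s |-> (s, 0). *)
Definition energy (eps : R) (delta : R * R) (phi : R * R -> R)
    (omega : set (R * R)) : \bar R :=
  ((2^-1)%:E * \int[lebesgue2]_(x in omega `&` halfplane)
      ((weak_partial e1 phi x) ^+ 2 + (weak_partial e2 phi x) ^+ 2
       - 2 * (delta.1 * weak_partial e1 phi x
              + delta.2 * weak_partial e2 phi x))%:E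
   + ((2 * eps)^-1)%:E * \int[lebesgue1]_(s in [set s | omega (s, 0%R)])
      ((sin (trace phi s)) ^+ 2)%:E)%E.

Definition local_minimizer (eps : R) (delta : R * R)
    (phi : R * R -> R) : Prop :=
  H1loc phi /\
  forall psi, C1c psi ->
    (energy eps delta phi (supp psi)
     <= energy eps delta (phi \+ psi)%R (supp psi))%E.

(* Limits at infinity of a function on the line that is only defined almost
   everywhere, such as a trace: these are essential limits, and agree with the
   ordinary ones when the function is continuous. *)
Definition ess_cvg_pinfty t (l : R) : Prop :=
  forall e : R, 0 < e ->
    exists M : R, {ae lebesgue1, forall s, M < s -> `|t s - l| < e}.

Definition ess_cvg_ninfty t (l : R) : Prop :=
  forall e : R, 0 < e ->
    exists M : R, {ae lebesgue1, forall s, s < M -> `|t s - l| < e}.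

Definition Linfty_halfplane u : Prop :=
  measurable_fun (halfplane : set (measurableTypeR R * measurableTypeR R)) u /\
  exists M : R, {ae lebesgue2, forall x, halfplane x -> `|u x| <= M}.

Definition conditions_at_infinity (delta : R * R) (phi : R * R -> R) : Prop :=
  [/\ ess_cvg_pinfty (trace phi) 0,
      ess_cvg_ninfty (trace phi) pi &
      Linfty_halfplane (fun x => phi x - delta.2 * x.2)].

(* Only the values on the closed half-plane x.2 >= 0 matter; there the
   denominator is positive as soon as 0 < eps. *)
Definition profile (eps : R) (delta : R * R) (a : R) : R * R -> R :=
  fun x => pi / 2 - atan ((x.1 + eps * a) / (x.2 + eps)) + delta.2 * x.2.

End Plane.

(* Main.v *)
(* Write [w = phi - delta.2 * x.2] and
   [F (x, v) = (- sin v ^+ 2, sin v * cos v) / (x.2 + eps)].  A calibration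
   expresses the energy of a compactly supported variation of a profile as half
   the integral of [|grad w - F (x, w)| ^+ 2], where [w] belongs to the varied
   function; the profiles are therefore minimizers.

   Conversely, let [phi] be a minimizer with the prescribed limits.  Subtracting
   its Euler-Lagrange equation from that of the profile [phi0] with [a = 0] and
   testing against the bounded difference times logarithmic cutoffs shows that
   [phi - phi0] has finite energy, because [sin ^+ 2] is uniformly convex near
   the wells [0] and [pi].  Let [psi] be a test function close to
   [phi - phi0] in energy: minimality of [phi] against [phi - psi] bounds the
   increment from [phi0] to [phi0 + psi], and by the calibration this forces
   [grad w = F (x, w)] in the limit.  Along this first order system the point
   [sin w : (x.2 + eps) * cos w - x.1 * sin w] of the projective line is constant,
   which determines [w] up to an additive constant, and the limits of the trace
   fix that constant. *)

(* All profiles solve the same system [grad w = F (x, w)] because [F] arises by eliminating the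
   parameter [a] from their gradients. The shift [x.2 + eps] makes the flux of the calibration field
   through the boundary line equal to [sin ^+ 2 / (2 * eps)], which is the boundary energy.

   A minimizer is only known to lie in [H1loc], so the equality case of the calibration is reached
   through a sequence: smooth [W] whose defect [grad W - F (x, W)] tends to 0 in L^2 of the
   half-plane while [W] tends to [w] locally in L^2. Functions of [(x, w)] that are locally
   uniformly Lipschitz in [w] pass to this limit, which is why the projective invariant is written
   with bounded quotients.

   The difference with a profile is bounded but need not be in L^2. The Dirichlet integral is scale
   invariant in the plane, so a single cutoff costs an error of order one: enough to bound the
   energy, not enough to approximate by test functions. Hence the cutoffs of small capacity.

   Test functions need not vanish on the boundary line. Mollification therefore samples only points
   above the given one, and the trace is carried along with the function. *)
Require Import Defs.
From HB Require Import structures.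
From mathcomp Require Import all_boot all_order all_algebra.
From mathcomp Require Import all_classical all_reals all_analysis.
From mathcomp Require Import measurable_realfun ring lra.

Set Implicit Arguments.
Unset Strict Implicit.
Unset Printing Implicit Defensive.
Import Order.TTheory GRing.Theory Num.Theory.
Import numFieldNormedType.Exports.
Local Open Scope classical_set_scope.
Local Open Scope ring_scope.

(** * Square integrable functions and integral operators *)

Section SquareIntegrable.
Context d (T : measurableType d) (R : realType).

Definition sqint (mu : set T -> \bar R) (D : set T) (f : T -> R) :=
  measurable_fun D f /\ mu.-integrable D (EFin \o (fun x => f x ^+ 2)).

Definition ip (mu : set T -> \bar R) (D : set T) (f g : T -> R) : R :=
  fine (\int[mu]_(x in D) (f x * g x)%:E).

Variable mu : {measure set T -> \bar R}.
Implicit Types (D : set T) (f g h : T -> R).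

Lemma ipE D f g : ip mu D f g = \int[mu]_(x in D) (f x * g x).
Proof. by []. Qed.

Lemma integrable_le D f g : measurable_fun D f ->
  (forall x, D x -> `|f x| <= g x) ->
  measurable D -> mu.-integrable D (EFin \o g) -> mu.-integrable D (EFin \o f).
Proof.
move=> mf fg mD; apply: le_integrable => //; first exact/measurable_EFinP.
by move=> x Dx /=; rewrite lee_fin (le_trans (fg _ Dx))// ler_norm.
Qed.

Lemma integrableDr D f g : measurable D -> mu.-integrable D (EFin \o f) ->
  mu.-integrable D (EFin \o g) ->
  mu.-integrable D (EFin \o (fun x => f x + g x)).
Proof. by move=> mD If Ig; exact: (integrableD mD If Ig). Qed.

Lemma integrableBr D f g : measurable D -> mu.-integrable D (EFin \o f) ->
  mu.-integrable D (EFin \o g) ->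
  mu.-integrable D (EFin \o (fun x => f x - g x)).
Proof. by move=> mD If Ig; exact: (integrableB mD If Ig). Qed.

Lemma integrableZr' D (c : R) f : measurable D -> mu.-integrable D (EFin \o f) ->
  mu.-integrable D (EFin \o (fun x => c * f x)).
Proof. by move=> mD If; exact: (integrableZl mD c If). Qed.

Lemma sqintP D f : sqint mu D f <->
  measurable_fun D f /\ (\int[mu]_(x in D) ((f x) ^+ 2)%:E < +oo)%E.
Proof.
split=> -[mf].
  move=> /integrableP[_ If]; split => //.
  rewrite (le_lt_trans _ If)//= le_eqVlt; apply/orP; left; apply/eqP.
  by apply: eq_integral => x _; rewrite /= ger0_norm// sqr_ge0.
move=> If; split => //; apply/integrableP; split.
  by apply/measurable_EFinP; exact: measurable_funX.
rewrite (le_lt_trans _ If)//= le_eqVlt; apply/orP; left; apply/eqP.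
by apply: eq_integral => x _; rewrite /= ger0_norm// sqr_ge0.
Qed.

Lemma sqint_int D f g : measurable D -> sqint mu D f -> sqint mu D g ->
  mu.-integrable D (EFin \o (fun x => f x * g x)).
Proof.
move=> mD [mf If] [mg Ig].
apply: (@integrable_le _ _ (fun x => f x ^+ 2 + g x ^+ 2)) => //.
- exact: measurable_funM.
- by move=> x _; rewrite ler_norml; apply/andP; split; nra.
- exact: integrableDr.
Qed.

Lemma sqint_le D f g : measurable D -> measurable_fun D f ->
  (forall x, D x -> `|f x| <= `|g x|) -> sqint mu D g -> sqint mu D f.
Proof.
move=> mD mf fg [mg Ig]; split => //.
apply: (@integrable_le _ _ (fun x => g x ^+ 2)) => //.
  exact: measurable_funX.
move=> x /fg; rewrite -real_normK ?num_real// -[g x ^+ 2]real_normK ?num_real//.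
by move=> ?; rewrite normrX !normr_id ler_sqr ?nnegrE.
Qed.

Lemma sqintD D f g : measurable D -> sqint mu D f -> sqint mu D g ->
  sqint mu D (fun x => f x + g x).
Proof.
move=> mD [mf If] [mg Ig]; split; first exact: measurable_funD.
apply: (@integrable_le _ _ (fun x => 2 * (f x ^+ 2 + g x ^+ 2))) => //.
- by apply: measurable_funX; exact: measurable_funD.
- move=> x _; rewrite ger0_norm ?sqr_ge0//.
  by have := sqr_ge0 (f x - g x); nra.
- by apply: integrableZr' => //; exact: integrableDr.
Qed.

Lemma sqintZ D (c : R) f : measurable D -> sqint mu D f ->
  sqint mu D (fun x => c * f x).
Proof.
move=> mD [mf If]; split; first exact: measurable_funM.
apply: (@eq_integrable _ _ _ _ _ _ (EFin \o (fun x => c ^+ 2 * f x ^+ 2))) => //.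
  by move=> x _; rewrite /= exprMn.
exact: integrableZr'.
Qed.

Lemma sqintN D f : measurable D -> sqint mu D f -> sqint mu D (fun x => - f x).
Proof.
move=> mD [mf If]; split; first exact: measurable_funN.
apply: eq_integrable If => // x _ /=; by rewrite sqrrN.
Qed.

Lemma sqintB D f g : measurable D -> sqint mu D f -> sqint mu D g ->
  sqint mu D (fun x => f x - g x).
Proof. by move=> mD Lf Lg; apply: sqintD => //; exact: sqintN. Qed.

Lemma sqint_bM D (c : R) h f : measurable D -> measurable_fun D h ->
  (forall x, D x -> `|h x| <= c) -> sqint mu D f -> sqint mu D (fun x => h x * f x).
Proof.
move=> mD mh hc Lf.
apply: (@sqint_le _ _ (fun x => c * f x)) => //.
- by apply: measurable_funM => //; case: Lf.
- move=> x Dx; rewrite !normrM ler_wpM2r// (le_trans (hc _ Dx))//.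
  exact: ler_norm.
- exact: sqintZ.
Qed.

Lemma sqintS D D' f : measurable D -> measurable D' -> D' `<=` D ->
  sqint mu D f -> sqint mu D' f.
Proof.
move=> mD mD' DD' [mf If]; split; first exact: measurable_funS mf.
exact: integrableS If.
Qed.

Lemma eq_sqint D f g : {in D, f =1 g} -> measurable D -> sqint mu D f -> sqint mu D g.
Proof.
move=> fg mD [mf If]; split; first exact: eq_measurable_fun mf.
by apply: eq_integrable If => // x Dx /=; rewrite fg.
Qed.

Lemma ipC D f g : ip mu D f g = ip mu D g f.
Proof. by rewrite !ipE; apply: eq_Rintegral => x _; rewrite mulrC. Qed.

Lemma eq_ip D f g f' g' : {in D, f =1 f'} -> {in D, g =1 g'} ->
  ip mu D f g = ip mu D f' g'.
Proof. by rewrite !ipE => ff gg; apply: eq_Rintegral => x Dx; rewrite ff// gg. Qed.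

Lemma ipDl D f g h : measurable D -> sqint mu D f -> sqint mu D g -> sqint mu D h ->
  ip mu D (fun x => f x + g x) h = ip mu D f h + ip mu D g h.
Proof.
move=> mD Lf Lg Lh; rewrite !ipE -RintegralD//; try exact: sqint_int.
by apply: eq_Rintegral => x _; rewrite mulrDl.
Qed.

Lemma ipBl D f g h : measurable D -> sqint mu D f -> sqint mu D g -> sqint mu D h ->
  ip mu D (fun x => f x - g x) h = ip mu D f h - ip mu D g h.
Proof.
move=> mD Lf Lg Lh; rewrite !ipE -RintegralB//; try exact: sqint_int.
by apply: eq_Rintegral => x _; rewrite mulrBl.
Qed.

Lemma ipZl D (c : R) f g : measurable D -> sqint mu D f -> sqint mu D g ->
  ip mu D (fun x => c * f x) g = c * ip mu D f g.
Proof.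
move=> mD Lf Lg; rewrite !ipE -RintegralZl//; try exact: sqint_int.
by apply: eq_Rintegral => x _; rewrite mulrA.
Qed.

Lemma ipDr D f g h : measurable D -> sqint mu D f -> sqint mu D g -> sqint mu D h ->
  ip mu D h (fun x => f x + g x) = ip mu D h f + ip mu D h g.
Proof. by move=> *; rewrite ipC ipDl// ![ip mu D h _]ipC. Qed.

Lemma ipBr D f g h : measurable D -> sqint mu D f -> sqint mu D g -> sqint mu D h ->
  ip mu D h (fun x => f x - g x) = ip mu D h f - ip mu D h g.
Proof. by move=> *; rewrite ipC ipBl// ![ip mu D h _]ipC. Qed.

Lemma ipZr D (c : R) f g : measurable D -> sqint mu D f -> sqint mu D g ->
  ip mu D g (fun x => c * f x) = c * ip mu D g f.
Proof. by move=> *; rewrite ipC ipZl// ![ip mu D g _]ipC. Qed.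

Lemma ip_ge0 D f : 0 <= ip mu D f f.
Proof. by rewrite ipE; apply: Rintegral_ge0 => x _; rewrite -expr2 sqr_ge0. Qed.

Lemma ip_sqint D f : measurable D -> sqint mu D f ->
  ((ip mu D f f)%:E = \int[mu]_(x in D) ((f x) ^+ 2)%:E)%E.
Proof.
move=> mD [mf If]; rewrite ipE /Rintegral.
under eq_integral do rewrite -expr2.
by rewrite fineK//; exact: (integrable_fin_num mD If).
Qed.

Lemma ip_le D f g : measurable D -> sqint mu D f -> sqint mu D g ->
  (forall x, D x -> `|f x| <= `|g x|) -> ip mu D f f <= ip mu D g g.
Proof.
move=> mD Lf Lg fg; rewrite !ipE; apply: le_Rintegral => //; try exact: sqint_int.
move=> x /fg h; rewrite -!expr2 -real_normK ?num_real//.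
by rewrite -[g x ^+ 2]real_normK ?num_real// ler_sqr ?nnegrE.
Qed.

Lemma ip_subset D D' f : measurable D -> measurable D' -> D' `<=` D ->
  sqint mu D f -> ip mu D' f f <= ip mu D f f.
Proof.
move=> mD mD' DD' Lf; have Lf' := sqintS mD mD' DD' Lf.
rewrite -lee_fin !ip_sqint//; apply: ge0_subset_integral => //.
  by case: Lf => _ /(measurable_int mu).
by move=> x _; rewrite lee_fin sqr_ge0.
Qed.

Lemma ip_young D f g (s : R) : measurable D -> sqint mu D f -> sqint mu D g ->
  0 < s -> 2 * ip mu D f g <= s * ip mu D f f + s^-1 * ip mu D g g.
Proof.
move=> mD Lf Lg s0.
have := ip_ge0 D (fun x => s * f x - g x).
rewrite ipBl ?ipBr ?ipZl ?ipZr//; try by [exact: sqintZ|exact: sqintB (sqintZ _ _ _) _].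
  rewrite [ip mu D g f]ipC => h.
  rewrite -subr_ge0 -(pmulr_rge0 _ s0); apply: le_trans h _.
  by rewrite le_eqVlt; apply/orP; left; apply/eqP; field; rewrite gt_eqF.
Qed.

Lemma ip_cauchy D f g : measurable D -> sqint mu D f -> sqint mu D g ->
  ip mu D f g ^+ 2 <= ip mu D f f * ip mu D g g.
Proof.
move=> mD Lf Lg; have F0 := ip_ge0 D f; have G0 := ip_ge0 D g.
have P (t : R) : 0 <= t ^+ 2 * ip mu D f f - 2 * t * ip mu D f g + ip mu D g g.
  have := ip_ge0 D (fun x => t * f x - g x).
  rewrite ipBl ?ipBr ?ipZl ?ipZr//; try by [exact: sqintZ|apply: sqintB => //; exact: sqintZ].
  rewrite [ip mu D g f]ipC => h; apply: le_trans h _.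
  by rewrite le_eqVlt; apply/orP; left; apply/eqP; ring.
have [f0|f0] := eqVneq (ip mu D f f) 0.
  rewrite f0 in P *; rewrite mul0r.
  have [->|n0] := eqVneq (ip mu D f g) 0; first by rewrite expr0n.
  (* With [ip mu D f f = 0] the polynomial is affine in [t], and this [t] gives it the value
     [- 1]. *)
  have := P ((ip mu D g g + 1) / (2 * ip mu D f g)).
  suff -> : ((ip mu D g g + 1) / (2 * ip mu D f g)) ^+ 2 * 0 -
     2 * ((ip mu D g g + 1) / (2 * ip mu D f g)) * ip mu D f g + ip mu D g g = - 1 by lra.
  by field.
have fp : 0 < ip mu D f f by rewrite lt_def f0.
have := P (ip mu D f g / ip mu D f f).
have -> : (ip mu D f g / ip mu D f f) ^+ 2 * ip mu D f f -
   2 * (ip mu D f g / ip mu D f f) * ip mu D f g + ip mu D g g =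
   (ip mu D f f * ip mu D g g - ip mu D f g ^+ 2) / ip mu D f f by field.
by rewrite pmulr_lge0 ?invr_gt0// subr_ge0.
Qed.

Lemma ipD_le D f g : measurable D -> sqint mu D f -> sqint mu D g ->
  ip mu D (fun x => f x + g x) (fun x => f x + g x) <= 2 * ip mu D f f + 2 * ip mu D g g.
Proof.
move=> mD Lf Lg; have := ip_ge0 D (fun x => f x - g x).
rewrite ipBl ?ipBr//; last exact: sqintB.
rewrite ipDl ?ipDr//; last exact: sqintD.
rewrite [ip mu D g f]ipC; lra.
Qed.

Lemma ip_eq0_ae D f : measurable D -> sqint mu D f -> ip mu D f f = 0 ->
  {ae mu, forall x, D x -> f x = 0}.
Proof.
move=> mD Lf f0; case: (Lf) => mf If.
have : (\int[mu]_(x in D) `|((f x) ^+ 2)%:E| = 0)%E.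
  under eq_integral do rewrite gee0_abs ?lee_fin ?sqr_ge0//.
  by rewrite -ip_sqint// f0.
move/ae_eq_integral_abs => /(_ mD) h.
apply: filterS (h _); last exact: (measurable_int mu If).
by move=> x /= hx Dx; move: (hx Dx) => [] /eqP; rewrite sqrf_eq0 => /eqP.
Qed.

End SquareIntegrable.

(** * Schur's test for integral operators with nonnegative kernels *)

Section Schur.
Context d d' (X : measurableType d) (Y : measurableType d') (R : realType).
Section Defs.
Variables (mu : set X -> \bar R) (nu : set Y -> \bar R).

(** The two integral bounds are the hypotheses of Schur's test. The pointwise bound [C] does not
    enter the final estimate; with the row bound it puts every [k x] in L^2, so that [Kop] is a
    genuine pairing. *)
Definition kernel_bound (k : X -> Y -> R) (A B : R) :=
  [/\ measurable_fun setT (fun z : X * Y => k z.1 z.2),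
      forall x y, 0 <= k x y,
      exists C : R, forall x y, k x y <= C,
      forall x, (\int[nu]_y (k x y)%:E <= A%:E)%E &
      forall y, (\int[mu]_x (k x y)%:E <= B%:E)%E].

Definition Kop (k : X -> Y -> R) (f : Y -> R) (x : X) : R :=
  ip nu setT f (k x).

End Defs.

Variables (mu : {sigma_finite_measure set X -> \bar R}).
Variables (nu : {sigma_finite_measure set Y -> \bar R}).
Variables (k : X -> Y -> R) (A B : R) (kb : kernel_bound mu nu k A B).

Let mk : measurable_fun setT (fun z : X * Y => k z.1 z.2).
Proof. by case: kb. Qed.
Let k0 x y : 0 <= k x y. Proof. by case: kb. Qed.

Let mkx x : measurable_fun setT (k x).
Proof. exact: (measurableT_comp mk (measurable_pair1 x)). Qed.

Let mky y : measurable_fun setT (k ^~ y).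
Proof. exact: (measurableT_comp mk (measurable_pair2 y)). Qed.

Lemma kernel_sqint x : sqint nu setT (k x).
Proof.
have [_ _ [C kC] kA _] := kb.
apply/sqintP; split => //.
apply: (@le_lt_trans _ _ (C%:E * \int[nu]_y (k x y)%:E)%E).
  rewrite -ge0_integralZl//.
  - apply: ge0_le_integral => //.
    + by move=> y _; rewrite lee_fin sqr_ge0.
    + by apply/measurable_EFinP; exact: measurable_funX.
    + by apply/measurable_EFinP; exact: measurable_funM.
    + by move=> y _; rewrite -EFinM lee_fin expr2 ler_wpM2r.
  - exact/measurable_EFinP.
  - by move=> y _; rewrite lee_fin.
  - by rewrite lee_fin (le_trans _ (kC x point)).
apply: (@le_lt_trans _ _ (C%:E * A%:E)%E); last by rewrite -EFinM ltry.
by apply: lee_wpmul2l => //; rewrite lee_fin (le_trans _ (kC x point)).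
Qed.

Lemma Kop_ip f x : Kop nu k f x = ip nu setT f (k x).
Proof. by []. Qed.

Lemma measurable_Kop f : measurable_fun setT f -> measurable_fun setT (Kop nu k f).
Proof.
move=> mf; rewrite /Kop /ip.
pose g (z : X * Y) := (f z.2 * k z.1 z.2)%:E.
have mg : measurable_fun setT g.
  apply/measurable_EFinP; apply: measurable_funM => //.
  exact: measurableT_comp.
apply: (@measurableT_comp _ _ _ _ _ _ fine) => //.
(* Tonelli gives measurability of partial integrals of nonnegative functions only, hence the
   splitting into positive and negative parts. *)
have -> : (fun x => \int[nu]_y (f y * k x y)%:E)%E =
    ((fun x => \int[nu]_y g^\+ (x, y)) \- (fun x => \int[nu]_y g^\- (x, y)))%E.
  apply/funext => x; rewrite integralE.
  by congr (_ - _)%E; apply: eq_integral => y _; rewrite /= ?funeposE ?funenegE.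
apply: emeasurable_funB; apply: measurable_fun_fubini_tonelli_F => //.
- exact: measurable_funepos.
- exact: measurable_funeneg.
Qed.

(** Cauchy-Schwarz after writing the kernel as [s * s] with [s] its square root: one factor carries
    [f], the other has squared norm at most [A]. *)
Lemma Kop_sqr_le f x : sqint nu setT f ->
  (((Kop nu k f x) ^+ 2)%:E <= A%:E * \int[nu]_y ((f y) ^+ 2 * k x y)%:E)%E.
Proof.
move=> Lf; have [mf If] := Lf.
have [_ _ [C kC] kA _] := kb.
pose s y := Num.sqrt (k x y).
have ms : measurable_fun setT s.
  apply: (@measurableT_comp _ _ _ _ _ _ (@Num.sqrt R)) => //.
  by apply: continuous_measurable_fun; exact: sqrt_continuous.
have sE y : s y ^+ 2 = k x y by rewrite sqr_sqrtr.
have Ls : sqint nu setT s.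
  apply/sqintP; split => //; apply: (@le_lt_trans _ _ A%:E); last by rewrite ltry.
  apply: le_trans (kA x); rewrite le_eqVlt; apply/orP; left; apply/eqP.
  by apply: eq_integral => y _; rewrite sE.
have Lfs : sqint nu setT (fun y => s y * f y).
  apply: (@sqint_bM _ _ _ _ _ (Num.sqrt C)) => // y _.
  by rewrite ger0_norm ?sqrtr_ge0// ler_sqrt ?kC// (le_trans _ (kC x y)).
have -> : Kop nu k f x = ip nu setT (fun y => s y * f y) s.
  by rewrite /Kop !ipE; apply: eq_Rintegral => y _; rewrite mulrAC -expr2 sE mulrC.
rewrite (le_trans (y := ((ip nu setT s s) * ip nu setT (fun y => s y * f y) (fun y => s y * f y))%:E))//.
  by rewrite lee_fin mulrC ip_cauchy.
rewrite EFinM; apply: lee_pmul.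
- by rewrite lee_fin ip_ge0.
- by rewrite lee_fin ip_ge0.
- rewrite ip_sqint//; apply: le_trans (kA x); rewrite le_eqVlt; apply/orP; left; apply/eqP.
  by apply: eq_integral => y _; rewrite sE.
- rewrite ip_sqint//; rewrite le_eqVlt; apply/orP; left; apply/eqP.
  by apply: eq_integral => y _; rewrite exprMn sE mulrC.
Qed.

(** The pointwise bound [Kop_sqr_le] is integrated in [x]; after exchanging the integrals by
    Tonelli, the column bound [B] applies for each fixed [y]. *)
Lemma schur_ereal f : sqint nu setT f ->
  (\int[mu]_x ((Kop nu k f x) ^+ 2)%:E <= (A * B * ip nu setT f f)%:E)%E.
Proof.
move=> Lf; have [mf If] := Lf; have [_ _ _ kA kB] := kb.
have A0 : (0 <= A%:E)%E.
  by apply: le_trans (kA point); apply: integral_ge0 => y _; rewrite lee_fin.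
pose g (z : X * Y) := ((f z.2) ^+ 2 * k z.1 z.2)%:E.
have mg : measurable_fun setT g.
  apply/measurable_EFinP; apply: measurable_funM => //; apply: measurable_funX.
  exact: measurableT_comp.
have g0 z : (0 <= g z)%E by rewrite lee_fin mulr_ge0// sqr_ge0.
apply: (@le_trans _ _ (\int[mu]_x (A%:E * \int[nu]_y g (x, y)))%E).
  apply: ge0_le_integral => //.
  - by move=> x _; rewrite lee_fin sqr_ge0.
  - by apply/measurable_EFinP/measurable_funX; exact: measurable_Kop.
  - by apply: measurable_funeM; exact: measurable_fun_fubini_tonelli_F.
  - by move=> x _; exact: Kop_sqr_le.
rewrite ge0_integralZl//; last 2 first.
  exact: measurable_fun_fubini_tonelli_F.
  by move=> x _; apply: integral_ge0.
rewrite -mulrA EFinM; apply: lee_wpmul2l => //.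
rewrite (fubini_tonelli g mg g0).
apply: (@le_trans _ _ (\int[nu]_y (B%:E * ((f y) ^+ 2)%:E))%E).
  apply: ge0_le_integral => //.
  - by move=> y _; apply: integral_ge0.
  - exact: measurable_fun_fubini_tonelli_G.
  - by apply: measurable_funeM; apply/measurable_EFinP/measurable_funX.
  - move=> y _; rewrite /g/=; under eq_integral do rewrite EFinM.
    rewrite ge0_integralZl ?lee_fin ?sqr_ge0//; try exact/measurable_EFinP;
      try by (move=> x _; rewrite lee_fin).
    by rewrite muleC; apply: lee_wpmul2r; rewrite ?lee_fin ?sqr_ge0.
rewrite ge0_integralZl//; last 3 first.
- by apply/measurable_EFinP/measurable_funX.
- by move=> y _; rewrite lee_fin sqr_ge0.
- by apply: le_trans (kB point); apply: integral_ge0 => x _; rewrite lee_fin.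
by rewrite EFinM ip_sqint.
Qed.

Lemma Kop_sqint f : sqint nu setT f -> sqint mu setT (Kop nu k f).
Proof.
move=> Lf; apply/sqintP; split; first by apply: measurable_Kop; case: Lf.
by apply: le_lt_trans (schur_ereal Lf) _; rewrite ltry.
Qed.

Lemma schur f : sqint nu setT f ->
  ip mu setT (Kop nu k f) (Kop nu k f) <= A * B * ip nu setT f f.
Proof.
by move=> Lf; rewrite -lee_fin ip_sqint ?schur_ereal//; exact: Kop_sqint.
Qed.

Lemma KopD (a : R) f g : sqint nu setT f -> sqint nu setT g ->
  Kop nu k (fun y => a * f y + g y) = fun x => a * Kop nu k f x + Kop nu k g x.
Proof.
move=> Lf Lg; apply/funext => x; rewrite !Kop_ip ipDl ?ipZl//.
- exact: kernel_sqint.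
- exact: sqintZ.
- exact: kernel_sqint.
Qed.

End Schur.

Lemma sq_dct d (T : measurableType d) (R : realType)
    (mu : {measure set T -> \bar R}) (D : set T) (f_ : nat -> T -> R) (f g : T -> R) :
  measurable D -> (forall n, measurable_fun D (f_ n)) -> measurable_fun D f ->
  sqint mu D g ->
  (forall x, D x -> f_ ^~ x @ \oo --> f x) ->
  (forall n x, D x -> `|f_ n x - f x| <= g x) ->
  forall e : R, 0 < e -> exists N, forall n, (N <= n)%N ->
    ip mu D (fun x => f_ n x - f x) (fun x => f_ n x - f x) < e.
Proof.
move=> mD mf_ mf Lg cf fg e e0.
have Ld n : sqint mu D (fun x => f_ n x - f x).
  apply: (@sqint_le _ _ _ _ _ _ g) => //; first exact: measurable_funB.
  by move=> x Dx; rewrite (le_trans (fg _ _ Dx))// ler_norm.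
have [|||||_ _] := @dominated_convergence _ _ _ mu D mD
  (fun n x => ((f_ n x - f x) ^+ 2)%:E) (cst 0%E) (fun x => ((g x) ^+ 2)%:E).
- by move=> n; apply/measurable_EFinP/measurable_funX/measurable_funB.
- exact: measurable_cst.
- apply: aeW => x Dx; apply/fine_cvgP; split; first exact: nearW.
  have h0 : (f_ n x - f x) @[n --> \oo] --> f x - f x.
    by apply: cvgB; [exact: cf|exact: cvg_cst].
  have h1 : (f_ n x - f x) * (f_ n x - f x) @[n --> \oo] --> (f x - f x) * (f x - f x).
    exact: cvgM.
  rewrite subrr mulr0 in h1.
  by apply: cvg_trans h1; apply: near_eq_cvg; apply: nearW => n; rewrite /= expr2.
- by case: Lg.
- by apply: aeW => x n Dx; rewrite /= lee_fin ger0_norm ?sqr_ge0//;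
    rewrite -real_normK ?num_real// ler_sqr ?nnegrE ?(le_trans _ (fg n x Dx))// fg.
rewrite integral0 => /fine_cvgP[_] /cvgrPdist_lt /(_ _ e0)[N _ hN].
exists N => n /hN /=; rewrite sub0r normrN.
rewrite -ip_sqint//= ger0_norm ?ip_ge0//.
Qed.

(** * Convergence of approximate identities in L^2, from a generating class of sets *)

Section ApproximateIdentity.
Context d (T : measurableType d) (R : realType).

Definition approx (mu : set T -> \bar R) (k : nat -> T -> T -> R) (f : T -> R) :=
  sqint mu setT f /\
  forall e : R, 0 < e -> exists N, forall n, (N <= n)%N ->
    ip mu setT (fun x => Kop mu (k n) f x - f x) (fun x => Kop mu (k n) f x - f x) < e.

Variables (mu : {sigma_finite_measure set T -> \bar R}).
Variables (k : nat -> T -> T -> R) (kb : forall n, kernel_bound mu mu (k n) 1 1).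
Implicit Types f g : T -> R.

Local Notation nrm f := (ip mu setT f f).

Let LK n f : sqint mu setT f -> sqint mu setT (Kop mu (k n) f).
Proof. exact: Kop_sqint. Qed.

Let LKB n f : sqint mu setT f -> sqint mu setT (fun x => Kop mu (k n) f x - f x).
Proof. by move=> Lf; apply: sqintB => //; exact: LK. Qed.

Lemma approxD (a : R) f g : approx mu k f -> approx mu k g ->
  approx mu k (fun x => a * f x + g x).
Proof.
move=> [Lf Hf] [Lg Hg]; split; first by apply: sqintD => //; exact: sqintZ.
move=> e e0.
pose c := 2 * a ^+ 2 + 2; have c0 : 0 < c by rewrite /c; have := sqr_ge0 a; lra.
have ec0 : 0 < e / (2 * c) by rewrite divr_gt0// mulr_gt0.
have [N1 h1] := Hf _ ec0; have [N2 h2] := Hg _ ec0.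
exists (maxn N1 N2) => n; rewrite geq_max => /andP[/h1 {}h1 /h2 {}h2].
rewrite (KopD (kb n))//.
rewrite (_ : (fun x => _) = (fun x => a * (Kop mu (k n) f x - f x) + (Kop mu (k n) g x - g x))); last first.
  by apply/funext => x; ring.
apply: le_lt_trans (ipD_le _ _ _) _ => //; [by apply: sqintZ => //; exact: LKB|exact: LKB|].
rewrite ipZl ?ipZr//; try by [exact: LKB|apply: sqintZ => //; exact: LKB].
set u := ip _ _ _ _ in h1 *; set v := ip _ _ _ _ in h2 *.
have u0 : 0 <= u by exact: ip_ge0.
have -> : e = c * (e / (2 * c)) + c * (e / (2 * c)) by field; rewrite gt_eqF.
apply: ltr_leD.
  apply: (@le_lt_trans _ _ (c * u)); last by rewrite ltr_pM2l.
  rewrite /c; nra.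
apply: (@le_trans _ _ (c * v)); last by rewrite ler_pM2l// ltW.
have v0 : 0 <= v by exact: ip_ge0.
rewrite /c; nra.
Qed.

(** With both kernel bounds equal to 1, Schur's test makes every operator an L^2 contraction. The
    functions that are approximated thus form a closed set: the error of [f] is at most the error of
    [g] plus twice the distance, up to constants. *)
Lemma approx_lim f : sqint mu setT f ->
  (forall e : R, 0 < e -> exists2 g, approx mu k g & nrm (fun x => f x - g x) < e) ->
  approx mu k f.
Proof.
move=> Lf H; split => // e e0.
have e8 : 0 < e / 16 by rewrite divr_gt0.
have [g [Lg Hg] fg] := H _ e8; have [N hN] := Hg _ e8.
exists N => n /hN {}hN.
have Lfg : sqint mu setT (fun x => f x - g x) by exact: sqintB.
have LKfg := LK n Lfg.
rewrite (_ : (fun x => _) = (fun x => (Kop mu (k n) (fun y => f y - g y) x +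
   (Kop mu (k n) g x - g x)) + (-1) * (f x - g x))); last first.
  apply/funext => x; rewrite -[in RHS](_ : (fun y => (-1) * g y + f y) = (fun y => f y - g y)).
    by rewrite (KopD (kb n))//; ring.
  by apply/funext => y; ring.
have L1 : sqint mu setT (fun x => Kop mu (k n) (fun y => f y - g y) x + (Kop mu (k n) g x - g x)).
  by apply: sqintD => //; exact: LKB.
apply: le_lt_trans (ipD_le _ L1 (sqintZ _ _ Lfg)) _ => //.
rewrite ipZl ?ipZr//; last exact: sqintZ.
have := ipD_le measurableT LKfg (LKB n Lg).
have := schur (kb n) Lfg; rewrite !mul1r.
lra.
Qed.

Lemma sqint_indic (E : set T) : measurable E -> (mu E < +oo)%E ->
  sqint mu setT (\1_E).
Proof.
move=> mE Efin; apply/sqintP; split; first exact: measurable_indic.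
rewrite (_ : (\int[mu]_x _)%E = \int[mu]_x (\1_E x)%:E)%E.
  by rewrite integral_indic// setIT.
apply: eq_integral => x _.
by rewrite !indicE; case: (x \in E); rewrite ?expr1n ?expr0n.
Qed.

Lemma nrm_indic (E : set T) : measurable E -> nrm (\1_E) = fine (mu E).
Proof.
move=> mE; rewrite /ip; congr fine.
transitivity (\int[mu]_x (\1_E x)%:E)%E; last by rewrite integral_indic// setIT.
apply: eq_integral => x _.
by rewrite !indicE; case: (x \in E); rewrite ?mulr1 ?mulr0.
Qed.

Section Generated.
Variables (G : set (set T)) (GI : setI_closed G).
Hypothesis Gm : @measurable _ T = <<s G >>.
Hypothesis Gfin : forall A, G A -> (mu A < +oo)%E.
Hypothesis GK : forall A, G A -> approx mu k (\1_A).

(** Dynkin's argument: the sets [E] with this property form a lambda-system that contains the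
    pi-system [G]. Differences are handled by linearity and increasing unions by [approx_lim];
    intersecting with [B] keeps the measures finite, hence the indicators in L^2. *)
Lemma approx_indic (B E : set T) : G B -> measurable E -> approx mu k (\1_(E `&` B)).
Proof.
move=> GB.
have mG (A : set T) : G A -> measurable A.
  by move=> GA; rewrite Gm; exact: sub_sigma_algebra.
have mB := mG _ GB; have Bfin := Gfin GB.
have Lfin (F : set T) : measurable F -> (mu (F `&` B) < +oo)%E.
  by move=> mF; apply: le_lt_trans Bfin; apply: le_measure;
    rewrite ?inE//; exact: measurableI.
pose H := [set F : set T | measurable F /\ approx mu k (\1_(F `&` B))].
suff : @measurable _ T `<=` H by move=> h /h[].
rewrite Gm; apply: lambda_system_subset => //.
- split => //.
  + by split => //; rewrite setTI; exact: GK.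
  + move=> F F' F'F [mF HF] [mF' HF']; split; first exact: measurableD.
    have := approxD (-1) HF' HF; congr (approx mu k); apply/funext => x.
    rewrite setDE !indicE !in_setI in_setC.
    have [xF'|xF'] := boolP (x \in F') => /=; last by rewrite andbT mulr0 add0r.
    have -> : x \in F by rewrite inE; apply: F'F; rewrite -inE.
    by case: (x \in B); rewrite /= ?mulr1 ?mulr0 ?addr0 // addNr.
  + move=> F ndF HF.
    have mF n : measurable (F n) by case: (HF n).
    have mU : measurable (\bigcup_n F n) by exact: bigcupT_measurable.
    split => //.
    have mFB n : measurable (F n `&` B) by exact: measurableI.
    apply: approx_lim.
      by apply: sqint_indic; [exact: measurableI|exact: Lfin].
    move=> e e0.
    have cv : mu \o (fun n => F n `&` B) @ \oo --> mu (\bigcup_n (F n `&` B)).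
      apply: nondecreasing_cvg_mu => //; first exact: bigcupT_measurable.
      by move=> m n mn; apply/subsetPset; apply: setSI; apply/subsetPset/ndF.
    rewrite -setI_bigcupl in cv.
    have UE : mu (\bigcup_n F n `&` B) = (fine (mu (\bigcup_n F n `&` B)))%:E.
      by rewrite fineK// ge0_fin_numE//; exact: Lfin.
    rewrite UE in cv.
    move/fine_cvgP : cv => -[_].
    move/cvgrPdist_lt => /(_ _ e0) [N _ hN].
    exists (\1_(F N `&` B)); first by case: (HF N).
    have sub : F N `&` B `<=` \bigcup_n F n `&` B.
      by apply: setSI => x Fx; exists N.
    rewrite (_ : (fun x => _) = \1_((\bigcup_n F n `&` B) `\` (F N `&` B))); last first.
      apply/funext => x; rewrite setDE !indicE [in RHS]in_setI in_setC.
      have [xF|xF] := boolP (x \in F N `&` B); last by rewrite andbT subr0.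
      have -> : x \in \bigcup_n F n `&` B by rewrite inE; apply: sub; rewrite -inE.
      by rewrite /= subrr.
    have mUB : measurable (\bigcup_n F n `&` B) by exact: measurableI.
    rewrite nrm_indic; last exact: measurableD.
    rewrite measureD//; last exact: Lfin.
    rewrite (setIidr sub) fineB ?ge0_fin_numE//; try exact: Lfin.
    by apply: le_lt_trans (hN N (leqnn N)); rewrite ler_norm.
- by move=> A GA; split; [exact: mG|apply/GK/GI].
Qed.

Import HBNNSimple.
Variables (B_ : nat -> set T) (GB : forall n, G (B_ n)).
Hypothesis B_lim : forall x, exists N, forall n, (N <= n)%N -> B_ n x.

Lemma approx0 : approx mu k (cst 0).
Proof.
have := approxD (-1) (GK (GB 0%N)) (GK (GB 0%N)).
by congr (approx mu k); apply/funext => x; rewrite mulN1r addNr.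
Qed.

Lemma approx_sfun (B : set T) (f : {nnsfun T >-> R}) : G B ->
  approx mu k (fun x => f x * \1_B x).
Proof.
move=> GB'; have mB : measurable B by rewrite Gm; exact: sub_sigma_algebra.
have [s fs] : exists s : seq R, forall x, f x = \sum_(i <- s) i * \1_(f @^-1` [set i]) x.
  exists (finmap.enum_fset (fset_set (range f))) => x.
  by rewrite [LHS]fimfunE fsbig_finite.
rewrite (_ : (fun x => _) = (fun x => \sum_(i <- s) i * \1_((f @^-1` [set i]) `&` B) x)); last first.
  apply/funext => x; rewrite fs big_distrl /=.
  by apply: eq_bigr => i _; rewrite indicI/= mulrA.
elim: s {fs} => [|i s IH].
  rewrite (_ : (fun x => _) = cst 0); first exact: approx0.
  by apply/funext => x; rewrite big_nil.
rewrite (_ : (fun x => _) = (fun x => i * \1_((f @^-1` [set i]) `&` B) x + (\sum_(i <- s) i * \1_((f @^-1` [set i]) `&` B) x))); last first.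
  by apply/funext => x; rewrite big_cons.
by apply: approxD => //; apply: approx_indic.
Qed.

(** Increasing simple functions are truncated to the exhausting sets [B_ n], so that they fall under
    [approx_sfun]; they converge to [f] in L^2 by dominated convergence with [f] itself as the
    bound. *)
Lemma approx_ge0 f : sqint mu setT f -> (forall x, 0 <= f x) -> approx mu k f.
Proof.
move=> Lf f0; apply: approx_lim => // e e0; have [mf _] := Lf.
have mEf : measurable_fun setT (EFin \o f) by exact/measurable_EFinP.
pose g n := nnsfun_approx measurableT mEf n.
have mB n : measurable (B_ n) by rewrite Gm; apply: sub_sigma_algebra.
have cg x : (g n x) @[n --> \oo] --> f x.
  have := @cvg_nnsfun_approx _ _ _ _ measurableT (EFin \o f) mEf (fun x _ => f0 x) x I.
  by move/fine_cvgP => [].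
have gf n x : g n x <= f x.
  have /cvg_lim <- := cg x => //.
  apply: nondecreasing_cvgn_le; last by apply/cvg_ex; exists (f x); exact: cg.
  by move=> p q pq; have /lefP := nd_nnsfun_approx measurableT mEf pq; apply.
pose h n x := g n x * \1_(B_ n) x.
have hbd n x : 0 <= h n x <= f x.
  rewrite /h indicE; case: (x \in B_ n); rewrite ?mulr1 ?mulr0 ?lexx ?f0//.
  by rewrite gf andbT.
have [n|x _|n x _|N hN] := @sq_dct _ _ _ mu setT h f f measurableT _ mf Lf _ _ e e0.
- by apply: measurable_funM => //; exact: measurable_indic.
- have [N hN] := B_lim x.
  apply: cvg_trans (cg x); apply: near_eq_cvg; exists N => // n /= /hN Bx.
  by rewrite /h indicE mem_set// mulr1.
- have /andP[h1 h2] := hbd n x.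
  by rewrite distrC ger0_norm ?subr_ge0// gerBl.
exists (h N); first exact: approx_sfun.
have := hN N (leqnn N); congr (_ < _); rewrite !ipE; apply: eq_Rintegral => x _.
by rewrite -mulrNN !opprB.
Qed.

Lemma approx_sqint f : sqint mu setT f -> approx mu k f.
Proof.
move=> Lf; have [mf _] := Lf.
have Lp : sqint mu setT (f^\+).
  apply: (@sqint_le _ _ _ _ _ _ f) => //; first exact: measurable_funrpos.
  move=> x _; rewrite ger0_norm ?funrpos_ge0// /funrpos maxEle.
  by case: ifP; rewrite ?normr_ge0// ler_norm.
have Ln : sqint mu setT (f^\-).
  apply: (@sqint_le _ _ _ _ _ _ f) => //; first exact: measurable_funrneg.
  move=> x _; rewrite ger0_norm ?funrneg_ge0// /funrneg maxEle.
  by case: ifP; rewrite ?normr_ge0// -normrN ler_norm.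
have := approxD (-1) (approx_ge0 Ln (fun x => funrneg_ge0 _ _)) (approx_ge0 Lp (fun x => funrpos_ge0 _ _)).
congr (approx mu k); apply/funext => x; by rewrite -[in RHS](funrposBneg f) mulN1r addrC.
Qed.

End Generated.

End ApproximateIdentity.

(** The sigma-algebra on the plane is the product one, so an open set is exhibited as a countable
    union of rectangles with rational vertices. *)
Lemma open_measurable2 (R : realType) (U : set (R * R)) : open U ->
  measurable (U : set (measurableTypeR R * measurableTypeR R)%type).
Proof.
move=> oU.
pose B (q : rat * rat * (rat * rat)) : set (measurableTypeR R * measurableTypeR R)%type :=
  `]ratr q.1.1, ratr q.1.2[%classic `*` `]ratr q.2.1, ratr q.2.2[%classic.
rewrite (_ : U = \bigcup_(q : rat * rat * (rat * rat)) (if `[< B q `<=` U >] then B q else set0)).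
  apply: countable_bigcupT_measurable; first exact: countableP.
  by move=> q; case: ifP => // _; apply: measurableX; exact: measurable_itv.
apply/seteqP; split=> [x Ux|x [q _]]; last first.
  by case: ifP => // /asboolP h /h.
have /nbhs_ballP[e /= e0 he] := open_nbhs_nbhs (conj oU Ux).
have rl (s : R) : s - e < s by rewrite gtrBl.
have rr (s : R) : s < s + e by rewrite ltrDl.
have [a] := rat_in_itvoo (rl x.1); rewrite in_itv/= => /andP[a1 a2].
have [b] := rat_in_itvoo (rr x.1); rewrite in_itv/= => /andP[b1 b2].
have [c] := rat_in_itvoo (rl x.2); rewrite in_itv/= => /andP[c1 c2].
have [d] := rat_in_itvoo (rr x.2); rewrite in_itv/= => /andP[d1 d2].
exists (a, b, (c, d)) => //.
rewrite asboolT /B/=.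
  by split; rewrite /= in_itv /= ?a2 ?b1 ?c2 ?d1.
move=> y [] /=; rewrite !in_itv/= => /andP[h1 h2] /andP[h3 h4].
apply: he; split; rewrite /ball/= ltr_norml; apply/andP; split; lra.
Qed.

Lemma continuous_measurable_fun2 (R : realType) (f : R * R -> R) : continuous f ->
  measurable_fun setT (f : (measurableTypeR R * measurableTypeR R)%type -> R).
Proof.
move=> /continuousP cf; apply: (measurability _ (RGenOpens.measurableE R)) => //.
move=> _ [_ [x [y ->]] <-]; rewrite setTI; apply: open_measurable2.
by apply: cf; exact: interval_open.
Qed.

(** * Calculus on the plane *)

Section FTC.
Context {R : realType}.
Notation mu := (@lebesgue_measure R).

Lemma FTC_segment (f f' : R -> R) (a b : R) : a <= b ->
  (forall s : R, is_derive s (1 : R) f (f' s)) -> continuous f' ->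
  \int[mu]_(x in `[a, b]) f' x = f b - f a.
Proof.
move=> ab df cf'; have cf : continuous f.
  by move=> x; apply/differentiable_continuous/derivable1_diffP.
have [->|ne] := eqVneq a b; first by rewrite set_itv1 Rintegral_set1 subrr.
have {ne}ab : a < b by rewrite lt_neqAle ne.
rewrite /Rintegral (@continuous_FTC2 _ f' f a b ab) -?EFinB//.
- exact: continuous_subspaceT.
- split; first by move=> x _; apply: (@ex_derive _ _ _ _ _ _ _ (df x)).
  + by apply: cvg_at_right_filter; exact: cf.
  + by apply: cvg_at_left_filter; exact: cf.
- by move=> x _; rewrite derive1E; apply: derive_val.
Qed.

Lemma continuous_segment_integrable (f : R -> R) (a b : R) : continuous f ->
  mu.-integrable `[a, b] (EFin \o f).
Proof.
move=> cf; apply: continuous_compact_integrable; first exact: segment_compact.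
exact: continuous_subspaceT.
Qed.

Lemma integrable_bounded_support (f : R -> R) (a b : R) : continuous f ->
  (forall s, ~~ (a <= s <= b) -> f s = 0) -> mu.-integrable setT (EFin \o f).
Proof.
move=> cf f0; rewrite (_ : EFin \o f = (EFin \o f) \_ `[a, b]).
  apply/(@integrable_mkcond _ _ _ mu `[a, b] (EFin \o f)) => //.
  exact: continuous_segment_integrable.
apply/funext => x; rewrite patchE; case: ifPn => //.
by rewrite notin_setE /= in_itv/= => /negP/f0 /= ->.
Qed.

Lemma Rintegral_bounded_support (f : R -> R) (D : set R) (a b : R) :
  measurable D -> `[a, b] `<=` D ->
  (forall s, D s -> ~~ (a <= s <= b) -> f s = 0) ->
  \int[mu]_(x in D) f x = \int[mu]_(x in `[a, b]) f x.
Proof.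
move=> mD abD f0; rewrite Rintegral_mkcond [RHS]Rintegral_mkcond.
apply: eq_Rintegral => x _; rewrite !patchE.
case: ifPn => [Dx|nDx]; last first.
  by rewrite ifN//; apply: contra nDx; rewrite !inE; exact: abD.
case: ifPn => //; rewrite notin_setE /= in_itv/= => /negP; apply: f0.
by rewrite inE in Dx.
Qed.

Lemma integral_derive_line (f f' : R -> R) (L : R) : 0 <= L ->
  (forall s : R, is_derive s (1 : R) f (f' s)) -> continuous f' ->
  (forall s, ~~ (- L <= s <= L) -> f' s = 0) -> f (- L) = 0 -> f L = 0 ->
  \int[mu]_s f' s = 0.
Proof.
move=> L0 df cf' f'0 fl fr; rewrite (@Rintegral_bounded_support _ _ (- L) L)//; last first.
  by move=> s _; exact: f'0.
by rewrite (FTC_segment _ df)// ?fr ?fl ?subrr//; lra.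
Qed.

Lemma integral_derive_halfline (f f' : R -> R) (L : R) : 0 <= L ->
  (forall s : R, is_derive s (1 : R) f (f' s)) -> continuous f' ->
  (forall s, ~~ (- L <= s <= L) -> f' s = 0) -> f L = 0 ->
  \int[mu]_(s in [set s | 0 < s]) f' s = - f 0.
Proof.
move=> L0 df cf' f'0 fr.
have -> : [set s : R | 0 < s] = `]0, +oo[%classic.
  by apply/seteqP; split => s /=; rewrite in_itv/= andbT.
have If : mu.-integrable `]0, +oo[ (EFin \o f').
  apply: (@integrableS _ _ _ _ setT) => //.
  exact: (@integrable_bounded_support _ (- L) L).
rewrite Rintegral_itv_obnd_cbnd//.
rewrite (@Rintegral_bounded_support _ _ 0 L)//.
- by rewrite (FTC_segment _ df)// fr sub0r.
- by move=> s /=; rewrite !in_itv/= andbT => /andP[].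
- move=> s /=; rewrite in_itv/= andbT => s0 h; apply: f'0.
  by apply: contra h => /andP[_ ->]; rewrite s0.
Qed.

End FTC.

(** * Functions of two variables with explicit partial derivatives *)

Section PlaneCalculus.
Context {R : realType}.
Implicit Types (f g : R * R -> R) (x v : R * R).

(** A quadratic remainder is stronger than the little-o of the definition, but it is what splines
    and mollified functions provide, and it survives integration in a parameter. *)
Lemma is_diff_taylor f x (a b C : R) :
  (forall z : R * R, `|z| <= 1 ->
    `|f (z + x) - f x - (z.1 * a + z.2 * b)| <= C * `|z| ^+ 2) ->
  is_diff x f (fun v => v.1 * a + v.2 * b).
Proof.
move=> H; pose df (v : R * R) : R := v.1 * a + v.2 * b.
have ldf : linear df.
  by move=> k u v; rewrite /df /= /GRing.scale /=; ring.
pose dfM := GRing.isLinear.Build _ _ _ _ _ ldf.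
pose dfL : {linear _ -> _} := HB.pack df dfM.
have cdf : continuous (dfL : R * R -> R).
  move=> z; rewrite /continuous_at /= /df.
  by apply: cvgD; apply: cvgMl; [exact: cvg_fst|exact: cvg_snd].
have nb (r : R) : 0 < r -> \forall z \near (0 : R * R), `|z| <= r.
  move=> r0; apply/nbhs_ballP; exists r => //= z [].
  rewrite /ball /= !sub0r !normrN => h1 h2.
  by rewrite prod_normE ge_max !ltW.
have key (e : R) : 0 < e -> \forall z \near (0 : R * R),
    `|f (z + x) - f x - (z.1 * a + z.2 * b)| <= e * `|z|.
  move=> e0; have [C0|C0] := leP C 0; near=> z.
    have z1 : `|z| <= 1 by near: z; exact: nb.
    apply: le_trans (H z z1) _; rewrite (le_trans (_ : _ <= 0))//; last first.
      by rewrite mulr_ge0 ?(ltW e0).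
    by rewrite mulr_le0_ge0.
  have z1 : `|z| <= 1 by near: z; exact: nb.
  apply: le_trans (H z z1) _; rewrite expr2 mulrA ler_wpM2r//.
  rewrite -ler_pdivlMl//.
  by near: z; apply: nb; rewrite mulr_gt0 ?invr_gt0//.
have dE : 'd f x = dfL :> (R * R -> R).
  apply: diff_unique => //; apply/eqaddoP => _ /posnumP[e].
  near=> z; rewrite !fctE /= opprD addrA.
  by near: z; exact: key.
apply: DiffDef; last by rewrite dE.
apply/diff_locallyP; rewrite dE; split => //; apply/eqaddoP => _ /posnumP[e].
near=> z; rewrite !fctE /= opprD addrA.
by near: z; exact: key.
Unshelve. all: by end_near. Qed.

(** The partial derivatives are carried as explicit functions, so that products and compositions
    compute them; [C1_C1g] and [C1g_C1] translate from and to [C1]. *)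
Definition C1g f f1 f2 := [/\ forall x, is_diff x f (fun v => v.1 * f1 x + v.2 * f2 x),
  continuous f1 & continuous f2].

Lemma C1g_cont f f1 f2 : C1g f f1 f2 -> continuous f.
Proof. by move=> [df _ _] x; apply: differentiable_continuous; case: (df x). Qed.

Lemma eq_C1g f f1 f2 g g1 g2 : C1g f f1 f2 -> f =1 g -> f1 =1 g1 -> f2 =1 g2 ->
  C1g g g1 g2.
Proof. by move=> h /funext <- /funext <- /funext <-. Qed.

Lemma C1g_cst (c : R) : C1g (cst c) (cst 0) (cst 0).
Proof.
split; [move=> x|exact: cst_continuous|exact: cst_continuous].
apply: (@is_diff_taylor _ _ _ _ 0) => z _.
by rewrite /= subrr !mulr0 !mul0r addr0 subrr normr0.
Qed.

Lemma C1g_fst : C1g fst (cst 1) (cst 0).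
Proof.
split; [move=> x|exact: cst_continuous|exact: cst_continuous].
apply: (@is_diff_taylor _ _ _ _ 0) => z _.
by rewrite /= mulr0 mulr1 mul0r addr0 addrK subrr normr0.
Qed.

Lemma C1g_snd : C1g snd (cst 0) (cst 1).
Proof.
split; [move=> x|exact: cst_continuous|exact: cst_continuous].
apply: (@is_diff_taylor _ _ _ _ 0) => z _.
by rewrite /= mulr0 mulr1 mul0r add0r addrK subrr normr0.
Qed.

Lemma C1gD f f1 f2 g g1 g2 : C1g f f1 f2 -> C1g g g1 g2 ->
  C1g (fun x => f x + g x) (fun x => f1 x + g1 x) (fun x => f2 x + g2 x).
Proof.
move=> [df c1 c2] [dg e1 e2]; split.
- move=> x; have h1 := df x; have h2 := dg x.
  apply: (@is_diff_eq _ _ _ _ _ _ _ (is_diffD h1 h2)).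
  by apply/funext => v; rewrite !fctE /=; ring.
- by move=> x; apply: cvgD; [exact: c1|exact: e1].
- by move=> x; apply: cvgD; [exact: c2|exact: e2].
Qed.

Lemma C1gM f f1 f2 g g1 g2 : C1g f f1 f2 -> C1g g g1 g2 ->
  C1g (fun x => f x * g x) (fun x => f x * g1 x + g x * f1 x)
    (fun x => f x * g2 x + g x * f2 x).
Proof.
move=> hf hg; have cf := C1g_cont hf; have cg := C1g_cont hg.
move: hf hg => [df c1 c2] [dg e1 e2]; split.
- move=> x; have h1 := df x; have h2 := dg x.
  apply: (@is_diff_eq _ _ _ _ _ _ _ (is_diffM h1 h2)).
  by apply/funext => v; rewrite !fctE /= /GRing.scale /=; ring.
- by move=> x; apply: cvgD; apply: cvgM; [exact: cf|exact: e1|exact: cg|exact: c1].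
- by move=> x; apply: cvgD; apply: cvgM; [exact: cf|exact: e2|exact: cg|exact: c2].
Qed.

Lemma C1gZ (c : R) f f1 f2 : C1g f f1 f2 ->
  C1g (fun x => c * f x) (fun x => c * f1 x) (fun x => c * f2 x).
Proof.
move=> h; apply: (eq_C1g (C1gM (C1g_cst c) h)) => x //=; by rewrite mulr0 addr0.
Qed.

Lemma C1gN f f1 f2 : C1g f f1 f2 ->
  C1g (fun x => - f x) (fun x => - f1 x) (fun x => - f2 x).
Proof. by move=> h; apply: (eq_C1g (C1gZ (-1) h)) => x; rewrite mulN1r. Qed.

Lemma C1gB f f1 f2 g g1 g2 : C1g f f1 f2 -> C1g g g1 g2 ->
  C1g (fun x => f x - g x) (fun x => f1 x - g1 x) (fun x => f2 x - g2 x).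
Proof. by move=> hf hg; exact: C1gD hf (C1gN hg). Qed.

Lemma C1g_comp (h h' : R -> R) f f1 f2 :
  (forall s : R, is_derive s (1 : R) h (h' s)) -> continuous h' -> C1g f f1 f2 ->
  C1g (fun x => h (f x)) (fun x => h' (f x) * f1 x) (fun x => h' (f x) * f2 x).
Proof.
move=> dh ch' hf; have cf := C1g_cont hf; move: hf => [df c1 c2].
have chf : continuous (fun x => h' (f x)).
  by move=> x; apply: (@continuous_comp _ _ _ f h'); [exact: cf|exact: ch'].
split.
- move=> x; have h1 := df x.
  have h2 : is_diff (f x) h (fun v : R => v * h' (f x)).
    have dhx := dh (f x).
    have dd : differentiable h (f x) by apply/derivable1_diffP.
    apply: DiffDef => //; rewrite diff1E//; apply/funext => v.
    by rewrite derive1E derive_val.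
  apply: (@is_diff_eq _ _ _ _ _ _ _ (is_diff_comp h1 h2)).
  by apply/funext => v /=; ring.
- by move=> x; apply: cvgM; [exact: chf|exact: c1].
- by move=> x; apply: cvgM; [exact: chf|exact: c2].
Qed.

Lemma C1g_deriveE f f1 f2 x v : C1g f f1 f2 -> 'D_v f x = v.1 * f1 x + v.2 * f2 x.
Proof.
move=> [df _ _]; have h := df x.
by rewrite deriveE ?diff_val//; case: h.
Qed.

Lemma C1g_derive1 f f1 f2 x : C1g f f1 f2 -> 'D_e1 f x = f1 x.
Proof. by move=> /C1g_deriveE ->; rewrite /= mul1r mul0r addr0. Qed.

Lemma C1g_derive2 f f1 f2 x : C1g f f1 f2 -> 'D_e2 f x = f2 x.
Proof. by move=> /C1g_deriveE ->; rewrite /= mul1r mul0r add0r. Qed.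

Lemma C1g_C1 f f1 f2 : C1g f f1 f2 -> C1 f.
Proof.
move=> h; split; first by case: h => df _ _ x; case: (df x).
move=> v; rewrite (_ : (fun x => _) = (fun x => v.1 * f1 x + v.2 * f2 x)).
  by case: h => _ c1 c2 x; apply: cvgD; apply: cvgMr; [exact: c1|exact: c2].
by apply/funext => x; rewrite (C1g_deriveE _ _ h).
Qed.

Lemma C1_C1g f : C1 f -> C1g f ('D_e1 f) ('D_e2 f).
Proof.
move=> [df cf]; split; [|exact: cf|exact: cf].
move=> x; apply: DiffDef; first exact: df.
apply/funext => v; rewrite !deriveE; try exact: df.
have -> : v = v.1 *: (e1 : R * R) + v.2 *: (e2 : R * R).
  transitivity (v.1 * 1 + v.2 * 0, v.1 * 0 + v.2 * 1) => //.
  by case: v => a b /=; rewrite !mulr1 !mulr0 addr0 add0r.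
by rewrite linearD !linearZ /= /GRing.scale/= !mulr1 !mulr0 addr0 add0r.
Qed.

Lemma C1g_slice1 f f1 f2 (b s : R) : C1g f f1 f2 ->
  is_derive s (1 : R) (fun t => f (t, b)) (f1 (s, b)).
Proof.
move=> [df _ _]; have h := df (s, b).
have hp : is_diff s (fun t : R => (t, b)) (fun v : R => (v, 0)).
  exact: (is_diff_pair (is_diff_id s) (is_diff_cst b s)).
have [d1 d2] := is_diff_comp hp h.
have dd : derivable (fun t => f (t, b)) s 1 by apply/derivable1_diffP.
apply: DeriveDef => //; rewrite deriveE; last exact/derivable1_diffP.
by have /(congr1 (fun F => F 1)) := d2; rewrite /= mul1r mul0r addr0.
Qed.

Lemma C1g_slice2 f f1 f2 (a s : R) : C1g f f1 f2 ->
  is_derive s (1 : R) (fun t => f (a, t)) (f2 (a, s)).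
Proof.
move=> [df _ _]; have h := df (a, s).
have hp : is_diff s (fun t : R => (a, t)) (fun v : R => (0, v)).
  exact: (is_diff_pair (is_diff_cst a s) (is_diff_id s)).
have [d1 d2] := is_diff_comp hp h.
have dd : derivable (fun t => f (a, t)) s 1 by apply/derivable1_diffP.
apply: DeriveDef => //; rewrite deriveE; last exact/derivable1_diffP.
by have /(congr1 (fun F => F 1)) := d2; rewrite /= mul1r mul0r add0r.
Qed.

Lemma continuous_slice1 f (b : R) : continuous f -> continuous (fun t => f (t, b)).
Proof.
move=> cf s; apply: (@continuous_comp _ _ _ (fun t => (t, b)) f); last exact: cf.
by apply: differentiable_continuous; case: (is_diff_pair (is_diff_id s) (is_diff_cst b s)).
Qed.

Lemma continuous_slice2 f (a : R) : continuous f -> continuous (fun t => f (a, t)).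
Proof.
move=> cf s; apply: (@continuous_comp _ _ _ (fun t => (a, t)) f); last exact: cf.
by apply: differentiable_continuous; case: (is_diff_pair (is_diff_cst a s) (is_diff_id s)).
Qed.

Lemma derive_outside f f1 f2 (A : set (R * R)) : C1g f f1 f2 -> closed A ->
  (forall x, ~ A x -> f x = 0) -> forall x, ~ A x -> f1 x = 0 /\ f2 x = 0.
Proof.
move=> hf cA f0 x nAx.
have near0 : \near x, f x = cst 0 x.
  have : open_nbhs x (~` A) by split => //; exact: closed_openC.
  by move/open_nbhs_nbhs; apply: filterS => y; exact: f0.
have D0 v : 'D_v f x = 0.
  by rewrite (near_eq_derive _ near0) derive_cst.
by rewrite -(C1g_derive1 x hf) -(C1g_derive2 x hf) !D0.
Qed.

End PlaneCalculus.

(** * Planar Lebesgue measure and the divergence formula on the half-plane *)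

Section Lebesgue2.
Context {R : realType}.
Local Notation R2 := (measurableTypeR R * measurableTypeR R)%type.

Definition leb1 : set (measurableTypeR R) -> \bar R := @lebesgue1 R.
HB.instance Definition _ := Measure.copy leb1 (@lebesgue1 R).
HB.instance Definition _ := Measure_isSigmaFinite.Build _ _ _ leb1
  (sigma_finiteT (@lebesgue_measure R)).
Definition leb2 : set R2 -> \bar R := @lebesgue2 R.
HB.instance Definition _ := Measure.copy leb2 (@lebesgue2 R).

Local Notation mu1 := leb1.
Local Notation mu2 := leb2.
Local Notation H := (halfplane : set (R * R)).

Definition box (L : R) : set (R * R) := [set x | `|x.1| <= L /\ `|x.2| <= L].

Lemma boxE (L : R) : box L = `[- L, L]%classic `*` `[- L, L]%classic.
Proof. by apply/seteqP; split => x; rewrite /box /setX /= !in_itv /= -!ler_norml. Qed.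

Lemma measurable_box (L : R) : measurable (box L : set R2).
Proof. by rewrite boxE; apply: measurableX; exact: measurable_itv. Qed.

Lemma compact_box (L : R) : compact (box L).
Proof. by rewrite boxE; apply: compact_setX; exact: segment_compact. Qed.

Lemma closed_box (L : R) : closed (box L).
Proof. by apply: compact_closed; [exact: norm_hausdorff|exact: compact_box]. Qed.

Lemma box_lty (L : R) : (mu2 (box L : set R2) < +oo)%E.
Proof.
have h : (@lebesgue_measure R `[(- L)%R, L]%classic < +oo)%E.
  by rewrite lebesgue_measure_itv /=; case: ifP => // _; rewrite -EFinB ltry.
rewrite boxE [X in (X < _)%E]product_measure1E ?measurable_itv//.
by rewrite -ge0_fin_numE ?mule_ge0//; apply: fin_numM; rewrite ge0_fin_numE//.
Qed.

Lemma sub_box (L M : R) : L <= M -> box L `<=` box M.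
Proof. by move=> LM x [h1 h2]; split; apply: le_trans LM. Qed.

Lemma in_box (x : R * R) : box (`|x.1| + `|x.2|) x.
Proof. by split; rewrite ?lerDl ?lerDr. Qed.

Lemma lebesgue2_sigma_finite : sigma_finite setT mu2.
Proof.
exists (fun n => box n%:R).
  apply/seteqP; split => // x _.
  exists (Num.bound (`|x.1| + `|x.2|)) => //=.
  by apply: sub_box (in_box x); apply/ltW/archi_boundP/addr_ge0.
by move=> n; split; [exact: measurable_box|exact: box_lty].
Qed.

HB.instance Definition _ := Measure_isSigmaFinite.Build _ _ _ leb2 lebesgue2_sigma_finite.

Lemma compact_sub_box (K : set (R * R)) : compact K -> exists2 L : R, 0 <= L & K `<=` box L.
Proof.
move=> /compact_bounded[M [_ hM]].
exists (`|M| + 1); first by rewrite addr_ge0.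
move=> x /(hM (`|M| + 1)) => h; have : `|x| <= `|M| + 1.
  by apply: h; rewrite (le_lt_trans (ler_norm M))// ltrDl.
by rewrite prod_normE ge_max => /andP[].
Qed.

Lemma compact_measurable (K : set (R * R)) : compact K -> measurable (K : set R2).
Proof.
move=> cK; rewrite -(setCK K); apply: measurableC; apply: open_measurable2.
by apply: closed_openC; apply: compact_closed => //; exact: norm_hausdorff.
Qed.

Lemma measurable_halfplane : measurable (H : set R2).
Proof.
rewrite (_ : H = setT `*` `]0, +oo[%classic).
  by apply: measurableX => //; exact: measurable_itv.
by apply/seteqP; split => [x h|x [_]] /=; rewrite ?in_itv/= ?andbT.
Qed.

Lemma box_bounded (f : R * R -> R) (L : R) : continuous f -> exists2 M : R, 0 <= M &
  forall x, box L x -> `|f x| <= M.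
Proof.
move=> cf.
have : compact (f @` box L).
  by apply: continuous_compact; [exact: continuous_subspaceT|exact: compact_box].
move=> /compact_bounded[M [_ hM]].
exists (`|M| + 1); first by rewrite addr_ge0.
move=> x bx; apply: hM; last by exists x.
by rewrite (le_lt_trans (ler_norm M))// ltrDl.
Qed.

Lemma integrable_box (D : set R2) (f : R * R -> R) (L M : R) : measurable D ->
  measurable_fun D (f : R2 -> R) ->
  (forall x, D x -> ~ box L x -> f x = 0) ->
  (forall x, D x -> box L x -> `|f x| <= M) ->
  mu2.-integrable D (EFin \o f).
Proof.
move=> mD mf f0 fM; have mB := measurable_box L.
have mDB : measurable (D `&` (box L : set R2)) by exact: measurableI.
have : mu2.-integrable (D `&` (box L : set R2)) (EFin \o f).
  apply: measurable_bounded_integrable => //.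
  - by apply: le_lt_trans (box_lty L); apply: le_measure; rewrite ?inE//; exact: subIsetr.
  - exact: measurable_funS mf.
  - exists M; split; first exact: num_real.
    by move=> z Mz x [Dx Bx]; apply: (le_trans (fM _ Dx Bx)); exact: ltW.
move=> h; have := (integrable_restrict mu2 mB mD (EFin \o f)).1 h.
apply: eq_integrable => // x Dx; rewrite patchE; case: ifPn => // nB /=.
by rewrite f0 ?inE//; [rewrite inE in Dx|move: nB; rewrite notin_setE].
Qed.

Lemma cont_integrable_box (D : set R2) (f : R * R -> R) (L : R) : measurable D ->
  continuous f -> (forall x, ~ box L x -> f x = 0) -> mu2.-integrable D (EFin \o f).
Proof.
move=> mD cf f0; have [M _ hM] := box_bounded L cf.
apply: (@integrable_box _ _ L M) => //.
- by apply: measurable_funTS; exact: continuous_measurable_fun2.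
- by move=> x _; exact: f0.
- by move=> x _; exact: hM.
Qed.

Lemma not_box_fst (L a b : R) : ~~ (- L <= a <= L) -> ~ box L (a, b).
Proof. by rewrite -ler_norml => /negP h [/h]. Qed.

Lemma not_box_snd (L a b : R) : ~~ (- L <= b <= L) -> ~ box L (a, b).
Proof. by rewrite -ler_norml => /negP h [_ /h]. Qed.

Variables (f f1 f2 : R * R -> R) (L : R).
Hypotheses (hf : C1g f f1 f2) (L0 : 0 <= L) (f0 : forall x, ~ box L x -> f x = 0).

Let f12 x : ~ box L x -> f1 x = 0 /\ f2 x = 0.
Proof. by move=> nb; apply: (derive_outside hf _ f0 nb); exact: closed_box. Qed.
Let cf1 : continuous f1. Proof. by case: hf. Qed.
Let cf2 : continuous f2. Proof. by case: hf. Qed.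

(** The function is assumed to vanish off the closed box only. Integrating up to [L + 1] puts the
    endpoints strictly outside, where the hypothesis applies directly. *)
Let L10 : 0 <= L + 1. Proof. by rewrite addr_ge0. Qed.
Let wide (s : R) : ~~ (- (L + 1) <= s <= L + 1) -> ~~ (- L <= s <= L).
Proof. by apply: contra; lra. Qed.
Let wideN : ~~ (- L <= - (L + 1) <= L). Proof. by apply/negP; lra. Qed.
Let wideP : ~~ (- L <= L + 1 <= L). Proof. by apply/negP; lra. Qed.

(** Fubini with the horizontal variable inside: on every line [x.2 = y] the integral is the
    difference of two vanishing boundary values. *)
Lemma integral_halfplane_d1 : \int[mu2]_(x in H) f1 x = 0.
Proof.
have mH := measurable_halfplane.
have If : mu2.-integrable H (EFin \o f1).
  by apply: (@cont_integrable_box _ _ L) => // x /f12[].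
rewrite /Rintegral integral_mkcond.
have If' := (@integrable_mkcond _ _ _ mu2 H (EFin \o f1) mH).1 If.
rewrite -(integral21_prod_meas1 If') integral0_eq//= => y _.
rewrite /fubini_G.
have [y0|y0] := ltP 0 y; last first.
  apply: integral0_eq => x _; rewrite patchE ifN// notin_setE /halfplane /=.
  by apply/negP; rewrite -leNgt.
rewrite (_ : (\int[_]_x _)%E = (\int[mu1]_x (f1 (x, y))%:E)%E); last first.
  by apply: eq_integral => x _; rewrite patchE ifT// inE.
have Is : mu1.-integrable setT (EFin \o (fun x => f1 (x, y))).
  apply: (@integrable_bounded_support _ _ (- L) L); first exact: continuous_slice1.
  by move=> s hs; case: (@f12 (s, y)) => //; exact: not_box_fst.
have h : \int[mu1]_s f1 (s, y) = 0.
  apply: (@integral_derive_line _ (fun s => f (s, y)) (fun s => f1 (s, y)) (L + 1)) => //.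
  - by move=> s; exact: C1g_slice1 hf.
  - exact: continuous_slice1.
  - move=> s hs; apply: (f12 _).1; apply: not_box_fst; exact: wide.
  - by apply: f0; exact: not_box_fst wideN.
  - by apply: f0; exact: not_box_fst wideP.
by rewrite -[LHS]fineK; [congr EFin|exact: (integrable_fin_num measurableT Is)].
Qed.

(** Fubini with the vertical variable inside: each half-line contributes only its value at the
    boundary point, with a minus sign. *)
Lemma integral_halfplane_d2 :
  \int[mu2]_(x in H) f2 x = - \int[mu1]_s f (s, 0).
Proof.
have mH := measurable_halfplane.
have If : mu2.-integrable H (EFin \o f2).
  by apply: (@cont_integrable_box _ _ L) => // x /f12[].
rewrite /Rintegral integral_mkcond.
have If' := (@integrable_mkcond _ _ _ mu2 H (EFin \o f2) mH).1 If.
rewrite -(integral12_prod_meas1 If').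
transitivity (\int[mu1]_s (- f (s, 0))); last first.
  rewrite -[RHS]mulN1r -RintegralZl//.
    by apply: eq_Rintegral => s _; rewrite mulN1r.
  apply: (@integrable_bounded_support _ _ (- L) L).
    by apply: continuous_slice1; exact: C1g_cont hf.
  by move=> s hs; apply: f0; exact: not_box_fst.
congr fine; apply: eq_integral => x _; rewrite /fubini_F.
have -> : (\int[mu1]_y (((EFin \o f2) \_ H) (x, y)))%E =
   (\int[mu1]_(y in [set y : R | (0 < y)%R]) (f2 (x, y))%:E)%E.
  rewrite [RHS]integral_mkcond; apply: eq_integral => y _.
  by rewrite !patchE; congr (if _ then _ else _); apply/idP/idP; rewrite !inE.
have Is : mu1.-integrable setT (EFin \o (fun y => f2 (x, y))).
  apply: (@integrable_bounded_support _ _ (- L) L); first exact: continuous_slice2.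
  by move=> s hs; case: (@f12 (x, s)) => //; exact: not_box_snd.
have mP : measurable ([set y : R | 0 < y] : set (measurableTypeR R)).
  rewrite (_ : [set y : R | 0 < y] = `]0, +oo[%classic); first exact: measurable_itv.
  by apply/seteqP; split => s /=; rewrite in_itv/= andbT.
have h : \int[mu1]_(s in [set y : R | 0 < y]) f2 (x, s) = - f (x, 0).
  apply: (@integral_derive_halfline _ (fun s => f (x, s)) (fun s => f2 (x, s)) (L + 1)) => //.
  - by move=> s; exact: C1g_slice2 hf.
  - exact: continuous_slice2.
  - move=> s hs; apply: (f12 _).2; apply: not_box_snd; exact: wide.
  - by apply: f0; exact: not_box_snd wideP.
rewrite -h -[LHS]fineK//; apply: (integrable_fin_num mP).
exact: (integrableS _ _ _ Is).
Qed.

End Lebesgue2.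

(** * Mollification *)

Section Spline.
Context {R : realType}.
Implicit Types (s r t h : R).

Definition q1 s : R := Num.max s 0.
Definition q2 s : R := q1 s ^+ 2.
Definition q3 s : R := q1 s ^+ 3.

Lemma q1_ge s : 0 <= s -> q1 s = s.
Proof. by move=> h; rewrite /q1 max_l. Qed.

Lemma q1_le s : s <= 0 -> q1 s = 0.
Proof. by move=> h; rewrite /q1 max_r. Qed.

Lemma q1_lip s t : `|q1 s - q1 t| <= `|s - t|.
Proof.
have := ler_norm (s - t); have := ler_norm (- (s - t)); rewrite normrN.
have := normr_ge0 (s - t).
by case: (leP s 0) => hs; case: (leP t 0) => ht;
  rewrite ?(q1_le hs) ?(q1_le ht) ?(q1_ge (ltW hs)) ?(q1_ge (ltW ht)) => ? ? ?;
  rewrite ler_norml; apply/andP; split; lra.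
Qed.

Lemma q2_taylor s r : `|q2 (s + r) - q2 s - 2 * q1 s * r| <= r ^+ 2.
Proof.
rewrite /q2; case: (leP s 0) => hs; case: (leP (s + r) 0) => ht;
  rewrite ?(q1_le hs) ?(q1_le ht) ?(q1_ge (ltW hs)) ?(q1_ge (ltW ht));
  rewrite ler_norml; apply/andP; split; nra.
Qed.

(** The planar [is_diff_taylor], applied to [f] as a function of the first coordinate and pulled
    back along a horizontal line. *)
Lemma is_derive_taylor (f : R -> R) s (f' C : R) :
  (forall r : R, `|r| <= 1 -> `|f (s + r) - f s - f' * r| <= C * r ^+ 2) ->
  is_derive s (1 : R) f f'.
Proof.
move=> H; pose g (x : R * R) := f x.1.
have hg : is_diff (s, 0) g (fun v => v.1 * f' + v.2 * 0).
  apply: (@is_diff_taylor _ _ _ _ _ `|C|) => z z1.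
  have z11 : `|z.1| <= 1 by apply: le_trans z1; rewrite prod_normE le_max lexx.
  rewrite /g /= mulr0 addr0 addrC [z.1 + s]addrC addrC [z.1 * f']mulrC.
  apply: le_trans (H _ z11) _.
  apply: (@le_trans _ _ (`|C| * z.1 ^+ 2)).
    by rewrite ler_wpM2r ?sqr_ge0// ler_norm.
  rewrite ler_wpM2l// -real_normK ?num_real// ler_sqr ?nnegrE//.
  by rewrite prod_normE le_max lexx.
have hp : is_diff s (fun t : R => (t, 0 : R)) (fun v : R => (v, 0)).
  exact: (is_diff_pair (is_diff_id s) (is_diff_cst 0 s)).
have [d1 d2] := is_diff_comp hp hg.
have dd : derivable f s 1 by apply/derivable1_diffP.
apply: DeriveDef => //; rewrite deriveE; last exact/derivable1_diffP.
by have /(congr1 (fun F => F 1)) := d2; rewrite /= mul1r mul0r addr0.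
Qed.

Lemma is_derive_q2 s : is_derive s (1 : R) q2 (2 * q1 s).
Proof.
by apply: (@is_derive_taylor _ _ _ 1) => r _; rewrite mul1r; exact: q2_taylor.
Qed.

Lemma is_derive_q3 s : is_derive s (1 : R) q3 (3 * q2 s).
Proof.
apply: (@is_derive_taylor _ _ _ (3 * `|s| + 1)) => r; rewrite ler_norml => /andP[r1 r2].
have h1 := ler_norm s; have h2 := ler_norm (- s); rewrite normrN in h2.
have h3 := normr_ge0 s; have r20 := sqr_ge0 r.
rewrite /q2 /q3; case: (leP s 0) => hs; case: (leP (s + r) 0) => ht;
  rewrite ?(q1_le hs) ?(q1_le ht) ?(q1_ge (ltW hs)) ?(q1_ge (ltW ht)).
- rewrite !expr0n /= !mulr0 mul0r !subr0 normr0; nra.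
- rewrite !expr0n /= mulr0 mul0r !subr0 ger0_norm ?exprn_ge0 ?(ltW ht)//.
  have hr : 0 <= s + r <= r by lra.
  have h4 : (s + r) ^+ 2 <= r ^+ 2 by nra.
  have h5 : (s + r) ^+ 3 <= r ^+ 2 * (s + r) by rewrite exprSr ler_wpM2r//; lra.
  apply: le_trans h5 _; nra.
- rewrite !expr0n /= sub0r.
  have hr : 0 <= s <= - r by lra.
  have h4 : s ^+ 2 <= r ^+ 2 by nra.
  have h5 : s ^+ 3 <= r ^+ 2 * s by rewrite exprSr ler_wpM2r//; lra.
  have h6 : 0 <= s ^+ 3 by rewrite exprn_ge0// ltW.
  have h7 : 3 * s ^+ 2 * (- r) <= 3 * s * r ^+ 2 by nra.
  have h8 : 0 <= 3 * s ^+ 2 * (- r) by rewrite mulr_ge0 ?mulr_ge0 ?sqr_ge0//; lra.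
  rewrite ler_norml; apply/andP; split; nra.
- have -> : (s + r) ^+ 3 - s ^+ 3 - 3 * s ^+ 2 * r = r ^+ 2 * (3 * s + r) by ring.
  rewrite normrM ger0_norm// mulrC ler_wpM2r// ler_norml; apply/andP; split; lra.
Qed.

(* The uniform quadratic B-spline supported in [[0, 3]], its derivative, and its
   primitive: [q1], [q2], [q3] are the truncated powers. *)
Definition bs s : R := (q2 s - 3 * q2 (s - 1) + 3 * q2 (s - 2) - q2 (s - 3)) / 2.
Definition bs1 s : R := q1 s - 3 * q1 (s - 1) + 3 * q1 (s - 2) - q1 (s - 3).
Definition bS s : R := (q3 s - 3 * q3 (s - 1) + 3 * q3 (s - 2) - q3 (s - 3)) / 6.

Lemma shift_derive (f f' : R -> R) (c s : R) :
  (forall t : R, is_derive t (1 : R) f (f' t)) ->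
  is_derive s (1 : R) (fun t => f (t - c)) (f' (s - c)).
Proof.
move=> df; have h : is_derive s (1 : R) (fun t : R => t - c) (1 - 0).
  by apply: is_deriveB.
have := @is_derive1_comp _ f (fun t => t - c) s _ _ (df (s - c)) h.
by rewrite subr0 mulr1.
Qed.

Lemma is_derive_bS s : is_derive s (1 : R) bS (bs s).
Proof.
have D c := @shift_derive q3 (fun s => 3 * q2 s) c s is_derive_q3.
have D0 := is_derive_q3 s; have D1 := D 1; have D2 := D 2; have D3 := D 3.
by rewrite /bS; apply: is_derive_eq; rewrite /bs /GRing.scale /=; field.
Qed.

Lemma bs1_lip s t : `|bs1 s - bs1 t| <= 8 * `|s - t|.
Proof.
have H c := q1_lip (s - c) (t - c).
have E (c : R) : s - c - (t - c) = s - t by ring.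
have := q1_lip s t; have := H 1; have := H 2; have := H 3; rewrite !E.
rewrite /bs1 !ler_norml => /andP[? ?] /andP[? ?] /andP[? ?] /andP[? ?].
apply/andP; split; lra.
Qed.

Lemma bs_taylor s r : `|bs (s + r) - bs s - bs1 s * r| <= 4 * r ^+ 2.
Proof.
have H c : `|q2 (s + r - c) - q2 (s - c) - 2 * q1 (s - c) * r| <= r ^+ 2.
  have -> : s + r - c = s - c + r by ring.
  exact: q2_taylor.
have := q2_taylor s r; have := H 1; have := H 2; have := H 3.
rewrite /bs /bs1 !ler_norml => /andP[? ?] /andP[? ?] /andP[? ?] /andP[? ?].
apply/andP; split; lra.
Qed.

Lemma bs_lo s : s <= 0 -> [/\ bs s = 0, bs1 s = 0 & bS s = 0].
Proof.
move=> h; rewrite /bs /bs1 /bS /q2 /q3 !q1_le; try lra.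
by rewrite !expr0n /= !mulr0 !subr0 !addr0 !mul0r.
Qed.

Lemma bs_hi s : 3 <= s -> [/\ bs s = 0, bs1 s = 0 & bS s = 1].
Proof.
by move=> h; rewrite /bs /bs1 /bS /q2 /q3 !q1_ge; try lra; split; field.
Qed.

Lemma bs_bounds s : [/\ 0 <= bs s <= 1, `|bs1 s| <= 3 & 0 <= bS s <= 1].
Proof.
case: (leP s 0) => h0.
  by have [-> -> ->] := bs_lo h0; rewrite normr0; split; lra.
case: (leP 3 s) => h3.
  by have [-> -> ->] := bs_hi h3; rewrite normr0; split; lra.
case: (leP s 1) => h1.
  rewrite /bs /bs1 /bS /q2 /q3 (@q1_ge s) ?(@q1_le (s - 1)) ?(@q1_le (s - 2)) ?(@q1_le (s - 3)); try lra.
  rewrite !expr0n /= ler_norml.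
  have ? : 0 <= s ^+ 2 <= 1 by nra.
  have ? : 0 <= s ^+ 3 <= 1 by rewrite exprn_ge0 ?exprn_ile1 ?(ltW h0).
  by split; try lra; apply/andP; split; lra.
case: (leP s 2) => h2.
  rewrite /bs /bs1 /bS /q2 /q3 (@q1_ge s) ?(@q1_ge (s - 1)) ?(@q1_le (s - 2)) ?(@q1_le (s - 3)); try lra.
  rewrite !expr0n /= ler_norml.
  have E3 : s ^+ 3 - 3 * (s - 1) ^+ 3 = 1 + 3 * (s - 1) + 3 * (s - 1) ^+ 2 - 2 * (s - 1) ^+ 3 by ring.
  have [t tE] : exists t, t = s - 1 by exists (s - 1).
  have ? : 0 <= t <= 1 by lra.
  have ? : 0 <= t ^+ 2 <= 1 by nra.
  have ? : 0 <= t ^+ 3 <= 1 by rewrite exprn_ge0 ?exprn_ile1//; lra.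
  split; [nra|by apply/andP; split; lra|].
  have ? : 2 * t ^+ 2 - t <= t ^+ 3.
    have : 0 <= t * (1 - t) ^+ 2 by rewrite mulr_ge0 ?sqr_ge0//; lra.
    by rewrite (_ : t * (1 - t) ^+ 2 = t ^+ 3 - (2 * t ^+ 2 - t)); [lra|ring].
  have ? : t ^+ 3 <= t ^+ 2 by rewrite exprSr; nra.
  by rewrite !mulr0 addr0 subr0 E3 -tE; lra.
rewrite /bs /bs1 /bS /q2 /q3 (@q1_ge s) ?(@q1_ge (s - 1)) ?(@q1_ge (s - 2)) ?(@q1_le (s - 3)); try lra.
rewrite !expr0n /= ler_norml.
have E2 : s ^+ 2 - 3 * (s - 1) ^+ 2 + 3 * (s - 2) ^+ 2 = (3 - s) ^+ 2 by ring.
have E3 : s ^+ 3 - 3 * (s - 1) ^+ 3 + 3 * (s - 2) ^+ 3 = 6 - (3 - s) ^+ 3 by ring.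
have [t tE] : exists t, t = 3 - s by exists (3 - s).
have ? : 0 <= t <= 1 by lra.
have ? : 0 <= t ^+ 2 <= 1 by nra.
have ? : 0 <= t ^+ 3 <= 1 by rewrite exprn_ge0 ?exprn_ile1//; lra.
rewrite E2 E3 -tE.
by split; [nra|by apply/andP; split; lra|lra].
Qed.

Lemma bs_cont : continuous (bs : R -> R).
Proof.
have D c t : is_derive t (1 : R) (fun s => q2 (s - c)) (2 * q1 (t - c)).
  exact: (@shift_derive q2 (fun s => 2 * q1 s) c t is_derive_q2).
have C c : continuous (fun s => q2 (s - c)).
  move=> t; apply/differentiable_continuous/derivable1_diffP.
  by case: (D c t).
have C0 : continuous q2.
  move=> t; apply/differentiable_continuous/derivable1_diffP.
  by case: (is_derive_q2 t).
move=> t; rewrite /bs.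
apply: cvgMl; apply: cvgB; last exact: C.
apply: cvgD; last by apply: cvgMr; exact: C.
apply: cvgB; first exact: C0.
by apply: cvgMr; exact: C.
Qed.

End Spline.

Section Kernel.
Context {R : realType}.
Local Notation R2 := (measurableTypeR R * measurableTypeR R)%type.
Local Notation mu1 := (@leb1 R).
Local Notation leb2 := (@leb2 R).
Implicit Types (s r t h : R).

(* [ak h] is a mollifier supported in [[h, 4 * h]]: being one-sided, it samples
   only interior values at points of the closed half-plane.  [tk h] is a primitive
   of [ak h (. + 11 * h) - ak h], equal to [1] near [0]. *)
Definition ak h t : R := bs (t / h - 1) / h.
Definition dak h t : R := bs1 (t / h - 1) / h ^+ 2.
Definition tk h t : R := bS (t / h + 10) - bS (t / h - 1).

Lemma ak_ge0 h t : 0 < h -> 0 <= ak h t.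
Proof.
by move=> h0; have [/andP[a _] _ _] := bs_bounds (t / h - 1); rewrite divr_ge0// ltW.
Qed.

Lemma ak_le h t : 0 < h -> ak h t <= h^-1.
Proof.
move=> h0; have [/andP[_ a] _ _] := bs_bounds (t / h - 1).
by rewrite /ak ler_pdivrMr// mulVf ?gt_eqF.
Qed.

Lemma ak_out h t : 0 < h -> ~~ (h <= t <= 4 * h) -> ak h t = 0 /\ dak h t = 0.
Proof.
move=> h0; rewrite negb_and -!ltNge /ak /dak => /orP[a|a].
  have := @bs_lo _ (t / h - 1); case; last by move=> -> -> _; rewrite !mul0r.
  by rewrite subr_le0 ler_pdivrMr// mul1r ltW.
have := @bs_hi _ (t / h - 1); case; last by move=> -> -> _; rewrite !mul0r.
by rewrite lerBrDr ler_pdivlMr//; lra.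
Qed.

Lemma dak_le h t : 0 < h -> `|dak h t| <= 3 / h ^+ 2.
Proof.
move=> h0; have [_ a _] := bs_bounds (t / h - 1).
have h20 : 0 < h ^+ 2 by rewrite exprn_gt0.
by rewrite normrM normfV (gtr0_norm h20) ler_pM2r ?invr_gt0.
Qed.

Lemma dak_lip h s t : 0 < h -> `|dak h s - dak h t| <= 8 / h ^+ 3 * `|s - t|.
Proof.
move=> h0; have a := bs1_lip (s / h - 1) (t / h - 1).
have h20 : 0 < h ^+ 2 by rewrite exprn_gt0.
rewrite -mulrBl normrM normfV (gtr0_norm h20) ler_pdivrMr//.
apply: le_trans a _.
have -> : s / h - 1 - (t / h - 1) = (s - t) / h by ring.
rewrite normrM normfV (gtr0_norm h0) le_eqVlt; apply/orP; left; apply/eqP; field.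
by rewrite gt_eqF.
Qed.

Lemma ak_taylor h t r : 0 < h ->
  `|ak h (t + r) - ak h t - dak h t * r| <= 4 / h ^+ 3 * r ^+ 2.
Proof.
move=> h0; have a := bs_taylor (t / h - 1) (r / h).
have hn : h != 0 by rewrite gt_eqF.
have -> : ak h (t + r) - ak h t - dak h t * r =
   (bs (t / h - 1 + r / h) - bs (t / h - 1) - bs1 (t / h - 1) * (r / h)) / h.
  rewrite /ak /dak (_ : (t + r) / h - 1 = t / h - 1 + r / h); last by ring.
  by field.
rewrite normrM normfV (gtr0_norm h0) ler_pdivrMr//.
apply: le_trans a _; rewrite le_eqVlt; apply/orP; left; apply/eqP; field.
by [].
Qed.

Lemma scaled_derive (f f' : R -> R) (h c t : R) :
  (forall t : R, is_derive t (1 : R) f (f' t)) ->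
  is_derive t (1 : R) (fun t => f (t / h + c)) (f' (t / h + c) / h).
Proof.
move=> df; have H : is_derive t (1 : R) (fun t : R => t / h + c) h^-1.
  apply: (@is_derive_taylor _ _ _ _ 0) => r _.
  by rewrite mul0r (_ : _ - _ = 0) ?normr0//; ring.
exact: (@is_derive1_comp _ f (fun t => t / h + c) t _ _ (df (t / h + c)) H).
Qed.

Lemma ak_cont h : continuous (ak h).
Proof.
move=> t; rewrite /ak; apply: cvgMl.
apply: (@continuous_comp _ _ _ (fun t => t / h - 1) bs); last exact: bs_cont.
by apply: cvgB; [apply: cvgMl; exact: cvg_id|exact: cvg_cst].
Qed.

Lemma is_derive_ak h t : 0 < h -> is_derive t (1 : R) (ak h) (dak h t).
Proof.
by move=> h0; apply: (@is_derive_taylor _ _ _ _ (4 / h ^+ 3)) => r _; exact: ak_taylor.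
Qed.

Lemma dak_cont h : 0 < h -> continuous (dak h).
Proof.
move=> h0 t; apply/cvgrPdist_le => /= e e0.
have c0 : 0 < 8 / h ^+ 3 by rewrite divr_gt0// exprn_gt0.
near=> u; apply: le_trans (dak_lip _ _ h0) _.
rewrite -ler_pdivlMl//; near: u.
have := @cvg_id _ (nbhs t); move/cvgrPdist_le; apply.
by rewrite mulr_gt0// invr_gt0.
Unshelve. all: by end_near. Qed.

Lemma is_derive_tk h t : 0 < h ->
  is_derive t (1 : R) (tk h) (ak h (t + 11 * h) - ak h t).
Proof.
move=> h0; have hn : h != 0 by rewrite gt_eqF.
have H1 := @scaled_derive bS bs h 10 t is_derive_bS.
have H2 := @scaled_derive bS bs h (-1) t is_derive_bS.
have := is_deriveB H1 H2; congr is_derive; rewrite /ak; congr (bs _ / _ - _).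
by field.
Qed.

(** The rise of [tk h] on [[- 10 * h, - 7 * h]] lies below the boundary line and makes the support
    compact; on the half-plane the derivative is exactly [- ak h]. *)
Lemma tk_props h t : 0 < h -> [/\ 0 <= t -> ak h (t + 11 * h) = 0, tk h 0 = 1,
   0 <= t -> 0 <= tk h t <= 1 & ~~ (- 10 * h <= t <= 4 * h) -> tk h t = 0].
Proof.
move=> h0; have hn : h != 0 by rewrite gt_eqF.
split.
- by move=> t0; apply: (ak_out h0 _).1; apply/negP; nra.
- rewrite /tk mul0r; have [_ _ ->] := @bs_hi R (0 + 10) ltac:(lra).
  by have [_ _ ->] := @bs_lo R (0 - 1) ltac:(lra); rewrite subr0.
- move=> t0; rewrite /tk; have th0 : 0 <= t / h by rewrite divr_ge0// ltW.
  have [_ _ ->] := @bs_hi R (t / h + 10) ltac:(lra).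
  by have [_ _] := bs_bounds (t / h - 1); lra.
- rewrite negb_and -!ltNge /tk => /orP[a|a].
    have th : t / h < - 10 by rewrite ltr_pdivrMr.
    have [_ _ ->] := @bs_lo R (t / h + 10) ltac:(lra).
    by have [_ _ ->] := @bs_lo R (t / h - 1) ltac:(lra); rewrite subrr.
  have th : 4 < t / h by rewrite ltr_pdivlMr.
  have [_ _ ->] := @bs_hi R (t / h + 10) ltac:(lra).
  by have [_ _ ->] := @bs_hi R (t / h - 1) ltac:(lra); rewrite subrr.
Qed.

Lemma tk_cont h : 0 < h -> continuous (tk h).
Proof.
move=> h0 t; apply/differentiable_continuous/derivable1_diffP.
by case: (is_derive_tk t h0).
Qed.

Lemma int_ak_r h (x : R) : 0 < h -> \int[mu1]_y ak h (y - x) = 1.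
Proof.
move=> h0; have hn : h != 0 by rewrite gt_eqF.
rewrite (@Rintegral_bounded_support _ _ _ x (x + 5 * h))//; last first.
  move=> y _ hy; apply: (ak_out h0 _).1; apply: contra hy => /andP[a b].
  by apply/andP; split; lra.
pose F (y : R) := bS (y / h + (- x / h - 1)).
have dF (y : R) : is_derive y (1 : R) F (ak h (y - x)).
  have := @scaled_derive bS bs h (- x / h - 1) y is_derive_bS.
  by congr is_derive; rewrite /ak; congr (bs _ / _); ring.
rewrite (FTC_segment _ dF); last 2 first.
- by rewrite lerDl mulr_ge0// ltW.
- move=> y; apply: (@continuous_comp _ _ _ (fun y => y - x) (ak h)); last exact: ak_cont.
  by apply: cvgB; [exact: cvg_id|exact: cvg_cst].
rewrite /F; have -> : x / h + (- x / h - 1) = - 1 by field.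
have -> : (x + 5 * h) / h + (- x / h - 1) = 4 by field.
have [_ _ ->] := @bs_hi R 4 ltac:(lra).
by have [_ _ ->] := @bs_lo R (-1) ltac:(lra); rewrite subr0.
Qed.

Lemma int_ak_l h (y : R) : 0 < h -> \int[mu1]_x ak h (y - x) = 1.
Proof.
move=> h0; have hn : h != 0 by rewrite gt_eqF.
rewrite (@Rintegral_bounded_support _ _ _ (y - 5 * h) y)//; last first.
  move=> x _ hx; apply: (ak_out h0 _).1; apply: contra hx => /andP[a b].
  by apply/andP; split; lra.
pose F (x : R) := - bS (x / (- h) + (y / h - 1)).
have dF (x : R) : is_derive x (1 : R) F (ak h (y - x)).
  have H := @scaled_derive bS bs (- h) (y / h - 1) x is_derive_bS.
  have := is_deriveN H; congr is_derive.
  by rewrite /ak invrN mulrN opprK; congr (bs _ / _); ring.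
rewrite (FTC_segment _ dF); last 2 first.
- by rewrite gerBl mulr_ge0// ltW.
- move=> x; apply: (@continuous_comp _ _ _ (fun x => y - x) (ak h)); last exact: ak_cont.
  by apply: cvgB; [exact: cvg_cst|exact: cvg_id].
rewrite /F; have -> : y / (- h) + (y / h - 1) = - 1 by field.
have -> : (y - 5 * h) / (- h) + (y / h - 1) = 4 by field.
have [_ _ ->] := @bs_hi R 4 ltac:(lra).
by have [_ _ ->] := @bs_lo R (-1) ltac:(lra); rewrite oppr0 sub0r opprK.
Qed.

Lemma ak_shift_cont_r h (x : R) : continuous (fun y => ak h (y - x)).
Proof.
move=> y; apply: (@continuous_comp _ _ _ (fun y => y - x) (ak h)); last exact: ak_cont.
by apply: cvgB; [exact: cvg_id|exact: cvg_cst].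
Qed.

Lemma ak_shift_cont_l h (y : R) : continuous (fun x => ak h (y - x)).
Proof.
move=> x; apply: (@continuous_comp _ _ _ (fun x => y - x) (ak h)); last exact: ak_cont.
by apply: cvgB; [exact: cvg_cst|exact: cvg_id].
Qed.

Lemma eint_ak_r h (x : R) : 0 < h -> (\int[mu1]_y (ak h (y - x))%:E = 1)%E.
Proof.
move=> h0; rewrite -[1%E]/(1%R%:E) -(int_ak_r x h0) /Rintegral fineK//.
apply: (integrable_fin_num measurableT).
apply: (@integrable_bounded_support _ _ x (x + 5 * h)); first exact: ak_shift_cont_r.
move=> y hy; apply: (ak_out h0 _).1; apply: contra hy => /andP[a b].
by apply/andP; split; lra.
Qed.

Lemma eint_ak_l h (y : R) : 0 < h -> (\int[mu1]_x (ak h (y - x))%:E = 1)%E.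
Proof.
move=> h0; rewrite -[1%E]/(1%R%:E) -(int_ak_l y h0) /Rintegral fineK//.
apply: (integrable_fin_num measurableT).
apply: (@integrable_bounded_support _ _ (y - 5 * h) y); first exact: ak_shift_cont_l.
move=> x hx; apply: (ak_out h0 _).1; apply: contra hx => /andP[a b].
by apply/andP; split; lra.
Qed.

Lemma measurable_ak_sub d (T : measurableType d) h (f g : T -> R) :
  measurable_fun setT f -> measurable_fun setT g ->
  measurable_fun setT (fun z => ak h (f z - g z)).
Proof.
move=> mf mg; apply: (@measurableT_comp _ _ _ _ _ _ (ak h)).
  by apply: continuous_measurable_fun; exact: ak_cont.
exact: measurable_funB.
Qed.

Lemma tonelli_prod (f g : R -> R) :
  measurable_fun setT (f : measurableTypeR R -> R) ->
  measurable_fun setT (g : measurableTypeR R -> R) ->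
  (forall x, 0 <= f x) -> (forall x, 0 <= g x) ->
  (\int[leb2]_(z in setT) (f z.1 * g z.2)%:E =
   (\int[mu1]_x (f x)%:E) * (\int[mu1]_y (g y)%:E))%E.
Proof.
move=> mf mg f0 g0.
have mfg : measurable_fun setT (fun z : R2 => (f z.1 * g z.2)%:E).
  apply/measurable_EFinP; apply: measurable_funM.
    exact: measurableT_comp.
  exact: measurableT_comp.
rewrite [LHS](@fubini_tonelli1 _ _ _ _ _ mu1 mu1 _ mfg); last first.
  by move=> z; rewrite lee_fin mulr_ge0.
rewrite /fubini_F /=.
transitivity (\int[mu1]_x ((f x)%:E * (\int[mu1]_y (g y)%:E)))%E.
  apply: eq_integral => x _; under eq_integral do rewrite EFinM.
  rewrite ge0_integralZl ?lee_fin//; first exact/measurable_EFinP.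
  by move=> y _; rewrite lee_fin.
rewrite ge0_integralZr//.
- exact/measurable_EFinP.
- by move=> x _; rewrite lee_fin.
- by apply: integral_ge0 => y _; rewrite lee_fin.
Qed.

Definition k1 h (x y : measurableTypeR R) : R := ak h (y - x).
Definition k2 h (x y : R2) : R := ak h (y.1 - x.1) * ak h (y.2 - x.2).

Lemma k1_bound h : 0 < h -> kernel_bound mu1 mu1 (k1 h) 1 1.
Proof.
move=> h0; split.
- by apply: measurable_ak_sub.
- by move=> x y; exact: ak_ge0.
- by exists h^-1 => x y; exact: ak_le.
- by move=> x; rewrite /k1 eint_ak_r.
- by move=> y; rewrite /k1 eint_ak_l.
Qed.

Lemma k2_bound h : 0 < h -> kernel_bound leb2 leb2 (k2 h) 1 1.
Proof.
move=> h0; split.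
- by apply: measurable_funM; apply: measurable_ak_sub; do ?[exact: measurableT_comp].
- by move=> x y; rewrite mulr_ge0 ?ak_ge0.
- exists (h^-1 * h^-1) => x y; apply: ler_pM; rewrite ?ak_ge0 ?ak_le//.
- move=> x; rewrite /k2 (@tonelli_prod (fun s => ak h (s - x.1)) (fun s => ak h (s - x.2))).
  + by rewrite !eint_ak_r// mule1.
  + exact: measurable_ak_sub.
  + exact: measurable_ak_sub.
  + by move=> s; exact: ak_ge0.
  + by move=> s; exact: ak_ge0.
- move=> y; rewrite /k2 (@tonelli_prod (fun s => ak h (y.1 - s)) (fun s => ak h (y.2 - s))).
  + by rewrite !eint_ak_l// mule1.
  + exact: measurable_ak_sub.
  + exact: measurable_ak_sub.
  + by move=> s; exact: ak_ge0.
  + by move=> s; exact: ak_ge0.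
Qed.

End Kernel.

(** * L^2 convergence of the one-sided mollifiers *)

Section Approx.
Context {R : realType}.
Local Notation R2 := (measurableTypeR R * measurableTypeR R)%type.
Local Notation mu1 := (@leb1 R).
Local Notation leb2 := (@leb2 R).
Implicit Types (s r t h : R).

Lemma leb1E (A : set (measurableTypeR R)) : mu1 A = (@lebesgue_measure R) A.
Proof. by []. Qed.

Lemma leb1_bnd (a b : R) (b0 b1 : bool) :
  (mu1 [set` Interval (BSide b0 a) (BSide b1 b)] < +oo)%E.
Proof.
by rewrite leb1E lebesgue_measure_itv/=; case: ifP => // _; rewrite -EFinB ltry.
Qed.

Definition hn (n : nat) : R := n.+1%:R^-1.

Lemma hn_gt0 n : 0 < hn n.
Proof. by rewrite invr_gt0. Qed.

Lemma hn_lt (e : R) : 0 < e -> exists N, forall n, (N <= n)%N -> hn n < e.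
Proof.
move=> e0; exists (Num.bound e^-1) => n Nn.
rewrite /hn invf_plt ?posrE//.
apply: (lt_le_trans (archi_boundP _)); first by rewrite invr_ge0 ltW.
by rewrite ler_nat (leq_trans Nn).
Qed.

Lemma Rintegral0_eq d (T : measurableType d) (mu : {measure set T -> \bar R}) (D : set T) (f : T -> R) :
  (forall x, D x -> f x = 0) -> \int[mu]_(x in D) f x = 0.
Proof.
by move=> f0; rewrite /Rintegral integral0_eq//= => x /f0 ->.
Qed.

(** The kernel at [s] averages over [[s + h, s + 4 * h]], so an indicator can change only within
    distance [4 * h] to the left of an endpoint. *)
Lemma k1_indic_itv h (a b s : R) : 0 < h -> a < b ->
  let K := Kop mu1 (k1 h) (\1_`]a, b]) s in
  [/\ 0 <= K <= 1, s < a - 4 * h \/ b < s -> K = 0 & a < s < b - 4 * h -> K = 1].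
Proof.
move=> h0 ab K.
have Iak : mu1.-integrable setT (EFin \o (fun y => ak h (y - s))).
  apply: (@integrable_bounded_support _ _ s (s + 5 * h)); first exact: ak_shift_cont_r.
  move=> y hy; apply: (ak_out h0 _).1; apply: contra hy => /andP[u v].
  by apply/andP; split; lra.
have I1 : mu1.-integrable setT (EFin \o (fun y => \1_`]a, b] y * ak h (y - s))).
  apply: (@integrable_le _ (measurableTypeR R) R mu1 setT (fun y => \1_`]a, b] y * ak h (y - s)) (fun y => ak h (y - s))) => //.
    apply: measurable_funM; first exact: measurable_indic.
    exact: measurable_ak_sub.
  move=> y _; rewrite normrM (ger0_norm (ak_ge0 _ h0)) ler_piMl ?ak_ge0//.
    by rewrite indicE; case: (y \in _); rewrite ?normr1 ?normr0.
split.
- apply/andP; split.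
    by apply: Rintegral_ge0 => y _; rewrite mulr_ge0 ?ak_ge0// indicE.
  rewrite -(int_ak_r s h0); apply: le_Rintegral => // y _.
  by rewrite ler_piMl ?ak_ge0// indicE; case: (y \in _).
- move=> hs; apply: Rintegral0_eq => y _; rewrite indicE /k1.
  case: (boolP (y \in `]a, b]%classic)); last by rewrite mul0r.
  rewrite inE /= in_itv/= => /andP[ay yb]; rewrite (ak_out h0 _).1 ?mulr0//.
  by apply/negP => /andP[u v]; case: hs => ?; lra.
- move=> /andP[sa sb]; rewrite -(int_ak_r s h0); apply: eq_Rintegral => y _.
  rewrite indicE /k1.
  case: (boolP (y \in `]a, b]%classic)); first by rewrite mul1r.
  rewrite mul0r notin_setE /= in_itv/= => /negP ny; rewrite (ak_out h0 _).1//.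
  by apply: contra ny => /andP[u v]; apply/andP; split; lra.
Qed.

(** The error is at most 1 and lives on the two intervals [I1] and [I2] of length [4 * h], so its
    squared norm is at most [8 * h]. *)
Lemma approx1_itv (a b : R) : approx mu1 (fun n => k1 (hn n)) (\1_`]a, b]).
Proof.
have Lab : sqint mu1 setT (\1_`]a, b] : measurableTypeR R -> R).
  by apply: sqint_indic => //; exact: leb1_bnd.
split => //.
move=> e e0.
have [ba|ab] := leP b a.
  exists 0%N => n _.
  rewrite ipE Rintegral0_eq// => s _.
  rewrite set_itv_ge -?leNgt ?bnd_simp// indic0 /= subr0.
  by rewrite (_ : Kop _ _ _ _ = 0) ?mulr0//; apply: Rintegral0_eq => y _; rewrite mul0r.
have [N hN] := @hn_lt (e / 16) ltac:(by rewrite divr_gt0).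
exists N => n /hN {}hN; set h := hn n in hN *; have h0 : 0 < h := hn_gt0 n.
pose I1 : set (measurableTypeR R) := `[a - 4 * h, a]%classic.
pose I2 : set (measurableTypeR R) := `[b - 4 * h, b]%classic.
have mI1 : measurable I1 by exact: measurable_itv.
have mI2 : measurable I2 by exact: measurable_itv.
have E1 : mu1 I1 = (4 * h)%:E.
  rewrite /I1 leb1E lebesgue_measure_itv/= lte_fin ifT; last lra.
  by rewrite -EFinB; congr EFin; ring.
have E2 : mu1 I2 = (4 * h)%:E.
  rewrite /I2 leb1E lebesgue_measure_itv/= lte_fin ifT; last lra.
  by rewrite -EFinB; congr EFin; ring.
have L1 : sqint mu1 setT (\1_I1 : measurableTypeR R -> R).
  by apply: sqint_indic => //; rewrite [X in (X < _)%E]E1 ltry.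
have L2 : sqint mu1 setT (\1_I2 : measurableTypeR R -> R).
  by apply: sqint_indic => //; rewrite [X in (X < _)%E]E2 ltry.
have LK := sqintB measurableT (Kop_sqint (k1_bound h0) Lab) Lab.
apply: (@le_lt_trans _ _ (ip mu1 setT (\1_I1) (\1_I1) + ip mu1 setT (\1_I2) (\1_I2))); last first.
  by rewrite !nrm_indic// [X in fine X + _]E1 [X in _ + fine X]E2 /=; lra.
rewrite !ipE -RintegralD//; try exact: sqint_int.
apply: le_Rintegral => //; try exact: sqint_int.
  by apply: integrableDr => //; exact: sqint_int.
move=> s _; have [k01 kout kin] := @k1_indic_itv h a b s h0 ab.
set K := Kop _ _ _ _ in k01 kout kin *.
have sq (A : set (measurableTypeR R)) : \1_A s * \1_A s = (\1_A s : R).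
  by rewrite indicE; case: (s \in A); rewrite ?mulr1 ?mulr0.
rewrite !sq.
have i0 (A : set (measurableTypeR R)) : 0 <= (\1_A s : R) by rewrite indicE.
have j1 := i0 I1; have j2 := i0 I2.
have [B1|B1] := boolP (s \in I1).
  rewrite [\1_I1 s]indicE B1; have := i0 `]a, b]%classic.
  by rewrite indicE; case: (s \in `]a, b]%classic) => /= _; nra.
have [B2|B2] := boolP (s \in I2).
  rewrite [\1_I2 s]indicE B2; have := i0 `]a, b]%classic.
  by rewrite indicE; case: (s \in `]a, b]%classic) => /= _; nra.
move: B1 B2; rewrite !notin_setE /I1 /I2 /= !in_itv/= => /negP B1 /negP B2.
rewrite !negb_and -!ltNge in B1 B2.
rewrite (_ : K - \1_`]a, b] s = 0) ?mulr0 ?addr_ge0//.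
rewrite indicE.
case: (boolP (s \in `]a, b]%classic)); rewrite ?inE ?notin_setE /= in_itv /=.
  move=> /andP[s1 s2]; rewrite kin ?subrr//.
  by case/orP: B2 => B2; apply/andP; split; clear -s1 s2 h0 ab B2; lra.
move=> /negP; rewrite negb_and -leNgt -ltNge subr0 => B; apply: kout.
case/orP: B => B; last by right.
by left; case/orP: B1 => B1; clear -h0 ab B B1; lra.
Qed.

Lemma approx1 (f : measurableTypeR R -> R) : sqint mu1 setT f ->
  approx mu1 (fun n => k1 (hn n)) f.
Proof.
move=> Lf.
refine (approx_sqint (fun n => k1_bound (hn_gt0 n)) (@ocitvI R) _ _ _
   (B_ := fun n => `]- n%:R, n%:R]%classic) _ _ Lf) => //.
- by move=> A [[a b] _ <-]; exact: leb1_bnd.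
- by move=> A [[a b] _ <-]; exact: approx1_itv.
- by move=> n; exists (- n%:R, n%:R).
- move=> x; exists (Num.bound `|x|).+1 => n /= bn; rewrite in_itv/=.
  have : `|x| < n%:R.
    by apply: (lt_le_trans (archi_boundP _)) => //; rewrite ler_nat ltnW.
  by rewrite ltr_norml => /andP[-> /ltW].
Qed.

(** The kernel [k2] is a tensor product, so the mollified rectangle is the product of two mollified
    indicators. The error is [(KA - A) * KB + A * (KB - B)], and both terms are controlled by the
    one-dimensional result. *)
Lemma approx2_rect (A B : set (measurableTypeR R)) : measurable A -> measurable B ->
  (mu1 A < +oo)%E -> (mu1 B < +oo)%E ->
  approx leb2 (fun n => k2 (hn n)) (\1_(A `*` B)).
Proof.
move=> mA mB fA fB.
have mAB : measurable (A `*` B) by exact: measurableX.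
have LA : sqint mu1 setT (\1_A) := sqint_indic mA fA.
have LB : sqint mu1 setT (\1_B) := sqint_indic mB fB.
have EAB : (fun z : R2 => \1_A z.1 * \1_B z.2) = \1_(A `*` B) :> (R2 -> R).
  apply/funext => z; rewrite !indicE; have [h|h] := boolP (z \in A `*` B).
    by move: h; rewrite inE => -[h1 h2]; rewrite !mem_set// mulr1.
  have [h1|h1] := boolP (z.1 \in A); last by rewrite mul0r.
  have [h2|h2] := boolP (z.2 \in B); last by rewrite mulr0.
  by move: h; rewrite notin_setE; case; split; rewrite -inE.
have prodL (f g : measurableTypeR R -> R) : sqint mu1 setT f -> sqint mu1 setT g ->
   sqint leb2 setT (fun z : R2 => f z.1 * g z.2) /\
   ip leb2 setT (fun z : R2 => f z.1 * g z.2) (fun z : R2 => f z.1 * g z.2) =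
   ip mu1 setT f f * ip mu1 setT g g.
  move=> [mf If] [mg Ig].
  have E : (\int[leb2]_z ((f z.1 * g z.2) ^+ 2)%:E =
     (ip mu1 setT f f)%:E * (ip mu1 setT g g)%:E)%E.
    rewrite !ip_sqint// -tonelli_prod//.
    - by apply: eq_integral => z _; rewrite exprMn.
    - exact: measurable_funX.
    - exact: measurable_funX.
    - by move=> x; exact: sqr_ge0.
    - by move=> x; exact: sqr_ge0.
  have L : sqint leb2 setT (fun z : R2 => f z.1 * g z.2).
    apply/sqintP; split; last by rewrite [X in (X < _)%E]E -EFinM ltry.
    by apply: measurable_funM; exact: measurableT_comp.
  by split => //; apply: EFin_inj; rewrite ip_sqint// E.
have [LAB nAB] := prodL _ _ LA LB.
rewrite -EAB; split => // e e0.
pose c := 2 * ip mu1 setT (\1_A) (\1_A) + 2 * ip mu1 setT (\1_B) (\1_B) + 1.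
have c0 : 0 < c by rewrite /c; have := ip_ge0 mu1 setT (\1_A); have := ip_ge0 mu1 setT (\1_B); lra.
have ec : 0 < e / (2 * c) by rewrite divr_gt0// mulr_gt0.
have [N1 h1] := (approx1 LA).2 _ ec; have [N2 h2] := (approx1 LB).2 _ ec.
exists (maxn N1 N2) => n; rewrite geq_max => /andP[/h1 {}h1 /h2 {}h2].
set h := hn n in h1 h2 *; have h0 : 0 < h := hn_gt0 n.
pose mA' := Kop mu1 (k1 h) (\1_A); pose mB' := Kop mu1 (k1 h) (\1_B).
have LmA : sqint mu1 setT mA' by exact: (Kop_sqint (mu := mu1) (nu := mu1) (k1_bound h0) LA).
have LmB : sqint mu1 setT mB' by exact: (Kop_sqint (mu := mu1) (nu := mu1) (k1_bound h0) LB).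
have KE (z : R2) : Kop leb2 (k2 h) (fun z : R2 => \1_A z.1 * \1_B z.2) z = mA' z.1 * mB' z.2.
  rewrite /Kop /Rintegral -fineM; last 2 first.
  - apply: (integrable_fin_num measurableT).
    exact: (sqint_int measurableT LA (kernel_sqint (k1_bound h0) z.1)).
  - apply: (integrable_fin_num measurableT).
    exact: (sqint_int measurableT LB (kernel_sqint (k1_bound h0) z.2)).
  congr fine; rewrite -tonelli_prod.
  - by apply: eq_integral => y _; rewrite /k2 /k1; congr EFin; ring.
  - by apply: measurable_funM; [exact: measurable_indic|exact: measurable_ak_sub].
  - by apply: measurable_funM; [exact: measurable_indic|exact: measurable_ak_sub].
  - by move=> x; rewrite mulr_ge0 ?ak_ge0// indicE.
  - by move=> x; rewrite mulr_ge0 ?ak_ge0// indicE.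
have LdA := sqintB measurableT LmA LA; have LdB := sqintB measurableT LmB LB.
have [P1 N1'] := prodL _ _ LdA LmB; have [P2 N2'] := prodL _ _ LA LdB.
rewrite (_ : (fun x => Kop leb2 (k2 h) _ x - _) = (fun z : R2 => (mA' z.1 - \1_A z.1) * mB' z.2 +
   \1_A z.1 * (mB' z.2 - \1_B z.2))); last first.
  by apply/funext => z; rewrite KE; ring.
apply: le_lt_trans (ipD_le _ P1 P2) _ => //.
rewrite [X in 2 * X + _]N1' [X in _ + 2 * X]N2'.
have hB : ip mu1 setT mB' mB' <= ip mu1 setT (\1_B) (\1_B).
  by have := schur (k1_bound h0) LB; rewrite !mul1r.
set u := ip mu1 _ _ _ in h1 *; set v := ip _ _ _ _ in h2 *.
have u0 : 0 <= u by exact: ip_ge0.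
have v0 : 0 <= v by exact: ip_ge0.
have a0 := ip_ge0 mu1 setT (\1_A); have b0 := ip_ge0 mu1 setT (\1_B).
have b0' := ip_ge0 mu1 setT mB'.
have -> : e = c * (e / (2 * c)) + c * (e / (2 * c)) by field; rewrite gt_eqF.
set w := e / _ in ec h1 h2 *; rewrite /c.
set a := ip mu1 setT (\1_A) _ in a0 *; set b := ip mu1 setT (\1_B) _ in b0 hB *.
set b' := ip mu1 setT mB' _ in b0' hB *.
have q1 : u * b' <= w * b by rewrite ler_pM// ltW.
have q2 : a * v <= w * a by rewrite mulrC ler_wpM2r// ltW.
have q3 := mulr_ge0 (ltW ec) a0; have q4 := mulr_ge0 (ltW ec) b0.
clear -ec q1 q2 q3 q4; lra.
Qed.

Lemma approx2 (f : R2 -> R) : sqint leb2 setT f ->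
  approx leb2 (fun n => k2 (hn n)) f.
Proof.
move=> Lf.
pose G : set (set R2) := [set A `*` B | A in [set A | measurable A /\ (mu1 A < +oo)%E]
   & B in [set A | measurable A /\ (mu1 A < +oo)%E]].
have fI (A B : set (measurableTypeR R)) : measurable A -> measurable B -> (mu1 A < +oo)%E -> (mu1 (A `&` B) < +oo)%E.
  by move=> mA mB; apply: le_lt_trans; apply: le_measure; rewrite ?inE//; exact: measurableI.
have Bn (n : nat) : measurable (`[- n%:R, n%:R]%classic : set (measurableTypeR R)) /\
    (mu1 (`[(- n%:R)%R, n%:R%R]%classic) < +oo)%E.
  split; first exact: measurable_itv.
  exact: leb1_bnd.
have inBn (x : R) : exists N, forall n, (N <= n)%N -> (`[- n%:R, n%:R]%classic : set R) x.
  exists (Num.bound `|x|).+1 => n /= bn; rewrite in_itv/= -ler_norml.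
  by apply/ltW/(lt_le_trans (archi_boundP _)) => //; rewrite ler_nat ltnW.
apply: (@approx_sqint _ _ _ leb2 _ (fun n => k2_bound (hn_gt0 n)) G _ _ _ _
   (fun n => `[- n%:R, n%:R]%classic `*` `[- n%:R, n%:R]%classic)) => //.
- move=> X Y [A1 [mA1 fA1] [B1 [mB1 fB1] <-]] [A2 [mA2 fA2] [B2 [mB2 fB2] <-]].
  exists (A1 `&` A2); first by split; [exact: measurableI|exact: fI].
  by exists (B1 `&` B2); [split; [exact: measurableI|exact: fI]|rewrite setXI].
(* Rectangles of finite measure still generate: any measurable rectangle is the countable union of
   its intersections with bounded squares. *)
- rewrite measurable_prod_measurableType; apply/seteqP; split.
    apply: smallest_sub; first exact: smallest_sigma_algebra.
    move=> _ [A mA [B mB <-]].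
    rewrite (_ : A `*` B = \bigcup_n ((A `&` `[- n%:R, n%:R]%classic) `*` (B `&` `[- n%:R, n%:R]%classic))).
      apply: sigma_algebra_bigcup => n; apply: sub_sigma_algebra.
      have [m1 m2] := Bn n.
      exists (A `&` `[- n%:R, n%:R]%classic).
        by split; [exact: measurableI|rewrite setIC; exact: fI].
      exists (B `&` `[- n%:R, n%:R]%classic) => //.
      by split; [exact: measurableI|rewrite setIC; exact: fI].
    apply/seteqP; split => [x [h1 h2]|x [n _ [[h1 _] [h2 _]]]]; last by split.
    have [N1 H1] := inBn x.1; have [N2 H2] := inBn x.2.
    exists (maxn N1 N2) => //.
    by split; split => //; [apply: H1; exact: leq_maxl|apply: H2; exact: leq_maxr].
  apply: sub_smallest2r; first exact: smallest_sigma_algebra.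
  move=> _ [A [mA _] [B [mB _] <-]].
  by exists A => //; exists B.
- move=> X [A [mA fA] [B [mB fB] <-]].
  rewrite [X in (X < _)%E]product_measure1E//.
  by rewrite -ge0_fin_numE ?mule_ge0//; apply: fin_numM; rewrite ge0_fin_numE.
- by move=> X [A [mA fA] [B [mB fB] <-]]; exact: approx2_rect.
- move=> n; exists `[- n%:R, n%:R]%classic; first exact: Bn.
  by exists `[- n%:R, n%:R]%classic => //; exact: Bn.
- move=> x; have [N1 H1] := inBn x.1; have [N2 H2] := inBn x.2.
  exists (maxn N1 N2) => n; rewrite geq_max => /andP[/H1 ? /H2 ?]; by split.
Qed.

(* [bdtest h s] below cut off to the half-plane; it compares a mollified function
   on the line [x.2 = 0] with the mollified trace. *)
Definition k3 h (s : measurableTypeR R) (y : R2) : R :=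
  ak h (y.1 - s) * (tk h y.2 * \1_`]0, +oo[ y.2).

(** The row bound [4 * h] is the point: on the half-plane [tk h] lives at heights at most [4 * h],
    so by Schur's test this operator tends to 0 with [h]. *)
Lemma k3_bound h : 0 < h -> kernel_bound mu1 leb2 (k3 h) (4 * h) 1.
Proof.
move=> h0.
have t01 (t : R) : 0 <= tk h t * \1_`]0, +oo[ t <= \1_`]0, 4 * h] t.
  have [_ _ a b] := tk_props t h0.
  rewrite !indicE; case: (boolP (t \in `]0, +oo[%classic)).
    rewrite inE /= in_itv/= andbT => t0; have /andP[a1 a2] := a (ltW t0).
    rewrite mulr1 a1 /=; case: (boolP (t \in _)) => // ; rewrite notin_setE /= in_itv/= t0 /= => /negP n4.
    by rewrite b//; apply: contra n4 => /andP[].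
  by rewrite mulr0 lexx ler0n.
have mt : measurable_fun setT ((fun t => tk h t * \1_`]0, +oo[ t) : measurableTypeR R -> R).
  apply: measurable_funM; last exact: measurable_indic.
  by apply: continuous_measurable_fun; exact: tk_cont.
split.
- apply: measurable_funM.
    by apply: measurable_ak_sub => //; do ?[exact: measurableT_comp].
  by apply: (measurableT_comp mt); exact: measurableT_comp.
- by move=> x y; rewrite mulr_ge0 ?ak_ge0//; case/andP: (t01 y.2).
- exists h^-1 => x y; rewrite -[h^-1]mulr1; apply: ler_pM; rewrite ?ak_ge0 ?ak_le//.
    by case/andP: (t01 y.2).
  case/andP: (t01 y.2) => _ a; apply: le_trans a _.
  by rewrite indicE; case: (_ \in _).
- move=> x; rewrite /k3 (@tonelli_prod _ (fun s => ak h (s - x)) (fun t => tk h t * \1_`]0, +oo[ t)) => //.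
  + rewrite eint_ak_r// mul1e.
    apply: (@le_trans _ _ (\int[mu1]_y (\1_`]0%R, (4 * h)%R] y)%:E)%E).
      apply: ge0_le_integral => //.
      * by move=> t _; rewrite lee_fin; case/andP: (t01 t).
      * exact/measurable_EFinP.
      * by apply/measurable_EFinP; exact: measurable_indic.
      * by move=> t _; rewrite lee_fin; case/andP: (t01 t).
    have mI : measurable (`]0, 4 * h]%classic : set (measurableTypeR R)) by exact: measurable_itv.
    rewrite (integral_indic _ measurableT mI).
    rewrite setIT; have := leb1E `]0%R, (4 * h)%R]%classic.
    rewrite lebesgue_measure_itv/= lte_fin ifT ?mulr_gt0// sube0 => E.
    by rewrite [X in (X <= _)%E]E.
  + exact: measurable_ak_sub.
  + by move=> s; exact: ak_ge0.
  + by move=> t; case/andP: (t01 t).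
- move=> y; rewrite /k3.
  apply: (@le_trans _ _ (\int[mu1]_x (ak h (y.1 - x))%:E)%E); last by rewrite eint_ak_l.
  apply: ge0_le_integral => //.
  + by move=> x _; rewrite lee_fin mulr_ge0 ?ak_ge0//; case/andP: (t01 y.2).
  + apply/measurable_EFinP; apply: measurable_funM => //.
    exact: measurable_ak_sub.
  + by apply/measurable_EFinP; exact: measurable_ak_sub.
  + move=> x _; rewrite lee_fin ler_piMr ?ak_ge0//; case/andP: (t01 y.2) => _ a; apply: le_trans a _.
    by rewrite indicE; case: (_ \in _).
Qed.

End Approx.

(** * Smoothness of mollified functions *)

Section KernelSmooth.
Context {R : realType}.
Local Notation R2 := (measurableTypeR R * measurableTypeR R)%type.
Local Notation leb2 := (@leb2 R).
Variables (f : R2 -> R) (If : leb2.-integrable setT (EFin \o f)).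

Let N := \int[leb2]_y `|f y|.

Let If' : leb2.-integrable setT (EFin \o (fun y => `|f y|)).
Proof. exact: integrable_norm. Qed.

Let mf : measurable_fun setT f.
Proof. by case/integrableP: If => /measurable_EFinP. Qed.

Let N0 : 0 <= N. Proof. by apply: Rintegral_ge0. Qed.

Lemma integrable_bM (g : R2 -> R) (M : R) : measurable_fun setT g ->
  (forall y, `|g y| <= M) -> leb2.-integrable setT (EFin \o (fun y => f y * g y)).
Proof.
move=> mg gM; apply: (@integrable_le _ R2 R leb2 setT (fun y => f y * g y) (fun y => M * `|f y|)) => //.
- exact: measurable_funM mf mg.
- by move=> y _; rewrite normrM mulrC ler_wpM2r.
- exact: integrableZr'.
Qed.

Lemma integral_bM_le (g : R2 -> R) (M : R) : measurable_fun setT g ->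
  (forall y, `|g y| <= M) -> `|\int[leb2]_y (f y * g y)| <= M * N.
Proof.
move=> mg gM; have I := integrable_bM mg gM.
apply: le_trans (le_normr_Rintegral _ I) _ => //.
rewrite -RintegralZl//; apply: le_Rintegral => //.
- exact: integrable_norm.
- exact: integrableZr'.
- by move=> y _; rewrite normrM mulrC ler_wpM2r.
Qed.

Definition Kint (g : R2 -> R2 -> R) (x : R * R) : R := \int[leb2]_y (f y * g x y).

Definition bdk (g : R2 -> R2 -> R) (M : R) :=
  (forall x, measurable_fun setT (g x)) /\ forall x y, `|g x y| <= M.

Lemma Kint_cont g M C : bdk g M ->
  (forall x z y : R * R, `|z| <= 1 -> `|g (z + x) y - g x y| <= C * `|z|) ->
  continuous (Kint g).
Proof.
move=> [mg gM] gC x; apply/cvgrPdist_le => /= e e0.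
have C1 : 0 < `|C| * N + 1 by rewrite ltr_wpDl// mulr_ge0.
pose r := Num.min 1 (e / (`|C| * N + 1)).
have r0 : 0 < r by rewrite lt_min ltr01 divr_gt0.
suff : \forall z \near (x : R * R), `|Kint g x - Kint g z| <= e by [].
apply/nbhs_ballP; exists r => //= z [h1 h2].
have zr : `|z - x| <= r.
  by rewrite prod_normE ge_max; apply/andP; split; rewrite distrC ltW.
rewrite distrC /Kint -RintegralB//; [|exact: integrable_bM (mg _) (gM _)..].
under eq_Rintegral do rewrite -mulrBr.
have z1 : `|z - x| <= 1 by rewrite (le_trans zr)// ge_min lexx.
apply: (le_trans (@integral_bM_le _ (`|C| * `|z - x|) _ _)).
- exact: measurable_funB.
- move=> y; have := gC x (z - x) y z1; rewrite subrK => h; apply: le_trans h _.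
  by rewrite ler_wpM2r// ler_norm.
- have zr' : `|z - x| <= e / (`|C| * N + 1) by rewrite (le_trans zr)// ge_min lexx orbT.
  rewrite ler_pdivlMr// in zr'; rewrite mulrAC mulrC; apply: le_trans zr'.
  by rewrite ler_wpM2l// lerDl.
Qed.

(** Differentiation under the integral sign: a Taylor remainder of the kernel that is uniform in [y]
    integrates against [f] to a quadratic remainder with constant [C * N]. *)
Lemma Kint_C1g g g1 g2 M C C' : bdk g M -> bdk g1 M -> bdk g2 M ->
  (forall x z y : R * R, `|z| <= 1 ->
    `|g (z + x) y - g x y - (z.1 * g1 x y + z.2 * g2 x y)| <= C * `|z| ^+ 2) ->
  (forall x z y : R * R, `|z| <= 1 -> `|g1 (z + x) y - g1 x y| <= C' * `|z|) ->
  (forall x z y : R * R, `|z| <= 1 -> `|g2 (z + x) y - g2 x y| <= C' * `|z|) ->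
  C1g (Kint g) (Kint g1) (Kint g2).
Proof.
move=> bg bg1 bg2 gT l1 l2; split; last 2 first.
- exact: Kint_cont bg1 l1.
- exact: Kint_cont bg2 l2.
move=> x; apply: (@is_diff_taylor _ _ _ _ _ (C * N)) => z z1.
have [mg gM] := bg; have [mg1 gM1] := bg1; have [mg2 gM2] := bg2.
have I x' := integrable_bM (mg x') (gM x').
have I1 := integrable_bM (mg1 x) (gM1 x).
have I2 := integrable_bM (mg2 x) (gM2 x).
have -> : Kint g (z + x) - Kint g x - (z.1 * Kint g1 x + z.2 * Kint g2 x) =
  \int[leb2]_y (f y * (g (z + x) y - g x y - (z.1 * g1 x y + z.2 * g2 x y))).
  rewrite /Kint -!RintegralZl// -RintegralB// -RintegralD//; try exact: integrableZr'.
  rewrite -RintegralB//.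
  - by apply: eq_Rintegral => y _; ring.
  - exact: integrableBr.
  - by apply: integrableDr => //; exact: integrableZr'.
apply: (le_trans (@integral_bM_le _ (C * `|z| ^+ 2) _ _)).
- apply: measurable_funB; first exact: measurable_funB.
  by apply: measurable_funD; exact: measurable_funM.
- by move=> y; exact: gT.
- by rewrite mulrAC.
Qed.

End KernelSmooth.

Section Mollifier.
Context {R : realType}.
Local Notation R2 := (measurableTypeR R * measurableTypeR R)%type.
Local Notation leb2 := (@leb2 R).

Lemma dak_measurable (h : R) : 0 < h -> measurable_fun setT (dak h : measurableTypeR R -> R).
Proof. by move=> h0; apply: continuous_measurable_fun; exact: dak_cont. Qed.

Lemma measurable_dak_sub d (T : measurableType d) (h : R) (f g : T -> R) : 0 < h ->
  measurable_fun setT f -> measurable_fun setT g ->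
  measurable_fun setT (fun z => dak h (f z - g z)).
Proof.
move=> h0 mf mg; apply: (@measurableT_comp _ _ _ _ _ _ (dak h)).
  exact: dak_measurable.
exact: measurable_funB.
Qed.

Lemma ak_lip1 (h t r : R) : 0 < h -> `|r| <= 1 ->
  `|ak h (t + r) - ak h t| <= (3 / h ^+ 2 + 4 / h ^+ 3) * `|r|.
Proof.
move=> h0 r1; have T := ak_taylor t r h0; have D := dak_le t h0.
have -> : ak h (t + r) - ak h t = (ak h (t + r) - ak h t - dak h t * r) + dak h t * r by ring.
apply: le_trans (ler_normD _ _) _; rewrite mulrDl addrC lerD//.
  by rewrite normrM ler_wpM2r.
apply: le_trans T _; rewrite -real_normK ?num_real// expr2 mulrA -[leRHS]mulr1.
by rewrite ler_wpM2l// mulr_ge0// divr_ge0// exprn_ge0// ltW.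
Qed.

Lemma mollifier_C1g (h : R) (f : R2 -> R) : 0 < h ->
  leb2.-integrable setT (EFin \o f) ->
  C1g (Kop leb2 (k2 h) f)
    (fun x => - \int[leb2]_y (f y * (dak h (y.1 - x.1) * ak h (y.2 - x.2))))
    (fun x => - \int[leb2]_y (f y * (ak h (y.1 - x.1) * dak h (y.2 - x.2)))).
Proof.
move=> h0 If.
pose A := h^-1; pose D := 3 / h ^+ 2; pose T := 4 / h ^+ 3; pose E := 8 / h ^+ 3.
have A0 : 0 <= A by rewrite invr_ge0 ltW.
have D0 : 0 <= D by rewrite divr_ge0// exprn_ge0// ltW.
have T0 : 0 <= T by rewrite divr_ge0// exprn_ge0// ltW.
have E0 : 0 <= E by rewrite divr_ge0// exprn_ge0// ltW.
have akA t : `|ak h t| <= A by rewrite ger0_norm ?ak_ge0 ?ak_le.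
have dakD t : `|dak h t| <= D by exact: dak_le.
pose g1 (x y : R2) : R := - (dak h (y.1 - x.1) * ak h (y.2 - x.2)).
pose g2 (x y : R2) : R := - (ak h (y.1 - x.1) * dak h (y.2 - x.2)).
have m1 (x : R2) : measurable_fun setT (fun y : R2 => ak h (y.1 - x.1)) by apply: measurable_ak_sub.
have m2 (x : R2) : measurable_fun setT (fun y : R2 => ak h (y.2 - x.2)) by apply: measurable_ak_sub.
have n1 (x : R2) : measurable_fun setT (fun y : R2 => dak h (y.1 - x.1)) by apply: measurable_dak_sub.
have n2 (x : R2) : measurable_fun setT (fun y : R2 => dak h (y.2 - x.2)) by apply: measurable_dak_sub.
pose M := A * A + D * A.
have bg : bdk (k2 h) M.
  split; first by move=> x; exact: measurable_funM.
  move=> x y; rewrite normrM; apply: (@le_trans _ _ (A * A)); first exact: ler_pM.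
  by rewrite lerDl mulr_ge0.
have bg1 : bdk g1 M.
  split; first by move=> x; apply: measurable_funN; exact: measurable_funM.
  move=> x y; rewrite normrN normrM; apply: (@le_trans _ _ (D * A)); first exact: ler_pM.
  by rewrite lerDr mulr_ge0.
have bg2 : bdk g2 M.
  split; first by move=> x; apply: measurable_funN; exact: measurable_funM.
  move=> x y; rewrite normrN normrM mulrC; apply: (@le_trans _ _ (D * A)); first exact: ler_pM.
  by rewrite lerDr mulr_ge0.
have nz (z : R * R) : `|z.1| <= `|z| /\ `|z.2| <= `|z|.
  by rewrite prod_normE !le_max !lexx orbT.
have sh (y x z : R) : y - (z + x) = (y - x) + (- z) by ring.
pose Q := D + T.
have Q0 : 0 <= Q by rewrite addr_ge0.
have lipA t (z : R) : `|z| <= 1 -> `|ak h (t - z) - ak h t| <= Q * `|z|.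
  by move=> z1; have := @ak_lip1 h t (- z) h0; rewrite normrN; apply.
have lipD t (z : R) : `|dak h (t - z) - dak h t| <= E * `|z|.
  by have := @dak_lip _ h (t - z) t h0; rewrite (_ : t - z - t = - z) ?normrN//; ring.
(* Finite-difference form of the product rule for bounded Lipschitz factors. *)
have prodlip (a b a' b' : R) (Ma Mb La Lb n : R) : 0 <= n -> 0 <= Ma -> 0 <= Mb ->
   `|b'| <= Mb -> `|a| <= Ma -> `|a' - a| <= La * n -> `|b' - b| <= Lb * n ->
   `|a' * b' - a * b| <= (La * Mb + Ma * Lb) * n.
  move=> n0 Ma0 Mb0 hb ha hA hB.
  have -> : a' * b' - a * b = (a' - a) * b' + a * (b' - b) by ring.
  apply: le_trans (ler_normD _ _) _; rewrite [leRHS]mulrDl lerD// normrM.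
    by rewrite mulrAC; apply: ler_pM.
  by rewrite -mulrA; apply: ler_pM.
pose C' := E * A + D * Q + (Q * D + A * E).
have := @Kint_C1g R f If (k2 h) g1 g2 M (T * A + (A + D) * T + D * D) C' bg bg1 bg2.
move=> H; have {H} : C1g (Kint f (k2 h)) (Kint f g1) (Kint f g2).
  apply: H.
  - move=> x z y z1; have [z1n z2n] := nz z; have z11 := le_trans z1n z1; have z21 := le_trans z2n z1.
    rewrite /k2 /g1 /g2 /= (sh y.1 x.1) (sh y.2 x.2).
    set s := y.1 - x.1; set t := y.2 - x.2.
    have e1 := ak_taylor s (- z.1) h0; have e2 := ak_taylor t (- z.2) h0.
    set r1 := ak h (s - z.1) - ak h s - dak h s * (- z.1) in e1.
    set r2 := ak h (t - z.2) - ak h t - dak h t * (- z.2) in e2.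
    rewrite !sqrrN in e1 e2.
    (* Remainder of a product of two expansions: [r1] and [r2] are the remainders of the factors,
       and the last term is the mixed product of the two first order terms. *)
    have -> : ak h (s - z.1) * ak h (t - z.2) - ak h s * ak h t -
       (z.1 * - (dak h s * ak h t) + z.2 * - (ak h s * dak h t)) =
       r1 * ak h (t - z.2) + (ak h s - dak h s * z.1) * r2 + dak h s * dak h t * (z.1 * z.2).
      by rewrite /r1 /r2; ring.
    have sq1 : z.1 ^+ 2 <= `|z| ^+ 2 by rewrite -real_normK ?num_real// ler_sqr ?nnegrE.
    have sq2 : z.2 ^+ 2 <= `|z| ^+ 2 by rewrite -real_normK ?num_real// ler_sqr ?nnegrE.
    have b1 : `|r1 * ak h (t - z.2)| <= T * A * `|z| ^+ 2.
      rewrite normrM mulrAC; apply: ler_pM => //.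
      by apply: le_trans e1 _; rewrite ler_wpM2l.
    have b2 : `|(ak h s - dak h s * z.1) * r2| <= (A + D) * T * `|z| ^+ 2.
      rewrite normrM -mulrA; apply: ler_pM => //.
        apply: le_trans (ler_normB _ _) _; rewrite lerD// normrM -[D]mulr1.
        exact: ler_pM.
      by apply: le_trans e2 _; rewrite ler_wpM2l.
    have b3 : `|dak h s * dak h t * (z.1 * z.2)| <= D * D * `|z| ^+ 2.
      rewrite normrM (normrM (dak h s)) (normrM z.1) [in leRHS]expr2.
      have dd := ler_pM (normr_ge0 _) (normr_ge0 _) (dakD s) (dakD t).
      have zz := ler_pM (normr_ge0 _) (normr_ge0 _) z1n z2n.
      by apply: ler_pM dd zz; apply: mulr_ge0.
    apply: le_trans (ler_normD _ _) _; rewrite [leRHS]mulrDl; apply: lerD => //.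
    by apply: le_trans (ler_normD _ _) _; rewrite [leRHS]mulrDl; apply: lerD.
  - move=> x z y z1; have [z1n z2n] := nz z; have z11 := le_trans z1n z1; have z21 := le_trans z2n z1.
    rewrite /g1 /= (sh y.1 x.1) (sh y.2 x.2) -opprD normrN.
    apply: (@le_trans _ _ ((E * A + D * Q) * `|z|)); last first.
      by rewrite ler_wpM2r// lerDl addr_ge0// mulr_ge0.
    apply: prodlip => //.
      by apply: le_trans (lipD _ _) _; rewrite ler_wpM2l.
    by apply: le_trans (lipA _ _ z21) _; rewrite ler_wpM2l.
  - move=> x z y z1; have [z1n z2n] := nz z; have z11 := le_trans z1n z1; have z21 := le_trans z2n z1.
    rewrite /g2 /= (sh y.1 x.1) (sh y.2 x.2) -opprD normrN.
    apply: (@le_trans _ _ ((Q * D + A * E) * `|z|)); last first.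
      by rewrite ler_wpM2r// lerDr addr_ge0// mulr_ge0.
    apply: prodlip => //.
      by apply: le_trans (lipA _ _ z11) _; rewrite ler_wpM2l.
    by apply: le_trans (lipD _ _) _; rewrite ler_wpM2l.
move=> H; apply: (eq_C1g H) => x //.
- rewrite /Kint -mulN1r -RintegralZl//.
    by apply: eq_Rintegral => y _; rewrite /g1; ring.
  apply: (integrable_bM If (M := D * A)); first exact: measurable_funM.
  by move=> y; rewrite normrM; exact: ler_pM.
- rewrite /Kint -mulN1r -RintegralZl//.
    by apply: eq_Rintegral => y _; rewrite /g2; ring.
  apply: (integrable_bM If (M := A * D)); first exact: measurable_funM.
  by move=> y; rewrite normrM; exact: ler_pM.
Qed.

End Mollifier.

Section Restriction.
Context d (T : measurableType d) (R : realType) (mu : {measure set T -> \bar R}).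
Implicit Types (D E : set T) (f g : T -> R).

Lemma patchM E f g : (fun x => (f \_ E) x * g x) = ((fun x => f x * g x) \_ E).
Proof. by apply/funext => x; rewrite /patch; case: ifP; rewrite ?mul0r. Qed.

Lemma sqint_patch D E f : measurable D -> measurable E ->
  sqint mu (D `&` E) f -> sqint mu D (f \_ E).
Proof.
move=> mD mE [mf If]; split.
  by apply/measurable_restrict => //; rewrite setIC.
apply/(integrable_mkcond _ mD).
move/(integrable_mkcond _ (measurableI _ _ mD mE)): If; congr (_.-integrable _ _).
apply/funext => x; rewrite /patch in_setI /=.
case: (x \in D); case: (x \in E) => //=.
by change (0%:E = (0 ^+ 2)%:E :> \bar R); rewrite expr0n.
Qed.

Lemma Rintegral_patch D E f : \int[mu]_(x in D) (f \_ E) x = \int[mu]_(x in D `&` E) f x.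
Proof. by rewrite Rintegral_mkcondr. Qed.

Lemma Rintegral_patchM D E f g :
  \int[mu]_(x in D) ((f \_ E) x * g x) = \int[mu]_(x in D `&` E) (f x * g x).
Proof. by rewrite -Rintegral_patch; rewrite -patchM. Qed.

Lemma Rintegral_sub D E f : E `<=` D -> (forall x, D x -> ~ E x -> f x = 0) ->
  \int[mu]_(x in D) f x = \int[mu]_(x in E) f x.
Proof.
move=> ED f0; rewrite [RHS]Rintegral_mkcond [LHS]Rintegral_mkcond.
apply: eq_Rintegral => x _; rewrite /patch.
case: (pselect (E x)) => Ex.
  by rewrite !mem_set//; exact: ED.
rewrite [x \in E]memNset//; case: ifPn => // /set_mem Dx; exact: f0.
Qed.

End Restriction.

(** * Sobolev functions with a trace *)

Section TestFunctions.
Context {R : realType}.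
Local Notation R2 := (measurableTypeR R * measurableTypeR R)%type.
Local Notation mu1 := (@leb1 R).
Local Notation leb2 := (@leb2 R).
Local Notation H := (halfplane : set R2).
Implicit Types (f g psi eta : R * R -> R) (t : R -> R).

Definition vanish (L : R) eta := forall x, ~ box L x -> eta x = 0.

Lemma vanishS (L L' : R) eta : L <= L' -> vanish L eta -> vanish L' eta.
Proof. by move=> LL v x nx; apply: v => /(sub_box LL). Qed.

Lemma vanish_d L eta eta1 eta2 : C1g eta eta1 eta2 -> vanish L eta ->
  vanish L eta1 /\ vanish L eta2.
Proof.
by move=> h v; split=> x nx; have [] := derive_outside h (@closed_box R L) v nx.
Qed.

Lemma C1g_prod (g g' k k' : R -> R) :
  (forall s : R, is_derive s (1 : R) g (g' s)) -> continuous g' ->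
  (forall s : R, is_derive s (1 : R) k (k' s)) -> continuous k' ->
  C1g (fun x => g x.1 * k x.2) (fun x => g' x.1 * k x.2) (fun x => g x.1 * k' x.2).
Proof.
move=> dg cg dk ck.
have := C1gM (C1g_comp dg cg (@C1g_fst R)) (C1g_comp dk ck (@C1g_snd R)).
by move/eq_C1g; apply => x //=; rewrite !mulr0 !mulr1 ?add0r ?addr0// mulrC.
Qed.

Definition loc2 f := forall L : R, sqint leb2 (H `&` box L) f.
Definition loc1 t := forall L : R, sqint mu1 `[- L, L] t.

Lemma cont_sqint (D : set R2) (L : R) f : measurable D -> continuous f -> vanish L f ->
  sqint leb2 D f.
Proof.
move=> mD cf v; split.
  by apply: measurable_funTS; exact: continuous_measurable_fun2.
apply: (@cont_integrable_box R D _ L) => //.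
  by move=> x; apply: cvgM; exact: cf.
by move=> x nx; rewrite v// expr0n.
Qed.

Lemma cont_loc2 f : continuous f -> loc2 f.
Proof.
move=> cf L; have mD : measurable (H `&` box L).
  by apply: measurableI; [exact: measurable_halfplane|exact: measurable_box].
have mf : measurable_fun (H `&` box L) f.
  by apply: measurable_funTS; exact: continuous_measurable_fun2.
split=> //; have [M M0 hM] := box_bounded L cf.
apply: (@integrable_box R _ _ L (M ^+ 2)) => //.
- exact: measurable_funX.
- by move=> x [_ bx] nbx.
- move=> x _ bx; rewrite normrX ler_sqr ?nnegrE//; exact: hM.
Qed.

Lemma cont_sqint1 (L : R) (D : set (measurableTypeR R)) t : measurable D -> continuous t ->
  (forall s, ~~ (- L <= s <= L) -> t s = 0) -> sqint mu1 D t.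
Proof.
move=> mD ct t0; apply: (@sqintS _ _ _ _ setT) => //; split.
  exact: continuous_measurable_fun.
apply: (@integrable_bounded_support R _ (- L) L).
  by move=> x; apply: cvgM; exact: ct.
by move=> s hs; rewrite t0// expr0n.
Qed.

Lemma measurable_Hbox (L : R) : measurable (H `&` box L).
Proof. by apply: measurableI; [exact: measurable_halfplane|exact: measurable_box]. Qed.
Hint Resolve measurable_halfplane measurable_box measurable_Hbox : core.

Lemma loc2_patch L f : loc2 f -> sqint leb2 H (f \_ (box L)).
Proof. by move=> /(_ L); apply: sqint_patch. Qed.

Lemma loc2_vanish L f : loc2 f -> (forall x, H x -> ~ box L x -> f x = 0) -> sqint leb2 H f.
Proof.
move=> lf v; apply: (@eq_sqint _ R2 R leb2 H (f \_ (box L)) f) => //; last exact: loc2_patch.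
move=> x /set_mem Hx; rewrite /patch; case: ifPn => // /negP nx.
by rewrite v// => bx; apply: nx; rewrite inE.
Qed.

Lemma loc2_int L f eta : loc2 f -> continuous eta -> vanish L eta ->
  leb2.-integrable H (EFin \o (fun x => f x * eta x)).
Proof.
move=> lf ce v; have := @sqint_int _ _ _ leb2 H _ _ (measurable_halfplane) (loc2_patch L lf) (cont_sqint (measurable_halfplane) ce v).
congr (_.-integrable _ _); apply/funext => x /=; rewrite /patch; case: ifPn => // /negP nx.
by rewrite v ?mulr0 ?mul0r// => bx; apply: nx; rewrite inE.
Qed.

Lemma loc1_patch L t : loc1 t -> sqint mu1 setT (t \_ `[- L, L]).
Proof. by move=> /(_ L) h; apply: sqint_patch => //; rewrite setTI. Qed.

Lemma loc1_int L t (e : R -> R) : loc1 t -> continuous e -> (forall s : R, ~~ (- L <= s <= L) -> e s = 0) ->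
  mu1.-integrable setT (EFin \o (fun x => t x * e x)).
Proof.
move=> lf ce v; have := @sqint_int _ _ _ mu1 setT _ _ measurableT (loc1_patch L lf) (cont_sqint1 measurableT ce v).
congr (_.-integrable _ _); apply/funext => x /=; rewrite /patch; case: ifPn => // /negP nx.
by rewrite v ?mulr0 ?mul0r//; apply/negP => bx; apply: nx; rewrite inE/= in_itv.
Qed.

Lemma vanish_line L eta s : vanish L eta -> ~~ (- L <= s <= L) -> eta (s, 0) = 0.
Proof. by move=> v n; apply: v; exact: not_box_fst. Qed.

Lemma C1g_k2 (h : R) (x : R * R) : 0 < h ->
  C1g (k2 h x) (fun y => dak h (y.1 - x.1) * ak h (y.2 - x.2))
    (fun y => ak h (y.1 - x.1) * dak h (y.2 - x.2)).
Proof.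
move=> h0; have D c s : is_derive s (1 : R) (fun r => ak h (r - c)) (dak h (s - c)).
  by apply: shift_derive => t; exact: is_derive_ak.
have C c : continuous (fun r => dak h (r - c)).
  move=> s; apply: (@cvg_comp _ _ _ (fun r => r - c) (dak h) _ (nbhs (s - c))).
    by apply: cvgB; [exact: cvg_id|exact: cvg_cst].
  exact: dak_cont.
exact: (C1g_prod (D _) (C _) (D _) (C _)).
Qed.

Lemma k2_supp (h : R) (x y : R * R) : 0 < h ->
  ~ (x.1 + h <= y.1 <= x.1 + 4 * h /\ x.2 + h <= y.2 <= x.2 + 4 * h) -> k2 h x y = 0.
Proof.
move=> h0 n; rewrite /k2.
have [a|a] := boolP (h <= y.1 - x.1 <= 4 * h); last by rewrite (ak_out h0 a).1 mul0r.
have [b|b] := boolP (h <= y.2 - x.2 <= 4 * h); last by rewrite (ak_out h0 b).1 mulr0.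
by exfalso; apply: n; lra.
Qed.

Lemma k2_vanish (h L : R) x : 0 < h -> box L x -> vanish (L + 4 * h) (k2 h x).
Proof.
move=> h0 bx y ny; apply: k2_supp => // hy; apply: ny.
by case: bx hy; rewrite /box/= !ler_norml => a b c; lra.
Qed.

Lemma k2_below (h : R) (x y : R * R) : 0 < h -> y.2 < x.2 + h -> k2 h x y = 0.
Proof. by move=> h0 l; apply: k2_supp => // -[_]; lra. Qed.

Definition bdtest h s (y : R * R) : R := ak h (y.1 - s) * tk h y.2.

Lemma C1g_bdtest (h s : R) : 0 < h ->
  C1g (bdtest h s) (fun y => dak h (y.1 - s) * tk h y.2)
    (fun y => ak h (y.1 - s) * (ak h (y.2 + 11 * h) - ak h y.2)).
Proof.
move=> h0; apply: (@C1g_prod (fun r => ak h (r - s)) (fun r => dak h (r - s)) (tk h) (fun r => ak h (r + 11 * h) - ak h r)).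
- by move=> r; apply: shift_derive => t; exact: is_derive_ak.
- move=> r; apply: (@cvg_comp _ _ _ (fun r => r - s) (dak h) _ (nbhs (r - s))).
    by apply: cvgB; [exact: cvg_id|exact: cvg_cst].
  exact: dak_cont.
- by move=> t; exact: is_derive_tk.
- move=> r; apply: cvgB; last exact: ak_cont.
  apply: (@cvg_comp _ _ _ (fun r => r + 11 * h) (ak h) _ (nbhs (r + 11 * h))).
    by apply: cvgD; [exact: cvg_id|exact: cvg_cst].
  exact: ak_cont.
Qed.

Lemma bdtest_vanish (h s : R) : 0 < h -> vanish (`|s| + 10 * h) (bdtest h s).
Proof.
move=> h0 y ny; rewrite /bdtest.
have [a|a] := boolP (h <= y.1 - s <= 4 * h); last by rewrite (ak_out h0 a).1 mul0r.
have [b|b] := boolP (- 10 * h <= y.2 <= 4 * h); last first.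
  by have [_ _ _ ->] := tk_props y.2 h0; rewrite ?mulr0.
exfalso; apply: ny; rewrite /box/= !ler_norml.
by have := ler_norm s; have := ler_norm (- s); rewrite normrN; have := normr_ge0 s; lra.
Qed.

Lemma bdtest_line (h s r : R) : 0 < h -> bdtest h s (r, 0) = ak h (r - s).
Proof. by move=> h0; rewrite /bdtest/=; have [_ -> _ _] := tk_props 0 h0; rewrite mulr1. Qed.

Lemma Kop_patch (k : R2 -> R2 -> R) f D x : Kop leb2 k (f \_ D) x = \int[leb2]_(y in D) (f y * k x y).
Proof. by rewrite /Kop ipE Rintegral_patchM setTI. Qed.

Lemma small_eq0 (a : R) : 0 <= a -> (forall e, 0 < e -> a < e) -> a = 0.
Proof.
move=> a0 h; apply/eqP; rewrite eq_le a0 andbT leNgt; apply/negP => /h; by rewrite ltxx.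
Qed.

Lemma ae_nat (d : measure_display) (T : measurableType d) (mu : {measure set T -> \bar R}) (P : nat -> T -> Prop) :
  (forall n, {ae mu, forall x, P n x}) -> {ae mu, forall x, forall n, P n x}.
Proof.
move=> h.
have := negligible_bigcup h; apply: negligibleS => x /=.
move=> /existsNP[n Pn]; exists n => //.
Qed.

Lemma Rnat_bound (r : R) : exists n : nat, r <= n%:R.
Proof. by exists (Num.bound `|r|); apply: le_trans (ler_norm r) _; apply/ltW/archi_boundP. Qed.

(** For [x] in the half-plane the kernel [k2 h x] is supported at height at least [x.2 + h], so it
    is an admissible test function. The mollification of [f] therefore vanishes at [x], and it
    converges to [f] in L^2. *)
Lemma fundamental2 f : loc2 f ->
  (forall eta eta1 eta2 (L c : R), C1g eta eta1 eta2 -> vanish L eta -> 0 < c ->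
    (forall x, x.2 < c -> eta x = 0) -> \int[leb2]_(x in H) (f x * eta x) = 0) ->
  {ae leb2, forall x, H x -> f x = 0}.
Proof.
move=> lf f0.
have {}f0 (n : nat) : {ae leb2, forall x, (H `&` box n%:R) x -> f x = 0}.
  apply: ip_eq0_ae => //.
  apply: small_eq0; first exact: ip_ge0.
  move=> e e0; pose L : R := n%:R + 4.
  have Lp : sqint leb2 setT (f \_ (H `&` box L)).
    by apply: sqint_patch => //; rewrite setTI.
  have [_ /(_ e e0)[N /(_ N (leqnn N))]] := approx2 Lp.
  apply: le_lt_trans; set K := Kop _ _ _.
  have SK : sqint leb2 setT (fun x => K x - (f \_ (H `&` box L)) x).
    by apply: sqintB => //; apply: (Kop_sqint (k2_bound (hn_gt0 N))).
  apply: le_trans (ip_subset measurableT (measurable_Hbox n%:R) (@subsetT _ _) SK).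
  apply: ip_le => //.
    exact: sqintS SK.
  move=> x [Hx bx].
  have -> : K x = 0; last first.
    rewrite sub0r normrN /patch mem_set//; split=> //; apply: sub_box bx; rewrite /L; lra.
  have h1 : hn N <= 1 :> R by rewrite /hn invf_le1// ler1n.
  have h0 := @hn_gt0 R N.
  have v : vanish L (k2 (hn N) x).
    by apply: vanishS (k2_vanish h0 bx); rewrite /L; lra.
  rewrite /K Kop_patch -[RHS](f0 (k2 (hn N) x) _ _ L (hn N) (C1g_k2 x h0) v h0); last first.
    by move=> y hy; apply: k2_below => //; move: Hx; rewrite /halfplane/=; lra.
  apply/esym/Rintegral_sub => [y []//|y Hy n1]; rewrite v ?mulr0// => b1; exact: n1.
have := ae_nat f0; apply: filterS => x hx Hx.
have [m hm] := Rnat_bound (`|x.1| + `|x.2|).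
by apply: (hx m); split=> //; apply: sub_box (in_box x).
Qed.

(** As in [fundamental2]: the mollifier on the line is the boundary value of the planar test
    function [bdtest h s]. *)
Lemma fundamental1 t : loc1 t ->
  (forall eta eta1 eta2 (L : R), C1g eta eta1 eta2 -> vanish L eta ->
    \int[mu1]_s (t s * eta (s, 0)) = 0) ->
  {ae mu1, forall s, t s = 0}.
Proof.
move=> lf f0.
have {}f0 (n : nat) : {ae mu1, forall s, `[- n%:R, n%:R]%classic s -> t s = 0}.
  apply: ip_eq0_ae => //.
  apply: small_eq0; first exact: ip_ge0.
  move=> e e0; pose L : R := n%:R + 4.
  have Lp := loc1_patch L lf.
  have [_ /(_ e e0)[N /(_ N (leqnn N))]] := approx1 Lp.
  apply: le_lt_trans; set K := Kop _ _ _.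
  have SK : sqint mu1 setT (fun x => K x - (t \_ `[- L, L]) x).
    by apply: sqintB => //; apply: (Kop_sqint (k1_bound (hn_gt0 N))).
  have mI : measurable (`[- n%:R, n%:R]%classic : set (measurableTypeR R)) by [].
  apply: le_trans (ip_subset measurableT mI (@subsetT _ _) SK).
  apply: ip_le => //.
    exact: sqintS SK.
  move=> x /=; rewrite in_itv/= => bx.
  have -> : K x = 0; last first.
    by rewrite sub0r normrN /patch mem_set//= in_itv/= /L; lra.
  have h1 : hn N <= 1 :> R by rewrite /hn invf_le1// ler1n.
  have h0 := @hn_gt0 R N.
  rewrite /K /Kop ipE Rintegral_patchM setTI.
  rewrite -[RHS](f0 _ _ _ _ (C1g_bdtest x h0) (bdtest_vanish (s := x) h0)).
  under [RHS]eq_Rintegral do rewrite bdtest_line//.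
  apply/esym/Rintegral_sub => // y _ /= n1; rewrite (ak_out h0 _).1 ?mulr0//.
  by apply/negP => n2; apply: n1; rewrite in_itv/= /L; lra.
have := ae_nat f0; apply: filterS => x hx.
have [m hm] := Rnat_bound `|x|.
by apply: (hx m); rewrite /= in_itv/= -ler_norml.
Qed.

End TestFunctions.

#[export] Hint Resolve measurable_halfplane measurable_box measurable_Hbox : core.

Section H1data.
Context {R : realType}.
Local Notation R2 := (measurableTypeR R * measurableTypeR R)%type.
Local Notation mu1 := (@leb1 R).
Local Notation leb2 := (@leb2 R).
Local Notation H := (halfplane : set R2).
Implicit Types (f g psi eta : R * R -> R) (t : R -> R).

Lemma loc2D f g : loc2 f -> loc2 g -> loc2 (fun x => f x + g x).
Proof. by move=> lf lg L; apply: sqintD. Qed.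

Lemma loc2Z (c : R) f : loc2 f -> loc2 (fun x => c * f x).
Proof. by move=> lf L; apply: sqintZ. Qed.

Lemma loc2_cM g f : continuous g -> loc2 f -> loc2 (fun x => g x * f x).
Proof.
move=> cg lf L; have [M M0 hM] := box_bounded L cg.
apply: (@sqint_bM _ _ _ leb2 (H `&` box L) M g f) => //.
  by apply: measurable_funTS; exact: continuous_measurable_fun2.
by move=> x [_ /hM].
Qed.

Lemma eq_loc2 f g : {in H, f =1 g} -> loc2 f -> loc2 g.
Proof.
by move=> fg lf L; apply: eq_sqint (lf L) => // x /set_mem[Hx _]; apply: fg; rewrite inE.
Qed.

Lemma loc1D t u : loc1 t -> loc1 u -> loc1 (fun x => t x + u x).
Proof. by move=> lf lg L; apply: sqintD. Qed.

Lemma loc1Z (c : R) t : loc1 t -> loc1 (fun x => c * t x).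
Proof. by move=> lf L; apply: sqintZ. Qed.

Lemma segment_bounded (g : R -> R) (a b : R) : continuous g ->
  exists M : R, forall s, a <= s <= b -> `|g s| <= M.
Proof.
move=> cg; have [ab|ba] := leP a b; last by exists 0 => s sab; exfalso; lra.
have cc : {within `[a, b], continuous (fun s => `|g s|)}.
  by apply: continuous_subspaceT => x; apply: cvg_norm; exact: cg.
have [c _ hc] := EVT_max ab cc.
by exists `|g c| => s sab; apply: hc; rewrite in_itv.
Qed.

Lemma loc1_cM (g : R -> R) t : continuous g -> loc1 t -> loc1 (fun x => g x * t x).
Proof.
move=> cg lf L; have [M hM] := segment_bounded (- L) L cg.
apply: (@sqint_bM _ _ _ mu1 `[- L, L] M g t) => //.
  by apply: measurable_funTS; exact: continuous_measurable_fun.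
Qed.

Lemma cont_loc1 t : continuous t -> loc1 t.
Proof.
move=> ct L; split; first by apply: measurable_funTS; exact: continuous_measurable_fun.
apply: continuous_segment_integrable => x; by apply: cvgM; exact: ct.
Qed.

(* Weak derivatives tested against [C^1] functions carried by explicit partial
   derivatives.  [wk2] includes the boundary term, so the single relation encodes
   both the weak derivative and the trace. *)
Definition wk1 f p1 := forall eta eta1 eta2 (L c : R), C1g eta eta1 eta2 -> vanish L eta ->
  0 < c -> (forall x, x.2 < c -> eta x = 0) ->
  \int[leb2]_(x in H) (f x * eta1 x) = - \int[leb2]_(x in H) (p1 x * eta x).

Definition wk2 f p2 t := forall eta eta1 eta2 (L : R), C1g eta eta1 eta2 -> vanish L eta ->
  \int[leb2]_(x in H) (f x * eta2 x + p2 x * eta x) = - \int[mu1]_s (t s * eta (s, 0)).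

(** The weak derivatives and the trace are arguments rather than choices, so sums, products and
    limits are computed without appealing to [weak_partial] or [trace]. These data are tied to the
    chosen ones by [H1d_H1loc] and [H1d_trace]. *)
Record H1d f p1 p2 t : Prop := MkH1d {
  H1d_f : loc2 f; H1d_1 : loc2 p1; H1d_2 : loc2 p2; H1d_t : loc1 t;
  H1d_wk1 : wk1 f p1; H1d_wk2 : wk2 f p2 t }.

Lemma Rintegral_split2 f g eta eta' (L : R) : loc2 f -> loc2 g ->
  continuous eta -> continuous eta' -> vanish L eta -> vanish L eta' ->
  \int[leb2]_(x in H) (f x * eta x + g x * eta' x) =
  \int[leb2]_(x in H) (f x * eta x) + \int[leb2]_(x in H) (g x * eta' x).
Proof. by move=> lf lg c c' v v'; apply: RintegralD => //; [exact: loc2_int v|exact: loc2_int v']. Qed.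

Lemma H1d_C1g f f1 f2 : C1g f f1 f2 -> H1d f f1 f2 (fun s => f (s, 0)).
Proof.
move=> hf; have cf := C1g_cont hf; have [_ c1 c2] := hf; split.
- exact: cont_loc2.
- exact: cont_loc2.
- exact: cont_loc2.
- by apply: cont_loc1; exact: continuous_slice1.
- move=> eta eta1 eta2 L c he v _ _; have [v1 v2] := vanish_d he v.
  have ce := C1g_cont he; have [_ ce1 ce2] := he.
  have vL : vanish `|L| (fun x => f x * eta x).
    by move=> x nx; rewrite (vanishS (ler_norm L) v)// mulr0.
  have := integral_halfplane_d1 (C1gM hf he) (normr_ge0 L) vL.
  under eq_Rintegral do rewrite [X in _ + X]mulrC.
  rewrite (Rintegral_split2 (L := L))//; [|exact: cont_loc2..].
  by move/eqP; rewrite addr_eq0 => /eqP.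
- move=> eta eta1 eta2 L he v; have [v1 v2] := vanish_d he v.
  have vL : vanish `|L| (fun x => f x * eta x).
    by move=> x nx; rewrite (vanishS (ler_norm L) v)// mulr0.
  rewrite -(integral_halfplane_d2 (C1gM hf he) (normr_ge0 L) vL).
  by apply: eq_Rintegral => x _; rewrite [X in _ + X]mulrC.
Qed.

Lemma eq_H1d f p1 p2 t f' p1' p2' t' : {in H, f =1 f'} -> {in H, p1 =1 p1'} ->
  {in H, p2 =1 p2'} -> t =1 t' -> H1d f p1 p2 t -> H1d f' p1' p2' t'.
Proof.
move=> ef e1 e2 et [lf l1 l2 lt w1 w2]; have {}et := funext et; subst t'; split => //.
- exact: eq_loc2 lf.
- exact: eq_loc2 l1.
- exact: eq_loc2 l2.
- move=> eta eta1 eta2 L c h v c0 vc; have := w1 _ _ _ _ _ h v c0 vc.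
  have -> : \int[leb2]_(x in H) (f x * eta1 x) = \int[leb2]_(x in H) (f' x * eta1 x).
    by apply: eq_Rintegral => x xH; rewrite ef.
  by move=> ->; congr (- _); apply: eq_Rintegral => x xH; rewrite e1.
- move=> eta eta1 eta2 L h v; rewrite -(w2 _ _ _ _ h v).
  by apply: eq_Rintegral => x xH; rewrite ef// e2.
Qed.

Lemma H1dD (c : R) f p1 p2 t g q1 q2 u : H1d f p1 p2 t -> H1d g q1 q2 u ->
  H1d (fun x => f x + c * g x) (fun x => p1 x + c * q1 x) (fun x => p2 x + c * q2 x)
    (fun s => t s + c * u s).
Proof.
move=> [lf l1 l2 lt w1 w2] [lf' l1' l2' lt' w1' w2'].
have lZ := @loc2Z c; split; try by apply: loc2D => //; exact: lZ.
- by apply: loc1D => //; exact: loc1Z.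
- move=> eta eta1 eta2 L b h v b0 vb; have [v1 v2] := vanish_d h v.
  have ce := C1g_cont h; have [_ ce1 ce2] := h.
  have I (k : R * R -> R) e : loc2 k -> continuous e -> vanish L e ->
      \int[leb2]_(x in H) (c * (k x * e x)) = c * \int[leb2]_(x in H) (k x * e x).
    by move=> lk c' v'; apply: RintegralZl => //; apply: loc2_int v'.
  have S (k k' : R * R -> R) e : loc2 k -> loc2 k' -> continuous e -> vanish L e ->
      \int[leb2]_(x in H) ((k x + c * k' x) * e x) =
      \int[leb2]_(x in H) (k x * e x) + c * \int[leb2]_(x in H) (k' x * e x).
    move=> lk lk' c' v'; rewrite -I// -RintegralD//.
    - by apply: eq_Rintegral => x _; ring.
    - exact: loc2_int v'.
    - by apply: integrableZr' => //; exact: loc2_int v'.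
  by rewrite !S// (w1 _ _ _ _ _ h v b0 vb) (w1' _ _ _ _ _ h v b0 vb); ring.
- move=> eta eta1 eta2 L h v; have [v1 v2] := vanish_d h v.
  have ce := C1g_cont h; have [_ ce1 ce2] := h.
  have I1 := loc2_int lf ce2 v2; have I2 := loc2_int l2 ce v.
  have J1 := loc2_int lf' ce2 v2; have J2 := loc2_int l2' ce v.
  have K1 := loc1_int lt (continuous_slice1 (b := 0) ce) (fun s => vanish_line v (s := s)).
  have K2 := loc1_int lt' (continuous_slice1 (b := 0) ce) (fun s => vanish_line v (s := s)).
  have -> : \int[mu1]_s ((t s + c * u s) * eta (s, 0)) =
     \int[mu1]_s (t s * eta (s, 0)) + c * \int[mu1]_s (u s * eta (s, 0)).
    rewrite -RintegralZl// -RintegralD//; last exact: integrableZr'.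
    by apply: eq_Rintegral => x _; ring.
  rewrite opprD -mulrN -(w2 _ _ _ _ h v) -(w2' _ _ _ _ h v).
  have Z : leb2.-integrable H (EFin \o (fun x => g x * eta2 x + q2 x * eta x)).
    exact: integrableDr.
  rewrite -RintegralZl// -RintegralD//.
  - by apply: eq_Rintegral => x _; ring.
  - exact: integrableDr.
  - exact: integrableZr'.
Qed.

(** Leibniz rule, obtained by testing [f] against [chi * eta]. *)
Lemma H1d_mul chi chi1 chi2 f p1 p2 t : C1g chi chi1 chi2 -> H1d f p1 p2 t ->
  H1d (fun x => chi x * f x) (fun x => chi x * p1 x + chi1 x * f x)
    (fun x => chi x * p2 x + chi2 x * f x) (fun s => chi (s, 0) * t s).
Proof.
move=> hc [lf l1 l2 lt w1 w2]; have cc := C1g_cont hc; have [_ cc1 cc2] := hc; split.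
- exact: loc2_cM.
- by apply: loc2D; exact: loc2_cM.
- by apply: loc2D; exact: loc2_cM.
- by apply: loc1_cM => //; exact: continuous_slice1.
- move=> eta eta1 eta2 L b h v b0 vb; have [v1 v2] := vanish_d h v.
  have ce := C1g_cont h; have [_ ce1 ce2] := h.
  have vce : vanish L (fun x => chi x * eta x) by move=> x nx; rewrite v ?mulr0.
  have cce : continuous (fun x => chi x * eta x) by move=> x; apply: cvgM; [exact: cc|exact: ce].
  have vb' x : x.2 < b -> chi x * eta x = 0 by move=> /vb ->; rewrite mulr0.
  have W := w1 _ _ _ _ b (C1gM hc h) vce b0 vb'.
  have M (k k' : R * R -> R) : continuous k -> continuous k' -> continuous (fun x => k x * k' x).
    by move=> hk hk' x; apply: cvgM; [exact: hk|exact: hk'].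
  have V (k k' : R * R -> R) : vanish L k' -> vanish L (fun x => k x * k' x).
    by move=> vk x nx; rewrite vk ?mulr0.
  have I1 := loc2_int lf (M _ _ cc ce1) (V _ _ v1).
  have I2 := loc2_int lf (M _ _ cc1 ce) (V _ _ v).
  have I3 := loc2_int l1 (M _ _ cc ce) (V _ _ v).
  have -> : \int[leb2]_(x in H) ((chi x * p1 x + chi1 x * f x) * eta x) =
     \int[leb2]_(x in H) (p1 x * (chi x * eta x)) + \int[leb2]_(x in H) (f x * (chi1 x * eta x)).
    by rewrite -RintegralD//; apply: eq_Rintegral => x _; ring.
  rewrite opprD -W -RintegralB//; last first.
    by have := integrableDr (measurable_halfplane) I1 I2; congr (_.-integrable _ _); apply/funext => x /=; congr EFin; ring.
  by apply: eq_Rintegral => x _; ring.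
- move=> eta eta1 eta2 L h v; have [v1 v2] := vanish_d h v.
  have vce : vanish L (fun x => chi x * eta x) by move=> x nx; rewrite v ?mulr0.
  have -> : \int[mu1]_s (chi (s, 0) * t s * eta (s, 0)) =
      \int[mu1]_s (t s * (chi (s, 0) * eta (s, 0))).
    by apply: eq_Rintegral => x _; ring.
  rewrite -(w2 _ _ _ _ (C1gM hc h) vce).
  by apply: eq_Rintegral => x _; ring.
Qed.

End H1data.

(** * Density of C^1 functions, traces included *)

Section Density.
Context {R : realType}.
Local Notation R2 := (measurableTypeR R * measurableTypeR R)%type.
Local Notation mu1 := (@leb1 R).
Local Notation leb2 := (@leb2 R).
Local Notation H := (halfplane : set R2).
Implicit Types (f g psi eta : R * R -> R) (t : R -> R).

(** Differentiating the kernel in [x] is minus differentiating it in [y]. Because the kernel looks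
    only upwards, [k2 h x] is a test function even for [x] on the boundary line, and the weak
    derivative can be moved back onto [f]. *)
Lemma mollified_partial1 f p1 (h : R) x : 0 < h -> wk1 f p1 -> 0 <= x.2 ->
  - (\int[leb2]_y ((f \_ H) y * (dak h (y.1 - x.1) * ak h (y.2 - x.2)))) =
  Kop leb2 (k2 h) (p1 \_ H) x.
Proof.
move=> h0 w x0; rewrite Kop_patch Rintegral_patchM setTI.
rewrite (w _ _ _ _ _ (C1g_k2 x h0) (k2_vanish h0 (in_box x)) h0) ?opprK//.
by move=> y yh; apply: k2_below => //; lra.
Qed.

Lemma mollified_partial2 f p2 t (h : R) x : 0 < h -> loc2 f -> loc2 p2 -> wk2 f p2 t -> 0 <= x.2 ->
  - (\int[leb2]_y ((f \_ H) y * (ak h (y.1 - x.1) * dak h (y.2 - x.2)))) =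
  Kop leb2 (k2 h) (p2 \_ H) x.
Proof.
move=> h0 lf lp w x0; rewrite Kop_patch Rintegral_patchM setTI.
have hk := C1g_k2 x h0; have v := k2_vanish h0 (in_box x).
have [v1 v2] := vanish_d hk v; have ck := C1g_cont hk; have [_ _ ck2] := hk.
have := w _ _ _ _ hk v; rewrite (Rintegral_split2 lf lp ck2 ck v2 v).
rewrite [X in _ = - X]Rintegral0_eq ?oppr0; last first.
  by move=> s _; rewrite k2_below ?mulr0//=; lra.
by move=> /eqP; rewrite addrC addr_eq0 => /eqP <-.
Qed.

(** Green's formula with the test function [bdtest h s]: its boundary value is the mollifier on the
    line and its vertical derivative in the half-plane is [- k2 h (s, 0)]. The remaining term, with
    [p2], is the operator [k3]. *)
Lemma mollified_trace f p2 t (h s : R) : 0 < h -> loc2 f -> loc2 p2 -> wk2 f p2 t ->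
  Kop leb2 (k2 h) (f \_ H) (s, 0) = Kop leb2 (k3 h) (p2 \_ H) s + Kop mu1 (k1 h) t s.
Proof.
move=> h0 lf lp w; rewrite Kop_patch.
have hk := C1g_bdtest s h0; have v := bdtest_vanish (s := s) h0.
have [v1 v2] := vanish_d hk v; have ck := C1g_cont hk; have [_ _ ck2] := hk.
have := w _ _ _ _ hk v; rewrite (Rintegral_split2 lf lp ck2 ck v2 v).
have -> : \int[leb2]_(x in H) (f x * (ak h (x.1 - s) * (ak h (x.2 + 11 * h) - ak h x.2))) =
    - \int[leb2]_(y in H) (f y * k2 h (s, 0) y).
  rewrite -[RHS]mulN1r -RintegralZl//; last first.
    by apply: loc2_int lf (C1g_cont (C1g_k2 _ h0)) (k2_vanish h0 (in_box _)).
  apply: eq_Rintegral => x /set_mem Hx; rewrite /k2/= subr0.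
  by have [/(_ (ltW Hx)) -> _ _ _] := tk_props x.2 h0; ring.
have -> : \int[leb2]_(x in H) (p2 x * bdtest h s x) = \int[leb2]_(y in H) (p2 y * k3 h s y).
  apply: eq_Rintegral => x /set_mem Hx; rewrite /k3 /bdtest indicE mem_set ?mulr1//=.
  by rewrite in_itv/= andbT.
have -> : Kop mu1 (k1 h) t s = \int[mu1]_r (t r * bdtest h s (r, 0)).
  by rewrite /Kop ipE; apply: eq_Rintegral => r _; rewrite bdtest_line.
have -> : Kop leb2 (k3 h) (p2 \_ H) s = \int[leb2]_(y in H) (p2 y * k3 h s y).
  by rewrite /Kop ipE Rintegral_patchM setTI.
set A := Rintegral _ _ _; set B := Rintegral _ _ _; set C := Rintegral _ _ _ => E.
lra.
Qed.

(** The approximation is the one-sided mollification of the extension of [f] by zero. On the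
    half-plane its derivatives are the mollified weak derivatives; on the line [mollified_trace]
    splits the error into the mollification error of [t] and a [k3] term. The support grows by at
    most [4 * h], and [h <= 1]. *)
Lemma density (L : R) f p1 p2 t : H1d f p1 p2 t ->
  (forall x, H x -> ~ box L x -> [/\ f x = 0, p1 x = 0 & p2 x = 0]) ->
  (forall s, ~~ (- L <= s <= L) -> t s = 0) ->
  forall e : R, 0 < e -> exists psi psi1 psi2,
   [/\ C1g psi psi1 psi2, vanish (L + 4) psi &
    [/\ ip leb2 H (fun x => psi x - f x) (fun x => psi x - f x) < e,
      ip leb2 H (fun x => psi1 x - p1 x) (fun x => psi1 x - p1 x) < e,
      ip leb2 H (fun x => psi2 x - p2 x) (fun x => psi2 x - p2 x) < e &
      ip mu1 setT (fun s => psi (s, 0) - t s) (fun s => psi (s, 0) - t s) < e]].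
Proof.
move=> [lf l1 l2 lt w1 w2] v vt e e0.
have sH g : loc2 g -> (forall x, H x -> ~ box L x -> g x = 0) -> sqint leb2 setT (g \_ H).
  by move=> lg vg; apply: sqint_patch => //; rewrite setTI; exact: loc2_vanish vg.
have vf x : H x -> ~ box L x -> f x = 0 by move=> Hx /(v x Hx)[].
have v1 x : H x -> ~ box L x -> p1 x = 0 by move=> Hx /(v x Hx)[].
have v2 x : H x -> ~ box L x -> p2 x = 0 by move=> Hx /(v x Hx)[].
have Sf := sH _ lf vf; have S1 := sH _ l1 v1; have S2 := sH _ l2 v2.
have St : sqint mu1 setT t.
  apply: (@eq_sqint _ _ _ mu1 setT (t \_ `[- L, L]) t) => //; last exact: loc1_patch.
  move=> s _; rewrite /patch; case: ifPn => // ns; rewrite vt//.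
  by move: ns; rewrite notin_setE/= in_itv/= => /negP.
have e4 : 0 < e / 4 by lra.
have [_ /(_ _ e0)[Nf hf]] := approx2 Sf; have [_ /(_ _ e0)[N1 h1]] := approx2 S1.
have [_ /(_ _ e0)[N2 h2]] := approx2 S2; have [_ /(_ _ e4)[Nt ht]] := approx1 St.
pose P := ip leb2 setT (p2 \_ H) (p2 \_ H).
have P0 : 0 <= P by exact: ip_ge0.
have P1 : 0 < P + 1 by lra.
(* With [h] below this value the Schur bound [4 * h * P] of the [k3] term is less than [e / 4]. *)
have e16 : 0 < e / (16 * (P + 1)) by rewrite divr_gt0// mulr_gt0.
have [N3 h3] := hn_lt e16.
pose n := maxn Nf (maxn N1 (maxn N2 (maxn Nt N3))).
have nf : (Nf <= n)%N by rewrite /n !leq_max leqnn.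
have n1 : (N1 <= n)%N by rewrite /n !leq_max leqnn !orbT.
have n2 : (N2 <= n)%N by rewrite /n !leq_max leqnn !orbT.
have nt : (Nt <= n)%N by rewrite /n !leq_max leqnn !orbT.
have n3 : (N3 <= n)%N by rewrite /n !leq_max leqnn !orbT.
pose h : R := hn n; have h0 : 0 < h := hn_gt0 n.
have hle : h <= 1 by rewrite /h /hn invf_le1// ler1n.
have vfb y : ~ box L y -> (f \_ H) y = 0.
  by move=> nb; rewrite /patch; case: ifPn => // /set_mem Hy; exact: vf.
have If : leb2.-integrable setT (EFin \o (f \_ H)).
  have Sb : sqint leb2 setT (\1_(box L : set R2)) by apply: sqint_indic => //; exact: box_lty.
  have := @sqint_int _ _ _ leb2 setT _ _ measurableT Sf Sb; congr (_.-integrable _ _).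
  apply/funext => y /=; rewrite indicE; have [b|b] := pselect (box L y).
    by rewrite mem_set// mulr1.
  by rewrite vfb ?mul0r.
have C := mollifier_C1g h0 If.
exists (Kop leb2 (k2 h) (f \_ H)), (fun x => - \int[leb2]_y ((f \_ H) y * (dak h (y.1 - x.1) * ak h (y.2 - x.2)))),
  (fun x => - \int[leb2]_y ((f \_ H) y * (ak h (y.1 - x.1) * dak h (y.2 - x.2)))).
have restr g k : sqint leb2 setT (g \_ H) -> (forall x : R2, H x -> k x = Kop leb2 (k2 h) (g \_ H) x) ->
    ip leb2 H (fun x => k x - g x) (fun x => k x - g x) <=
    ip leb2 setT (fun x => Kop leb2 (k2 h) (g \_ H) x - (g \_ H) x)
       (fun x => Kop leb2 (k2 h) (g \_ H) x - (g \_ H) x).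
  move=> Sg kE; have SK : sqint leb2 setT (fun x => Kop leb2 (k2 h) (g \_ H) x - (g \_ H) x).
    by apply: sqintB => //; apply: (Kop_sqint (k2_bound h0)).
  apply: le_trans (ip_subset measurableT (@measurable_halfplane R) (@subsetT _ _) SK).
  rewrite le_eqVlt; apply/orP; left; apply/eqP.
  have Q : {in H, (fun x => k x - g x) =1 (fun x => Kop leb2 (k2 h) (g \_ H) x - (g \_ H) x)}.
    by move=> x xH; rewrite kE; [rewrite /patch xH|exact/set_mem].
  exact: eq_ip.
split => //.
  move=> x nx; rewrite /Kop ipE; apply: Rintegral0_eq => y _.
  have [b|b] := pselect (box L y); last by rewrite vfb ?mul0r.
  rewrite k2_supp ?mulr0// => hy; apply: nx; move: b hy.
  by rewrite /box/= !ler_norml => -[a b] [c d]; clear -a b c d hle h0; lra.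
split.
- by apply: le_lt_trans (restr f _ Sf _) (hf n nf).
- apply: le_lt_trans (restr p1 _ S1 _) (h1 n n1) => x Hx.
  by apply: mollified_partial1 => //; exact: ltW.
- apply: le_lt_trans (restr p2 _ S2 _) (h2 n n2) => x Hx.
  by apply: (@mollified_partial2 _ _ t) => //; exact: ltW.
- have Sk3 := Kop_sqint (k3_bound h0) S2.
  have Sk1 : sqint mu1 setT (fun s => Kop mu1 (k1 h) t s - t s).
    by apply: sqintB => //; apply: (Kop_sqint (k1_bound h0)).
  have -> : (fun s => Kop leb2 (k2 h) (f \_ H) (s, 0) - t s) =
      (fun s => Kop leb2 (k3 h) (p2 \_ H) s + (Kop mu1 (k1 h) t s - t s)).
    by apply/funext => s; rewrite (mollified_trace s h0 lf l2 w2) addrA.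
  apply: le_lt_trans (ipD_le measurableT Sk3 Sk1) _.
  have A := ht n nt; have B := schur (k3_bound h0) S2; rewrite mulr1 -/P in B.
  have B2 : 4 * h * P <= 4 * h * (P + 1) by rewrite ler_wpM2l ?lerDl// mulr_ge0// ltW.
  have := h3 n n3; rewrite -/h ltr_pdivlMr ?mulr_gt0// => D.
  have {B2}B := le_trans B B2; have {D}D : 4 * h * (P + 1) < e / 4 by clear -D; lra.
  rewrite [ltRHS](_ : e = 2 * (e / 4) + 2 * (e / 4)); last by field.
  by apply: ltrD; rewrite ltr_pM2l//; exact: le_lt_trans B D.
Qed.

End Density.

Lemma ae_imp d (T : measurableType d) (R : realType) (mu : {measure set T -> \bar R}) (P Q : T -> Prop) :
  {ae mu, forall x, P x} -> (forall x, P x -> Q x) -> {ae mu, forall x, Q x}.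
Proof. by move=> aeP PQ; apply: (@filterS _ _ (ae_filter_ringOfSetsType mu) _ _ PQ). Qed.

Lemma ae_imp2 d (T : measurableType d) (R : realType) (mu : {measure set T -> \bar R}) (P Q S : T -> Prop) :
  {ae mu, forall x, P x} -> {ae mu, forall x, Q x} -> (forall x, P x -> Q x -> S x) ->
  {ae mu, forall x, S x}.
Proof.
by move=> aeP aeQ PQ; apply: (@filterS2 _ _ (ae_filter_ringOfSetsType mu) _ _ _ PQ).
Qed.

(** * Translation between explicit data and the definitions of the statement *)

Section Interface.
Context {R : realType}.
Local Notation R2 := (measurableTypeR R * measurableTypeR R)%type.
Local Notation mu1 := (@leb1 R).
Local Notation leb2 := (@leb2 R).
Local Notation H := (halfplane : set R2).
Implicit Types (f g psi eta : R * R -> R) (t : R -> R).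

Lemma supp_closed psi : closed (supp psi).
Proof. exact: closed_closure. Qed.

Lemma supp0 psi x : ~ supp psi x -> psi x = 0.
Proof.
move=> nx; apply/eqP; apply: contra_notT nx => h; exact: subset_closure.
Qed.

Lemma C1cP psi : C1c psi <-> exists psi1 psi2 L, C1g psi psi1 psi2 /\ vanish L psi.
Proof.
split=> [[h /compact_sub_box[L _ KL]]|[psi1 [psi2 [L [h v]]]]].
  exists ('D_e1 psi), ('D_e2 psi), L; split; first exact: C1_C1g.
  by move=> x nx; apply: supp0 => /KL.
split; first exact: C1g_C1 h.
apply: (subclosed_compact (supp_closed (psi := psi)) (@compact_box R L)).
rewrite [X in _ `<=` X](closure_id _).1; last exact: closed_box.
apply: closureS => x /= px; apply/not_notP => nx.
by rewrite v ?eqxx in px.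
Qed.

Lemma compact_below (K : set (R * R)) : compact K -> K `<=` halfplane ->
  exists2 c : R, 0 < c & forall x, x.2 < c -> ~ K x.
Proof.
move=> cK KH.
have cc : compact (snd @` K).
  by apply: continuous_compact => //; apply: continuous_subspaceT => x; exact: cvg_snd.
have /closed_openC oc : closed (snd @` K) by apply: compact_closed => //; exact: Rhausdorff.
have c0 : (~` (snd @` K)) 0 by move=> [x /KH]; rewrite /halfplane/= => + E; rewrite E ltxx.
have /nbhs_ballP[c /= c1 hc] := open_nbhs_nbhs (conj oc c0).
exists c => // x xc Kx; have := KH _ Kx; rewrite /halfplane/= => x0.
apply: (hc x.2); last by exists x.
by rewrite /ball/= sub0r normrN gtr0_norm.
Qed.

Lemma L2locP f : L2loc_halfplane f <-> loc2 f.
Proof.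
split=> [[mf hf] L|lf].
  apply/sqintP; split; first by apply: measurable_funS mf => // x [].
  by rewrite setIC; exact: (hf _ (@compact_box R L)).
split.
  have -> : (halfplane : set R2) = \bigcup_n (H `&` box n%:R).
    apply/seteqP; split=> [x Hx|x [n _ []]//].
    have [m hm] := Rnat_bound (`|x.1| + `|x.2|); exists m => //.
    by split=> //; apply: sub_box (in_box x).
  by apply/measurable_fun_bigcup => // n; have [] := lf n%:R.
move=> K cK; have [L _ KL] := compact_sub_box cK.
have mK := compact_measurable cK.
have /sqintP[mf] := lf L; apply: le_lt_trans.
apply: ge0_subset_integral => //.
- exact: measurableI.
- by apply/measurable_EFinP; exact: measurable_funX.
- by move=> x _; rewrite lee_fin sqr_ge0.
- by move=> x [/KL ? ?].
Qed.

Lemma L2loc1P t : L2loc_line t <-> loc1 t.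
Proof.
split=> [[mt ht] L|lt].
  apply/sqintP; split; first exact: measurable_funTS.
  exact: (ht _ (@segment_compact R (- L) L)).
split.
  have -> : (setT : set (measurableTypeR R)) = \bigcup_n (`[- n%:R, n%:R]%classic : set (measurableTypeR R)).
    apply/seteqP; split=> // x _; have [m hm] := Rnat_bound `|x|.
    by exists m => //=; rewrite in_itv/= -ler_norml.
  by apply/measurable_fun_bigcup => // n; have [] := lt n%:R.
move=> K cK; have := compact_bounded cK => -[M [_ hM]].
pose L := `|M| + 1; have ML : M < L by rewrite /L (le_lt_trans (ler_norm M))// ltrDl.
have KL : K `<=` `[- L, L] by move=> x Kx /=; rewrite in_itv/= -ler_norml; exact: hM Kx.
have /sqintP[mf] := lt L; apply: le_lt_trans.
apply: ge0_subset_integral => //.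
- by apply: closed_measurable; apply: compact_closed => //; exact: Rhausdorff.
- by apply/measurable_EFinP; exact: measurable_funX.
- by move=> x _; rewrite lee_fin sqr_ge0.
Qed.

(* [i] selects the direction: [e2] when true, [e1] when false. *)
Definition wki (i : bool) f p := forall eta eta1 eta2 (L c : R), C1g eta eta1 eta2 -> vanish L eta ->
  0 < c -> (forall x, x.2 < c -> eta x = 0) ->
  \int[leb2]_(x in H) (f x * (if i then eta2 x else eta1 x)) = - \int[leb2]_(x in H) (p x * eta x).

Lemma weak_partialP (i : bool) f p :
  is_weak_partial (if i then e2 else e1) f p <-> loc2 p /\ wki i f p.
Proof.
split=> [[/L2locP lp h]|[/L2locP lp h]]; split => //.
  move=> eta eta1 eta2 L c he v c0 vc.
  have cc : C1c eta by apply/C1cP; exists eta1, eta2, L.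
  have sH : supp eta `<=` halfplane.
    have cl : closed [set x : R * R | c <= x.2].
      have -> : [set x : R * R | c <= x.2] = snd @^-1` [set r : R | c <= r] by [].
      by apply: closed_comp => [x _|]; [exact: cvg_snd|exact: closed_ge].
    move=> x; have : supp eta `<=` [set x : R * R | c <= x.2].
      rewrite [X in _ `<=` X](closure_id _).1//.
      apply: closureS => y /= py; rewrite leNgt; apply/negP => /vc y0.
      by rewrite y0 eqxx in py.
    by move=> /[apply] /= cx; rewrite /halfplane/=; exact: lt_le_trans cx.
  have := h eta cc sH; case: (i) => <-; apply: eq_Rintegral => x _.
    by rewrite (C1g_derive2 _ he).
  by rewrite (C1g_derive1 _ he).
move=> eta /C1cP[eta1 [eta2 [L [he v]]]] sH.
have cK : compact (supp eta) by have [] : C1c eta by apply/C1cP; exists eta1, eta2, L.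
have [c c0 hc] := compact_below cK sH.
have := h eta eta1 eta2 L c he v c0 (fun x xc => supp0 (hc x xc)) => <-.
case: (i); apply: eq_Rintegral => x _.
  by rewrite (C1g_derive2 _ he).
by rewrite (C1g_derive1 _ he).
Qed.

Lemma wk2_wki f p2 t : loc2 f -> loc2 p2 -> wk2 f p2 t -> wki true f p2.
Proof.
move=> lf lp w eta eta1 eta2 L c he v c0 vc; have [v1 v2] := vanish_d he v.
have ce := C1g_cont he; have [_ _ ce2] := he.
have := w _ _ _ _ he v; rewrite (Rintegral_split2 lf lp ce2 ce v2 v).
rewrite [X in _ = - X]Rintegral0_eq ?oppr0; last by move=> s _; rewrite vc ?mulr0.
by move/eqP; rewrite addr_eq0 => /eqP.
Qed.

Lemma wki_unique i f p q : loc2 p -> loc2 q -> wki i f p -> wki i f q ->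
  {ae leb2, forall x, H x -> p x = q x}.
Proof.
move=> lp lq wp wq.
have : {ae leb2, forall x, H x -> p x + (-1) * q x = 0}.
  apply: fundamental2; first by apply: loc2D => //; exact: loc2Z.
  move=> eta eta1 eta2 L c he v c0 vc; have ce := C1g_cont he.
  have -> : \int[leb2]_(x in H) ((p x + -1 * q x) * eta x) =
      \int[leb2]_(x in H) (p x * eta x) - \int[leb2]_(x in H) (q x * eta x).
    rewrite -RintegralB//; [|exact: loc2_int v|exact: loc2_int v].
    by apply: eq_Rintegral => x _; ring.
  have := wp _ _ _ _ _ he v c0 vc; rewrite (wq _ _ _ _ _ he v c0 vc).
  by move/oppr_inj ->; rewrite subrr.
by apply: filterS => x h /h; lra.
Qed.

Lemma weak_partial_spec v f g : is_weak_partial v f g -> is_weak_partial v f (weak_partial v f).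
Proof. exact: (@xgetI _ (cst 0) [set g | is_weak_partial v f g]). Qed.

Lemma H1d_H1loc f p1 p2 t : H1d f p1 p2 t ->
  [/\ H1loc f, loc2 (weak_partial e1 f), loc2 (weak_partial e2 f),
    {ae leb2, forall x, H x -> weak_partial e1 f x = p1 x} &
    {ae leb2, forall x, H x -> weak_partial e2 f x = p2 x}].
Proof.
move=> [lf l1 l2 lt w1 w2].
have W1 : is_weak_partial e1 f p1 by apply/(weak_partialP false).
have W2 : is_weak_partial e2 f p2 by apply/(weak_partialP true); split=> //; exact: wk2_wki w2.
have [V1 V1'] := (weak_partialP false f _).1 (weak_partial_spec W1).
have [V2 V2'] := (weak_partialP true f _).1 (weak_partial_spec W2).
move: (weak_partial _ _) (weak_partial _ _) V1 V1' V2 V2' => g1 g2 V1 V1' V2 V2'.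
split => //.
- by split; [exact/L2locP|exists p1|exists p2].
- exact: (wki_unique V1 l1 V1').
- by apply: (wki_unique V2 l2 V2'); exact: wk2_wki w2.
Qed.

Lemma ae_Rintegral d (T : measurableType d) (mu : {measure set T -> \bar R}) (D : set T) (f g : T -> R) :
  measurable D -> measurable_fun D f -> measurable_fun D g ->
  {ae mu, forall x, D x -> f x = g x} ->
  (\int[mu]_(x in D) (f x)%:E = \int[mu]_(x in D) (g x)%:E)%E.
Proof.
move=> mD mf mg h; apply: ae_eq_integral => //; [exact/measurable_EFinP|exact/measurable_EFinP|].
by apply: filterS h => x h Dx; rewrite h.
Qed.

Lemma loc2_measurable f : loc2 f -> measurable_fun H f.
Proof. by move/L2locP => []. Qed.

Lemma loc1_measurable t : loc1 t -> measurable_fun (setT : set (measurableTypeR R)) t.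
Proof. by move/L2loc1P => []. Qed.

(** Two traces satisfy Green's formula with the same left-hand side, since the chosen weak
    derivative agrees almost everywhere with [p2]; [fundamental1] then identifies them. *)
Lemma is_traceP f p1 p2 t u : H1d f p1 p2 t ->
  is_trace f u <-> loc1 u /\ {ae mu1, forall s, u s = t s}.
Proof.
move=> hf; have [_ _ lw _ ae2] := H1d_H1loc hf; have [lf l1 l2 lt w1 w2] := hf.
have E eta eta1 eta2 L : C1g eta eta1 eta2 -> vanish L eta ->
   \int[leb2]_(x in H) (f x * 'D_e2 eta x + weak_partial e2 f x * eta x) =
   - \int[mu1]_s (t s * eta (s, 0)).
  move=> he v; rewrite -(w2 _ _ _ _ he v); congr fine.
  have ce := C1g_cont he; have [_ _ ce2] := he.
  have m (k : R * R -> R) : continuous k -> measurable_fun H k.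
    by move=> ck; apply: measurable_funTS; exact: continuous_measurable_fun2.
  under eq_integral do rewrite (C1g_derive2 _ he).
  apply: ae_Rintegral => //.
  - by apply: measurable_funD; apply: measurable_funM; [exact: loc2_measurable|exact: m|exact: loc2_measurable|exact: m].
  - by apply: measurable_funD; apply: measurable_funM; [exact: loc2_measurable|exact: m|exact: loc2_measurable|exact: m].
  - by apply: filterS ae2 => x h Hx; rewrite h.
split=> [[/L2loc1P lu hu]|[lu aeu]].
  split => //.
  have : {ae mu1, forall s, u s + (-1) * t s = 0}.
    apply: fundamental1; first by apply: loc1D => //; exact: loc1Z.
    move=> eta eta1 eta2 L he v; have ce := continuous_slice1 (b := 0) (C1g_cont he).
    have vl s : ~~ (- L <= s <= L) -> eta (s, 0) = 0 by exact: vanish_line.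
    have -> : \int[mu1]_s ((u s + -1 * t s) * eta (s, 0)) =
        \int[mu1]_s (u s * eta (s, 0)) - \int[mu1]_s (t s * eta (s, 0)).
      rewrite -RintegralB//; [|exact: loc1_int vl|exact: loc1_int vl].
      by apply: eq_Rintegral => x _; ring.
    have cc : C1c eta by apply/C1cP; exists eta1, eta2, L.
    have := hu eta cc; rewrite (E _ _ _ _ he v) => /oppr_inj.
    by move=> h; apply/eqP; rewrite subr_eq0; apply/eqP/esym.
  by move=> ae0; apply: (ae_imp ae0) => x; rewrite mulN1r => /eqP; rewrite subr_eq0 => /eqP.
split; first exact/L2loc1P.
move=> eta /C1cP[eta1 [eta2 [L [he v]]]].
apply: (etrans (E _ _ _ _ he v)); congr (- _); congr fine.
have ce : measurable_fun (setT : set (measurableTypeR R)) (fun s => eta (s, 0)).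
  by apply: continuous_measurable_fun; apply: continuous_slice1; exact: C1g_cont he.
apply: ae_Rintegral => //.
- by apply: measurable_funM => //; exact: loc1_measurable.
- by apply: measurable_funM => //; exact: loc1_measurable.
- by apply: (ae_imp aeu) => s ->.
Qed.

Lemma H1d_trace f p1 p2 t : H1d f p1 p2 t ->
  loc1 (trace f) /\ {ae mu1, forall s, trace f s = t s}.
Proof.
move=> hf; apply/(is_traceP _ hf); apply: (xgetI (cst 0) (x := t)).
by apply/(is_traceP _ hf); split; [case: hf|exact: aeW].
Qed.

(** The second hypothesis excludes the case where [trace f] is only the default value [cst 0]. *)
Lemma H1loc_H1d f : H1loc f -> is_trace f (trace f) ->
  H1d f (weak_partial e1 f) (weak_partial e2 f) (trace f).
Proof.
move=> [/L2locP lf [g1 hg1] [g2 hg2]] [/L2loc1P lt ht].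
have [V1 V1'] := (weak_partialP false f _).1 (weak_partial_spec hg1).
have [V2 V2'] := (weak_partialP true f _).1 (weak_partial_spec hg2).
move: (weak_partial _ _) (weak_partial _ _) (trace f) V1 V1' V2 V2' lt ht => q1 q2 t V1 V1' V2 V2' lt ht.
split => // eta eta1 eta2 L he v.
have cc : C1c eta by apply/C1cP; exists eta1, eta2, L.
rewrite -(ht _ cc); apply: eq_Rintegral => x _.
by rewrite (C1g_derive2 _ he).
Qed.

End Interface.

(** * Minimality of the profiles *)

Section EnergyVariation.
Context {R : realType}.
Local Notation R2 := (measurableTypeR R * measurableTypeR R)%type.
Local Notation mu1 := (@leb1 R).
Local Notation leb2 := (@leb2 R).
Local Notation H := (halfplane : set R2).
Variables (eps : R) (delta : R * R).
Implicit Types (f g psi eta : R * R -> R) (t : R -> R).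

Definition edens (p1 p2 : R * R -> R) (x : R * R) : R :=
  p1 x ^+ 2 + p2 x ^+ 2 - 2 * (delta.1 * p1 x + delta.2 * p2 x).

Definition line (K : set (R * R)) : set (measurableTypeR R) := [set s | K (s, 0)].

Lemma measurable_sin2 (D : set (measurableTypeR R)) (t : R -> R) : measurable_fun D t ->
  measurable_fun D (fun s => sin (t s) ^+ 2).
Proof.
move=> mt; apply: measurable_funX; apply: (measurableT_comp _ mt).
by apply: continuous_measurable_fun; exact: continuous_sin.
Qed.

Lemma line_measurable K : compact K -> measurable (line K).
Proof.
move=> cK; apply: closed_measurable; rewrite /line.
have -> : [set s : R | K (s, 0)] = (fun s : R => (s, 0) : R * R) @^-1` K by [].
apply: closed_comp => [s _|].
  by apply: differentiable_continuous; case: (is_diff_pair (is_diff_id s) (is_diff_cst (0 : R) s)).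
by apply: compact_closed => //; exact: norm_hausdorff.
Qed.

Lemma loc_int_mul K f g : compact K -> loc2 f -> loc2 g ->
  leb2.-integrable (K `&` H) (EFin \o (fun x => f x * g x)).
Proof.
move=> cK lf lg; have [L _ KL] := compact_sub_box cK.
have mK := compact_measurable cK.
have s k : loc2 k -> sqint leb2 (K `&` H) k.
  move=> lk; apply: (@sqintS _ _ _ leb2 (H `&` box L)) => //; first exact: measurableI.
  by move=> x [/KL].
apply: sqint_int; [exact: measurableI|exact: s|exact: s].
Qed.

Lemma edens_int K p1 p2 : compact K -> loc2 p1 -> loc2 p2 ->
  leb2.-integrable (K `&` H) (EFin \o edens p1 p2).
Proof.
move=> cK l1 l2; have mK := compact_measurable cK.
have mKH : measurable (K `&` H : set R2) by exact: measurableI.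
have l0 : loc2 (cst 1 : R * R -> R) by apply: cont_loc2 => x; exact: cvg_cst.
have i1 := loc_int_mul cK l1 l1; have i2 := loc_int_mul cK l2 l2.
have j1 := integrableZr' (2 * delta.1) mKH (loc_int_mul cK l1 l0).
have j2 := integrableZr' (2 * delta.2) mKH (loc_int_mul cK l2 l0).
have := integrableBr mKH (integrableDr mKH i1 i2) (integrableDr mKH j1 j2).
congr (_.-integrable _ _); apply/funext => x /=; congr EFin; rewrite /edens; ring.
Qed.

Lemma sin2_int K t : compact K -> loc1 t ->
  mu1.-integrable (line K) (EFin \o (fun s => sin (t s) ^+ 2)).
Proof.
move=> cK lt; have [L _ KL] := compact_sub_box cK; have mL := line_measurable cK.
apply: (@integrable_le _ (measurableTypeR R) R mu1 _ _ (cst 1)) => //.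
- by apply: measurable_sin2; apply: measurable_funTS; exact: loc1_measurable.
- move=> s _; rewrite /= ger0_norm ?sqr_ge0//.
- apply: (@integrableS _ (measurableTypeR R) R mu1 `[- L, L]%classic (line K) (EFin \o cst 1)) => //.
    by move=> s /KL[/=]; rewrite in_itv/= ler_norml.
  by apply: continuous_segment_integrable => x; exact: cvg_cst.
Qed.

Lemma energyE f p1 p2 t (K : set (R * R)) : H1d f p1 p2 t -> compact K ->
  energy eps delta f K = (2^-1 * \int[leb2]_(x in K `&` H) edens p1 p2 x +
    (2 * eps)^-1 * \int[mu1]_(s in line K) (sin (t s) ^+ 2))%:E.
Proof.
move=> hf cK; have [_ lw1 lw2 ae1 ae2] := H1d_H1loc hf; have [lt' aet] := H1d_trace hf.
have [lf l1 l2 lt _ _] := hf; have mK := compact_measurable cK.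
have mKH : measurable (K `&` H : set R2) by exact: measurableI.
rewrite EFinD !EFinM /energy /Rintegral !fineK; last 2 first.
- by apply: integrable_fin_num (sin2_int cK lt); exact: line_measurable.
- by apply: integrable_fin_num (edens_int cK l1 l2).
congr (adde (mule _ _) (mule _ _)).
- apply: (ae_Rintegral (mu := leb2) (f := edens (weak_partial e1 f) (weak_partial e2 f))) => //.
  + by have /integrableP[/measurable_EFinP] := edens_int cK lw1 lw2.
  + by have /integrableP[/measurable_EFinP] := edens_int cK l1 l2.
  + by apply: (ae_imp2 ae1 ae2) => x h1 h2 [_ Hx]; rewrite /edens h1// h2.
- apply: (ae_Rintegral (mu := mu1) (f := fun s => sin (trace f s) ^+ 2)) => //.
  + exact: line_measurable.
  + by apply: measurable_sin2; apply: measurable_funTS; exact: loc1_measurable.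
  + by apply: measurable_sin2; apply: measurable_funTS; exact: loc1_measurable.
  + by apply: (ae_imp aet) => s ->.
Qed.

(* The increment of the energy of [f] under the variation [psi], where [p1], [p2]
   and [t] are the partial derivatives and the trace of [f]. *)
Definition Jf (p1 p2 : R * R -> R) t psi psi1 psi2 : R :=
  \int[leb2]_(x in H) (2^-1 * (psi1 x ^+ 2 + psi2 x ^+ 2) +
     ((p1 x - delta.1) * psi1 x + (p2 x - delta.2) * psi2 x)) +
  (2 * eps)^-1 * \int[mu1]_s (sin (t s + psi (s, 0)) ^+ 2 - sin (t s) ^+ 2).

(** Off the support of [psi] its gradient vanishes as well, so the increment can be integrated over
    the whole half-plane and line, and the support disappears from the formula. *)
Lemma energy_diff f p1 p2 t psi psi1 psi2 L : H1d f p1 p2 t ->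
  C1g psi psi1 psi2 -> vanish L psi ->
  energy eps delta (f \+ psi) (supp psi) =
    (energy eps delta f (supp psi) + (Jf p1 p2 t psi psi1 psi2)%:E)%E.
Proof.
move=> hf hp v; set K := supp psi.
have cK : compact K by have [] : C1c psi by apply/C1cP; exists psi1, psi2, L.
have hfp : H1d (f \+ psi) (fun x => p1 x + psi1 x) (fun x => p2 x + psi2 x)
    (fun s => t s + psi (s, 0)).
  by apply: eq_H1d (H1dD 1 hf (H1d_C1g hp)) => x *; rewrite /= mul1r.
rewrite (energyE hf cK) (energyE hfp cK) -EFinD; congr EFin.
have [_ l1 l2 lt _ _] := hf; have [_ l1' l2' lt' _ _] := hfp.
have mK := compact_measurable cK.
have mKH : measurable (K `&` H : set R2) by exact: measurableI.
have mL := line_measurable cK.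
rewrite /Jf.
have -> : \int[leb2]_(x in H) (2^-1 * (psi1 x ^+ 2 + psi2 x ^+ 2) +
     ((p1 x - delta.1) * psi1 x + (p2 x - delta.2) * psi2 x)) =
   2^-1 * \int[leb2]_(x in K `&` H) edens (fun x => p1 x + psi1 x) (fun x => p2 x + psi2 x) x
   - 2^-1 * \int[leb2]_(x in K `&` H) edens p1 p2 x.
  rewrite -mulrBr -RintegralB//; [|exact: edens_int|exact: edens_int].
  rewrite -RintegralZl//; last by apply: integrableBr => //; exact: edens_int.
  rewrite (@Rintegral_sub _ _ _ leb2 H (K `&` H)); [|by move=> x []|].
    by apply: eq_Rintegral => x _; rewrite /edens; field.
  move=> x Hx nx; have nK : ~ K x by move=> Kx; apply: nx.
  have [-> ->] := derive_outside hp (supp_closed (psi := psi)) (fun y => @supp0 R psi y) nK.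
  by rewrite expr0n/= !mulr0 !addr0 mulr0.
have -> : \int[mu1]_s (sin (t s + psi (s, 0)) ^+ 2 - sin (t s) ^+ 2) =
   \int[mu1]_(s in line K) (sin (t s + psi (s, 0)) ^+ 2) - \int[mu1]_(s in line K) (sin (t s) ^+ 2).
  rewrite -RintegralB//; [|exact: sin2_int|exact: sin2_int].
  apply: Rintegral_sub => // s _ ns.
  by rewrite (supp0 (psi := psi))// addr0 subrr.
ring.
Qed.

Lemma minimizerP f p1 p2 t : H1d f p1 p2 t ->
  local_minimizer eps delta f <->
  (forall psi psi1 psi2 L, C1g psi psi1 psi2 -> vanish L psi -> 0 <= Jf p1 p2 t psi psi1 psi2).
Proof.
move=> hf; split=> [[_ h] psi psi1 psi2 L hp v|h].
  have cp : C1c psi by apply/C1cP; exists psi1, psi2, L.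
  have := h psi cp; rewrite (energy_diff hf hp v) (energyE hf cp.2).
  by rewrite -EFinD lee_fin lerDl.
split; first by have [] := H1d_H1loc hf.
move=> psi cp; have [psi1 [psi2 [L [hp v]]]] := (C1cP psi).1 cp.
by rewrite (energy_diff hf hp v) (energyE hf cp.2) -EFinD lee_fin lerDl (h _ _ _ _ hp v).
Qed.

End EnergyVariation.

(** * The first order system of the profiles and its calibration *)

Section Profile.
Context {R : realType}.
Local Notation R2 := (measurableTypeR R * measurableTypeR R)%type.
Local Notation mu1 := (@leb1 R).
Local Notation leb2 := (@leb2 R).
Local Notation H := (halfplane : set R2).
Variables (eps : R) (heps : 0 < eps).
Implicit Types (f g psi eta : R * R -> R) (t : R -> R) (x : R * R) (v : R).

(* A positive C^1 extension of [s + eps] from [0 <= s] to the whole line, so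
   that the profiles become C^1 functions on the plane. *)
Definition yf (s : R) : R := eps + s + (2 * eps)^-1 * (s ^+ 2 - q2 s).
Definition dyf (s : R) : R := 1 + eps^-1 * (s - q1 s).

Lemma yf_gt0 s : 0 < yf s.
Proof.
rewrite /yf /q2; have [s0|s0] := leP 0 s.
  by rewrite q1_ge// subrr mulr0 addr0 ltr_pwDl.
rewrite q1_le ?ltW// expr0n subr0.
have -> : eps + s + (2 * eps)^-1 * s ^+ 2 = (2 * eps)^-1 * ((s + eps) ^+ 2 + eps ^+ 2).
  by field; rewrite gt_eqF.
by rewrite mulr_gt0 ?invr_gt0 ?mulr_gt0// ltr_wpDl ?sqr_ge0// exprn_gt0.
Qed.

Lemma is_derive_yf (s : R) : is_derive s (1 : R) yf (dyf s).
Proof.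
have D := is_derive_q2 s; rewrite /yf; apply: is_derive_eq.
by rewrite /dyf /GRing.scale /=; field; rewrite gt_eqF.
Qed.

Lemma dyf_cont : continuous dyf.
Proof.
move=> s; apply: cvgD; first exact: cvg_cst.
apply: cvgM; first exact: cvg_cst.
by apply: cvgB; [exact: cvg_id|apply: continuous_max; [exact: cvg_id|exact: cvg_cst]].
Qed.

Definition kf s := (yf s)^-1.
Definition dkf s := - (kf s ^+ 2) * dyf s.

Lemma kf_gt0 s : 0 < kf s. Proof. by rewrite invr_gt0 yf_gt0. Qed.

Lemma kfE s : 0 <= s -> kf s = (s + eps)^-1.
Proof. by move=> s0; rewrite /kf /yf /q2 q1_ge// subrr mulr0 addr0 addrC. Qed.

Lemma dkfE s : 0 <= s -> dkf s = - kf s ^+ 2.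
Proof. by move=> s0; rewrite /dkf /dyf q1_ge// subrr mulr0 addr0 mulr1. Qed.

Lemma is_derive_kf (s : R) : is_derive s (1 : R) kf (dkf s).
Proof.
have D := is_derive_yf s; have Y0 := yf_gt0 s; rewrite /kf.
have := is_deriveV (lt0r_neq0 Y0) D; congr is_derive.
by rewrite /dkf /kf /GRing.scale/= exprVn.
Qed.

Lemma kf_cont : continuous kf.
Proof.
by move=> s; apply/differentiable_continuous/derivable1_diffP; case: (is_derive_kf s).
Qed.

Lemma dkf_cont : continuous dkf.
Proof.
move=> s; apply: cvgM; last exact: dyf_cont.
by apply: cvgN; apply: cvgM; exact: kf_cont.
Qed.

(* The profiles solve [grad w = F (x, w)]. *)
Definition F1 x v := - (kf x.2 * sin v ^+ 2).
Definition F2 x v := kf x.2 * (sin v * cos v).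

Lemma sin_cos_angle (z : R) (u := pi / 2 - atan z) :
  sin u ^+ 2 = (1 + z ^+ 2)^-1 /\ sin u * cos u = z * (1 + z ^+ 2)^-1.
Proof.
have s0 : 0 <= 1 + z ^+ 2 by rewrite addr_ge0 ?sqr_ge0.
have C2 : cos (atan z) ^+ 2 = (1 + z ^+ 2)^-1 by rewrite cos_atan exprVn sqr_sqrtr.
have c0 : cos (atan z) != 0 by apply/lt0r_neq0/cos_gt0_pihalf; rewrite atan_gtNpi2 atan_ltpi2.
have S : sin (atan z) = z * cos (atan z).
  by rewrite -[X in X * _]atanK /tan divfK.
have -> : sin u = cos (atan z) by rewrite /u sinB cos_pihalf sin_pihalf mul0r subr0 mul1r.
have -> : cos u = sin (atan z) by rewrite /u cosB cos_pihalf sin_pihalf mul0r add0r mul1r.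
by split=> //; rewrite S -C2; ring.
Qed.

Definition ang (c : R) x := pi / 2 - atan ((x.1 + c) * kf x.2).
Definition ang1 c x := - (1 + ((x.1 + c) * kf x.2) ^+ 2)^-1 * kf x.2.
Definition ang2 c x := - (1 + ((x.1 + c) * kf x.2) ^+ 2)^-1 * ((x.1 + c) * dkf x.2).

Lemma C1g_ang c : C1g (ang c) (ang1 c) (ang2 c).
Proof.
have C := @C1g_prod R (fun r => r + c) (cst 1) kf dkf.
have {}C : C1g (fun x : R * R => (x.1 + c) * kf x.2) (fun x : R * R => 1 * kf x.2)
    (fun x : R * R => (x.1 + c) * dkf x.2).
  apply: C.
  - by move=> s; apply: is_derive_eq; rewrite addr0.
  - by move=> s; exact: cvg_cst.
  - exact: is_derive_kf.
  - exact: dkf_cont.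
have D (s : R) : is_derive s (1 : R) (fun s => pi / 2 - atan s) (- (1 + s ^+ 2)^-1).
  have := is_deriveB (is_derive_cst (pi / 2 : R) s 1) (is_derive1_atan s).
  by rewrite sub0r.
have Dc : continuous (fun s : R => - (1 + s ^+ 2)^-1).
  move=> s; apply: cvgN; apply: cvgV; first by apply: lt0r_neq0; rewrite ltr_pwDl// sqr_ge0.
  by apply: cvgD; [exact: cvg_cst|apply: cvgM; exact: cvg_id].
by apply: eq_C1g (C1g_comp D Dc C) _ _ _ => x //; rewrite mul1r.
Qed.

Lemma angF c x : 0 <= x.2 -> ang1 c x = F1 x (ang c x) /\ ang2 c x = F2 x (ang c x).
Proof.
move=> x0; have [S SC] := sin_cos_angle ((x.1 + c) * kf x.2).
rewrite /F1 /F2 /ang S SC /ang1 /ang2 dkfE//; split; first by rewrite mulNr mulrC.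
by ring.
Qed.

Lemma is_derive_S (s : R) :
  is_derive s (1 : R) (fun s => sin s * cos s - s) (- 2 * sin s ^+ 2).
Proof.
apply: is_derive_eq; rewrite /GRing.scale/=; have := cos2Dsin2 s; lra.
Qed.

Lemma is_derive_sin2 (s : R) :
  is_derive s (1 : R) (fun s => sin s ^+ 2) (2 * (sin s * cos s)).
Proof.
have -> : (fun s : R => sin s ^+ 2) = (fun s => sin s * sin s) by apply/funext => r; rewrite expr2.
by apply: is_derive_eq; rewrite /GRing.scale/=; ring.
Qed.

Lemma C1g_of2 (k dk : R -> R) : (forall s : R, is_derive s (1 : R) k (dk s)) -> continuous dk ->
  C1g (fun x : R * R => k x.2) (fun _ => 0) (fun x => dk x.2).
Proof.
move=> hk ck; have := C1g_comp hk ck (@C1g_snd R).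
by move/eq_C1g; apply => x //=; rewrite ?mulr0 ?mulr1.
Qed.

(* The calibration field [(G1, G2)]: its divergence along a graph [w] is
   [F . grad w - |F|^2 / 2]. *)
Definition G1 x v := 2^-1 * kf x.2 * (sin v * cos v - v).
Definition G2 x v := 2^-1 * kf x.2 * sin v ^+ 2.

(** The [v]-derivatives of [G1] and [G2] are [F1] and [F2], which gives the terms in [w1] and [w2].
    The explicit dependence on [x.2] contributes [- 2^-1 * kf ^+ 2 * sin ^+ 2], which is
    [- 2^-1 * (F1 ^+ 2 + F2 ^+ 2)] since [sin ^+ 2 + cos ^+ 2 = 1]. *)
Lemma C1g_G w w1 w2 : C1g w w1 w2 ->
  exists g1 g2 k1 k2, [/\ C1g (fun x => G1 x (w x)) g1 g2, C1g (fun x => G2 x (w x)) k1 k2 &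
    forall x, 0 <= x.2 -> g1 x + k2 x =
      F1 x (w x) * w1 x + F2 x (w x) * w2 x - 2^-1 * (F1 x (w x) ^+ 2 + F2 x (w x) ^+ 2)].
Proof.
move=> hw; have hk := C1gZ 2^-1 (C1g_of2 is_derive_kf dkf_cont).
have cs : continuous (fun s : R => - 2 * sin s ^+ 2).
  by move=> s; apply: cvgM; [exact: cvg_cst|apply: cvgM; exact: continuous_sin].
have cq : continuous (fun s : R => 2 * (sin s * cos s)).
  move=> s; apply: cvgM; first exact: cvg_cst.
  by apply: cvgM; [exact: continuous_sin|exact: continuous_cos].
have A := C1gM hk (C1g_comp is_derive_S cs hw).
have B := C1gM hk (C1g_comp is_derive_sin2 cq hw).
do 4 eexists; split; [exact: A|exact: B|] => x x0 /=.
rewrite /F1 /F2 dkfE//.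
have E : (sin (w x) * cos (w x)) ^+ 2 = sin (w x) ^+ 2 - (sin (w x) ^+ 2) ^+ 2.
  by have := cos2Dsin2 (w x) => C; rewrite exprMn -[cos _ ^+ 2](addrK (sin (w x) ^+ 2)) C; ring.
rewrite [(kf x.2 * (_ * _)) ^+ 2]exprMn E; by field.
Qed.

Lemma C1g_intH (k : R * R -> R) (L : R) : continuous k -> vanish L k ->
  leb2.-integrable H (EFin \o k).
Proof. by move=> ck vk; apply: (@cont_integrable_box R H k L). Qed.

Variable delta : R * R.

Lemma H1d_profile (a : R) : H1d (profile eps delta a) (ang1 (eps * a))
  (fun x => ang2 (eps * a) x + delta.2) (fun s => ang (eps * a) (s, 0)).
Proof.
have := H1d_C1g (C1gD (C1g_ang (eps * a)) (C1gZ delta.2 (@C1g_snd R))).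
apply: eq_H1d => [x /set_mem Hx|x _|x _|s] /=.
- by rewrite /profile /ang kfE// ltW.
- by rewrite mulr0 addr0.
- by rewrite mulr1.
- by rewrite mulr0 addr0.
Qed.

(** The divergence theorem is applied to [G (x, w) - G (x, u)], which has bounded support, with [u]
    the profile angle and [w = u + psi]. Since [kf 0 = eps^-1], its boundary flux is the increment
    of the boundary energy; in the interior the divergence completes the square
    [|grad w - F (x, w)| ^+ 2], whose value at [u] is zero. *)
Lemma calibration (c L : R) psi psi1 psi2 : C1g psi psi1 psi2 -> vanish L psi ->
  Jf eps delta (ang1 c) (fun x => ang2 c x + delta.2) (fun s => ang c (s, 0)) psi psi1 psi2 =
  \int[leb2]_(x in H) (2^-1 * ((ang1 c x + psi1 x - F1 x (ang c x + psi x)) ^+ 2 +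
                               (ang2 c x + psi2 x - F2 x (ang c x + psi x)) ^+ 2)).
Proof.
move=> hp v; have hu := C1g_ang c; have hw := C1gD hu hp.
have vL : vanish `|L| psi by exact: vanishS (ler_norm L) v.
have [g1 [g2 [k1 [k2 [hG1 hG2 hdiv]]]]] := C1g_G hw.
have [g1' [g2' [k1' [k2' [hG1' hG2' hdiv']]]]] := C1g_G hu.
have hV1 := C1gB hG1 hG1'; have hV2 := C1gB hG2 hG2'.
have vV1 : vanish `|L| (fun x => G1 x (ang c x + psi x) - G1 x (ang c x)).
  by move=> x nx; rewrite vL// addr0 subrr.
have vV2 : vanish `|L| (fun x => G2 x (ang c x + psi x) - G2 x (ang c x)).
  by move=> x nx; rewrite vL// addr0 subrr.
have I1 := integral_halfplane_d1 hV1 (normr_ge0 L) vV1.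
have I2 := integral_halfplane_d2 hV2 (normr_ge0 L) vV2.
(* The horizontal drift integrates to zero, while the vertical one cancels against the summand
   [delta.2] in the derivative of the profile. *)
have I3 := integral_halfplane_d1 (C1gZ delta.1 hp) (normr_ge0 L)
  (fun x nx => etrans (congr1 _ (vL x nx)) (mulr0 _)).
have [w1 w2] := vanish_d hp vL; have cp := C1g_cont hp; have [_ cp1 cp2] := hp.
have [_ cu1 cu2] := hu; have cu := C1g_cont hu.
have [vg _] := vanish_d hV1 vV1; have [_ vk] := vanish_d hV2 vV2.
have [_ cg _] := hV1; have [_ _ ck] := hV2.
pose A x := 2^-1 * (psi1 x ^+ 2 + psi2 x ^+ 2) +
     ((ang1 c x - delta.1) * psi1 x + (ang2 c x + delta.2 - delta.2) * psi2 x).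
have cA : continuous A.
  move=> x; apply: cvgD.
    apply: cvgM; first exact: cvg_cst.
    by apply: cvgD; apply: cvgM; [exact: cp1|exact: cp1|exact: cp2|exact: cp2].
  apply: cvgD; apply: cvgM.
  - by apply: cvgB; [exact: cu1|exact: cvg_cst].
  - exact: cp1.
  - by apply: cvgB; [apply: cvgD; [exact: cu2|exact: cvg_cst]|exact: cvg_cst].
  - exact: cp2.
have vA : vanish `|L| A.
  by move=> x nx; rewrite /A w1// w2// expr0n/= !(mulr0, addr0).
have cd : continuous (fun x => delta.1 * psi1 x) by move=> x; apply: cvgM; [exact: cvg_cst|exact: cp1].
have vd : vanish `|L| (fun x => delta.1 * psi1 x) by move=> x nx; rewrite w1// mulr0.
have iA := C1g_intH cA vA; have ig := C1g_intH cg vg; have ik := C1g_intH ck vk.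
have id := C1g_intH cd vd.
rewrite /Jf -/A.
have -> : (2 * eps)^-1 * \int[mu1]_s (sin (ang c (s, 0) + psi (s, 0)) ^+ 2 - sin (ang c (s, 0)) ^+ 2)
   = - \int[leb2]_(x in H) (k2 x - k2' x).
  rewrite I2 opprK -RintegralZl//.
    by apply: eq_Rintegral => s _; rewrite /G2 kfE//= add0r invfM; ring.
  apply: (@integrable_bounded_support R _ (- `|L|) `|L|).
    move=> s; have cs f : continuous f -> {for s, continuous (fun r : R => sin (f (r, 0)) ^+ 2)}.
      move=> cf; have c1 := continuous_slice1 (b := 0) cf.
      have c2 : {for s, continuous (fun r : R => sin (f (r, 0)))}.
        by apply: (@continuous_comp _ _ _ (fun r => f (r, 0)) (@sin R)); [exact: c1|exact: continuous_sin].
      by rewrite /prop_for; under eq_fun do rewrite expr2; exact: cvgM.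
    apply: cvgB; last exact: cs.
    by apply: (cs (fun x => ang c x + psi x)) => x; apply: cvgD; [exact: cu|exact: cp].
  by move=> s hs; rewrite (vanish_line vL)// addr0 subrr.
have E : \int[leb2]_(x in H) A x - \int[leb2]_(x in H) (k2 x - k2' x) =
  \int[leb2]_(x in H) A x - \int[leb2]_(x in H) (k2 x - k2' x) -
  \int[leb2]_(x in H) (g1 x - g1' x) + \int[leb2]_(x in H) (delta.1 * psi1 x).
  by rewrite I1 I3 subr0 addr0.
rewrite E; have iAk := integrableBr (measurable_halfplane) iA ik.
have iAkg := integrableBr (measurable_halfplane) iAk ig.
rewrite -RintegralB// -RintegralB// -RintegralD//.
apply: eq_Rintegral => x /set_mem Hx; have x0 := ltW Hx.
have D := hdiv x x0; have D' := hdiv' x x0; have [a1 a2] := angF c x0.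
have -> : A x - (k2 x - k2' x) - (g1 x - g1' x) + delta.1 * psi1 x =
   A x - (g1 x + k2 x) + (g1' x + k2' x) + delta.1 * psi1 x by ring.
by rewrite D D' /A a1 a2; field.
Qed.

Lemma profile_minimizer (a : R) : local_minimizer eps delta (profile eps delta a).
Proof.
apply/(minimizerP _ _ (H1d_profile a)) => psi psi1 psi2 L hp v.
rewrite (calibration _ hp v); apply: Rintegral_ge0 => x _.
by rewrite mulr_ge0// addr_ge0 ?sqr_ge0.
Qed.

Lemma ang_bound c x : 0 < ang c x < pi.
Proof.
have := @atan_gtNpi2 R ((x.1 + c) * kf x.2); have := @atan_ltpi2 R ((x.1 + c) * kf x.2).
rewrite /ang; lra.
Qed.

Lemma ang_pinfty c e : 0 < e -> exists M, forall s, M < s -> `|ang c (s, 0)| < e.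
Proof.
move=> e0; have /cvgrPdist_lt/(_ e e0)[M [_ hM]] := @cvgy_atan R.
have k0 := kf_gt0 0.
exists ((kf 0)^-1 * M - c) => s hs; apply: (hM ((s + c) * kf 0)) => /=.
by rewrite -ltr_pdivrMr// mulrC; lra.
Qed.

Lemma ang_ninfty c e : 0 < e -> exists M, forall s, s < M -> `|ang c (s, 0) - pi| < e.
Proof.
move=> e0; have /cvgrPdist_lt/(_ e e0)[M [_ hM]] := @cvgy_atan R.
have k0 := kf_gt0 0.
exists ((kf 0)^-1 * - M - c) => s hs.
have := hM (- ((s + c) * kf 0)); rewrite /= atanN opprK.
have h : M < - ((s + c) * kf 0).
  by rewrite ltrNr -ltr_pdivlMr// mulrC; lra.
move=> /(_ h); rewrite /ang /=; congr (_ < _); rewrite -normrN; congr `|_|.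
by field.
Qed.

Lemma profile_conditions (a : R) : conditions_at_infinity delta (profile eps delta a).
Proof.
have hp := H1d_profile a; have [_ aet] := H1d_trace hp.
split.
- move=> e e0; have [M hM] := ang_pinfty (eps * a) e0; exists M.
  by apply: (ae_imp aet) => s -> Ms; rewrite subr0; exact: hM.
- move=> e e0; have [M hM] := ang_ninfty (eps * a) e0; exists M.
  by apply: (ae_imp aet) => s -> Ms; exact: hM.
- have E x : H x -> profile eps delta a x - delta.2 * x.2 = ang (eps * a) x.
    by move=> Hx; rewrite /profile /ang kfE ?addrK// ltW.
  split.
    apply: (eq_measurable_fun (ang (eps * a))) => [x /set_mem Hx|]; first by rewrite E.
    apply: measurable_funTS; apply: continuous_measurable_fun2.
    exact: C1g_cont (C1g_ang (eps * a)).
  exists pi; apply: aeW => x Hx; rewrite E//.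
  by have := ang_bound (eps * a) x => /andP[h1 h2]; rewrite gtr0_norm// ltW.
Qed.

End Profile.

(** * Finite energy of the difference with a profile *)

Section MeanValue.
Context {R : realType}.
Implicit Types (f : R -> R) (a b s : R).

(** The location of [c] is expressed through all intervals containing [a] and [b], so that callers
    do not have to order the two points. *)
Lemma mvt f f' a b : (forall s, is_derive s (1 : R) f (f' s)) ->
  exists2 c, (forall m M, m <= a <= M -> m <= b <= M -> m <= c <= M) & f b - f a = f' c * (b - a).
Proof.
move=> df.
have cf : continuous f.
  by move=> s; apply/differentiable_continuous/derivable1_diffP; case: (df s).
have [ab|ba] := leP a b.
  have [|c ci E] := @MVT_segment R f f' a b ab (fun s _ => df s); first exact: continuous_subspaceT.
  by exists c => // m M; move: ci; rewrite in_itv/=; lra.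
have [|c ci E] := @MVT_segment R f f' b a (ltW ba) (fun s _ => df s); first exact: continuous_subspaceT.
exists c; last by rewrite -[LHS]opprB E; ring.
by move=> m M; move: ci; rewrite in_itv/=; lra.
Qed.

Lemma mvt_lip f f' (K : R) a b : (forall s, is_derive s (1 : R) f (f' s)) ->
  (forall s, `|f' s| <= K) -> `|f b - f a| <= K * `|b - a|.
Proof. by move=> df fK; have [c _ ->] := mvt a b df; rewrite normrM ler_wpM2r. Qed.

Lemma mvt_taylor f f' (K : R) a b : (forall s, is_derive s (1 : R) f (f' s)) ->
  (forall s r, `|f' s - f' r| <= K * `|s - r|) ->
  `|f (a + b) - f a - f' a * b| <= K * b ^+ 2.
Proof.
move=> df fK; have [c hc ->] := mvt a (a + b) df.
have ca : `|c - a| <= `|b|.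
  have := hc (a - `|b|) (a + `|b|); have := ler_norm b; have := ler_norm (- b).
  by rewrite normrN ler_norml; lra.
have -> : a + b - a = b by ring.
have K0 : 0 <= K by have := fK 1 0; rewrite subr0 normr1 mulr1; apply: le_trans.
rewrite -mulrBl normrM -real_normK ?num_real// expr2 mulrA ler_wpM2r//.
by apply: le_trans (fK _ _) _; rewrite ler_wpM2l.
Qed.

Definition s2 a : R := 2 * (sin a * cos a).

Lemma is_derive_s2 a : is_derive a (1 : R) s2 (2 * (cos a ^+ 2 - sin a ^+ 2)).
Proof. by rewrite /s2; apply: is_derive_eq; rewrite /GRing.scale/=; ring. Qed.

Lemma cos2_sin2_bound a : `|2 * (cos a ^+ 2 - sin a ^+ 2)| <= 2 :> R.
Proof.
have := cos2Dsin2 a; have := sqr_ge0 (cos a); have := sqr_ge0 (sin a).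
rewrite ler_norml => *; apply/andP; split; lra.
Qed.

Lemma s2_lip a b : `|s2 b - s2 a| <= 2 * `|b - a|.
Proof. by exact: mvt_lip is_derive_s2 cos2_sin2_bound. Qed.

Lemma sin_lip a b : `|sin b - sin a| <= `|b - a|.
Proof.
rewrite -[leRHS]mul1r; apply: (@mvt_lip (@sin R) (@cos R)) => s.
by rewrite ler_norml cos_geN1 cos_le1.
Qed.

Lemma sin2_taylor a b : `|sin (a + b) ^+ 2 - sin a ^+ 2 - s2 a * b| <= 2 * b ^+ 2.
Proof.
apply: (@mvt_taylor (fun s => sin s ^+ 2) s2) => [s|s r]; first exact: is_derive_sin2.
by rewrite distrC; apply: le_trans (s2_lip _ _) _; rewrite distrC.
Qed.

Lemma sin2_diff a b : sin (a + b) ^+ 2 - sin a ^+ 2 = sin b * sin (2 * a + b).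
Proof.
have -> : 2 * a + b = a + (a + b) by ring.
rewrite [sin (a + (a + b))]sinD cosD !sinD.
have Ca : cos a ^+ 2 = 1 - sin a ^+ 2 by rewrite -(cos2Dsin2 a) addrK.
have Cb : cos b ^+ 2 = 1 - sin b ^+ 2 by rewrite -(cos2Dsin2 b) addrK.
have -> : (sin a * cos b + cos a * sin b) ^+ 2 - sin a ^+ 2 =
  sin a ^+ 2 * cos b ^+ 2 + 2 * (sin a * cos b * cos a * sin b) + cos a ^+ 2 * sin b ^+ 2 - sin a ^+ 2 by ring.
have -> : sin b * (sin a * (cos a * cos b - sin a * sin b) + cos a * (sin a * cos b + cos a * sin b)) =
  2 * (sin a * cos b * cos a * sin b) + sin b ^+ 2 * (cos a ^+ 2 - sin a ^+ 2) by ring.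
by rewrite Ca Cb; ring.
Qed.

Lemma sin_le_id a : `|sin a| <= `|a|.
Proof. by have := sin_lip 0 a; rewrite sin0 !subr0. Qed.

Lemma sin_abs_le1 a : `|sin a| <= 1.
Proof. by rewrite ler_norml sin_geN1 sin_le1. Qed.

Lemma sin2_diff_le a b : `|sin (a + b) ^+ 2 - sin a ^+ 2| <= `|b|.
Proof.
rewrite sin2_diff normrM -[leRHS]mulr1; apply: ler_pM => //; [exact: sin_le_id|exact: sin_abs_le1].
Qed.

(** Uniform convexity of [sin ^+ 2] near the well [0]: its second derivative is [2 - 4 * sin ^+ 2],
    and [sin ^+ 2 <= 1 / 16] on this interval. *)
Lemma s2_mono0 a b : `|a| <= 1 / 4 -> `|b| <= 1 / 4 -> (b - a) ^+ 2 <= (s2 b - s2 a) * (b - a).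
Proof.
move=> ha hb; have [c hc ->] := mvt a b is_derive_s2.
have {}hc : `|c| <= 1 / 4.
  by move: ha hb (hc (- (1 / 4)) (1 / 4)); rewrite !ler_norml; lra.
have S : sin c ^+ 2 <= 1 / 16.
  have h : `|sin c| <= 1 / 4 := le_trans (sin_le_id c) hc.
  rewrite -real_normK ?num_real//.
  by have := normr_ge0 (sin c); nra.
have -> : cos c ^+ 2 = 1 - sin c ^+ 2 by rewrite -(cos2Dsin2 c) addrK.
rewrite -mulrA -expr2 ler_peMl ?sqr_ge0//; lra.
Qed.

Lemma s2_piD a : s2 (a + pi) = s2 a.
Proof. by rewrite /s2 sinDpi cosDpi mulrNN. Qed.

Lemma s2_monopi a b : `|a - pi| <= 1 / 4 -> `|b - pi| <= 1 / 4 ->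
  (b - a) ^+ 2 <= (s2 b - s2 a) * (b - a).
Proof.
move=> ha hb; have := s2_mono0 ha hb.
rewrite -(s2_piD (a - pi)) -(s2_piD (b - pi)) !subrK.
by rewrite (_ : b - pi - (a - pi) = b - a)//; ring.
Qed.

Lemma quad_zero (A B : R) : (forall r, 0 <= r * A + r ^+ 2 * B) -> A = 0.
Proof.
move=> h; pose k := `|B| + 1; have k0 : 0 < k by rewrite ltr_wpDl.
have := h (- (A / k)).
have -> : - (A / k) * A + (- (A / k)) ^+ 2 * B = - (A / k) ^+ 2 * (k - B).
  by field; rewrite gt_eqF.
have kB : 0 < k - B by rewrite /k; have := ler_norm B; lra.
rewrite mulNr oppr_ge0 pmulr_lle0// => h0.
have /eqP : (A / k) ^+ 2 = 0 by apply/eqP; rewrite eq_le h0 sqr_ge0.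
by rewrite sqrf_eq0 mulf_eq0 invr_eq0 (gt_eqF k0) orbF => /eqP.
Qed.

End MeanValue.

(** * The Euler-Lagrange equation in weak form *)

Section EulerLagrange.
Context {R : realType}.
Local Notation R2 := (measurableTypeR R * measurableTypeR R)%type.
Local Notation mu1 := (@leb1 R).
Local Notation leb2 := (@leb2 R).
Local Notation H := (halfplane : set R2).
Variables (eps : R) (delta : R * R).
Implicit Types (f g psi eta : R * R -> R) (t : R -> R).

Lemma cont_line_int psi (L : R) : continuous psi -> vanish L psi ->
  mu1.-integrable setT (EFin \o (fun s => psi (s, 0))).
Proof.
move=> c v; apply: (@integrable_bounded_support R _ (- L) L); first exact: continuous_slice1.
by move=> s; exact: vanish_line.
Qed.

Lemma measurable_s2 (t : R -> R) : measurable_fun (setT : set (measurableTypeR R)) t ->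
  measurable_fun (setT : set (measurableTypeR R)) (fun s => s2 (t s)).
Proof.
move=> mt; apply: (measurableT_comp _ mt); apply: continuous_measurable_fun => s.
by apply/differentiable_continuous/derivable1_diffP; case: (is_derive_s2 s).
Qed.

Lemma s2_bound (a : R) : `|s2 a| <= 2.
Proof.
rewrite /s2 !normrM ger0_norm//; rewrite -[leRHS]mulr1 ler_wpM2l//.
by rewrite -[leRHS]mulr1; apply: ler_pM => //; [exact: sin_max|exact: cos_max].
Qed.

Lemma s2_line_int t psi (L : R) : loc1 t -> continuous psi -> vanish L psi ->
  mu1.-integrable setT (EFin \o (fun s => s2 (t s) * psi (s, 0))).
Proof.
move=> lt c v; have := cont_line_int c v => I.
apply: (@integrable_le _ (measurableTypeR R) R mu1 _ _ (fun s => 2 * `|psi (s, 0)|)) => //.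
- apply: measurable_funM; first exact: measurable_s2 (loc1_measurable lt).
  by case/integrableP: I => /measurable_EFinP.
- by move=> s _; rewrite normrM ler_wpM2r// s2_bound.
- apply: integrableZr' => //; exact: integrable_norm.
Qed.

Lemma euler_lagrange f p1 p2 t psi psi1 psi2 L : H1d f p1 p2 t -> 0 < eps ->
  (forall psi psi1 psi2 L, C1g psi psi1 psi2 -> vanish L psi ->
    0 <= Jf eps delta p1 p2 t psi psi1 psi2) ->
  C1g psi psi1 psi2 -> vanish L psi ->
  \int[leb2]_(x in H) ((p1 x - delta.1) * psi1 x + (p2 x - delta.2) * psi2 x) +
    (2 * eps)^-1 * \int[mu1]_s (s2 (t s) * psi (s, 0)) = 0.
Proof.
move=> [lf l1 l2 lt _ _] e0 hJ hp v; have [v1 v2] := vanish_d hp v.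
have cp := C1g_cont hp; have [_ cp1 cp2] := hp.
have e2 : 0 <= (2 * eps)^-1 by rewrite invr_ge0 mulr_ge0// ltW.
have lc (a : R) p : loc2 p -> loc2 (fun x => p x - a).
  by move=> lp; apply: (loc2D lp); apply: cont_loc2 => x; exact: cvg_cst.
have i1 := loc2_int (lc delta.1 _ l1) cp1 v1; have i2 := loc2_int (lc delta.2 _ l2) cp2 v2.
have i12 := integrableDr (measurable_halfplane) i1 i2.
have iq : leb2.-integrable H (EFin \o (fun x => 2^-1 * (psi1 x ^+ 2 + psi2 x ^+ 2))).
  apply: (@C1g_intH R _ L).
    move=> x; apply: cvgM; first exact: cvg_cst.
    by apply: cvgD; apply: cvgM; [exact: cp1|exact: cp1|exact: cp2|exact: cp2].
  by move=> x nx; rewrite v1// v2// expr0n/= addr0 mulr0.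
have is2 := s2_line_int lt cp v.
have csq : continuous (fun x => psi x ^+ 2) by move=> x; apply: cvgM; exact: cp.
have vsq : vanish L (fun x => psi x ^+ 2) by move=> x nx; rewrite v// expr0n.
have ip2 := cont_line_int csq vsq.
apply: (@quad_zero _ _ (\int[leb2]_(x in H) (2^-1 * (psi1 x ^+ 2 + psi2 x ^+ 2)) +
   (2 * eps)^-1 * (2 * \int[mu1]_s (psi (s, 0) ^+ 2)))) => r.
have vr : vanish L (fun x => r * psi x) by move=> x nx; rewrite v// mulr0.
have cr : continuous (fun x => r * psi x) by move=> x; apply: cvgM; [exact: cvg_cst|exact: cp].
apply: le_trans (hJ _ _ _ _ (C1gZ r hp) vr) _; rewrite /Jf.
have -> : \int[leb2]_(x in H) (2^-1 * ((r * psi1 x) ^+ 2 + (r * psi2 x) ^+ 2) +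
      ((p1 x - delta.1) * (r * psi1 x) + (p2 x - delta.2) * (r * psi2 x))) =
   r ^+ 2 * \int[leb2]_(x in H) (2^-1 * (psi1 x ^+ 2 + psi2 x ^+ 2)) +
   r * \int[leb2]_(x in H) ((p1 x - delta.1) * psi1 x + (p2 x - delta.2) * psi2 x).
  rewrite -RintegralZl// -RintegralZl// -RintegralD//; [|exact: integrableZr'..].
  by apply: eq_Rintegral => x _; ring.
have I : \int[mu1]_s (sin (t s + r * psi (s, 0)) ^+ 2 - sin (t s) ^+ 2) <=
   r * \int[mu1]_s (s2 (t s) * psi (s, 0)) + r ^+ 2 * (2 * \int[mu1]_s (psi (s, 0) ^+ 2)).
  have j1 := integrableZr' r measurableT is2; have j2 := integrableZr' 2 measurableT ip2.
  have j3 := integrableZr' (r ^+ 2) measurableT j2.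
  rewrite -RintegralZl// -RintegralZl// -RintegralZl// -RintegralD//.
  have mr : measurable_fun (setT : set (measurableTypeR R)) (fun s => r * psi (s, 0)).
    by apply: continuous_measurable_fun; exact: continuous_slice1 cr.
  have mt := loc1_measurable lt.
  apply: le_Rintegral => //.
  - apply: (@integrable_le _ (measurableTypeR R) R mu1 _ _ (fun s => `|r * psi (s, 0)|)) => //.
    + by apply: measurable_funB; apply: measurable_sin2 => //; exact: measurable_funD.
    + by move=> s _; exact: sin2_diff_le.
    + by apply: integrable_norm; exact: cont_line_int cr vr.
  - exact: integrableDr.
  - move=> s _; have := sin2_taylor (t s) (r * psi (s, 0)).
    rewrite ler_norml => /andP[_ h]; set A := sin _ ^+ 2 in h *.
    set B := sin _ ^+ 2 in h *; have -> : r * (s2 (t s) * psi (s, 0)) + r ^+ 2 * (2 * psi (s, 0) ^+ 2) =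
      s2 (t s) * (r * psi (s, 0)) + 2 * (r * psi (s, 0)) ^+ 2 by ring.
    by rewrite -lerBlDl.
have := ler_wpM2l e2 I; rewrite mulrDr => {}I.
by rewrite [leLHS]addrC; apply: le_trans (lerD I (lexx _)) _; rewrite le_eqVlt; apply/orP; left; apply/eqP; ring.
Qed.

End EulerLagrange.

Section MoreIntegration.
Context d (T : measurableType d) (R : realType) (mu : {measure set T -> \bar R}).
Implicit Types (D : set T) (f g : T -> R).

Lemma ae_le_Rintegral D f g : measurable D ->
  mu.-integrable D (EFin \o f) -> mu.-integrable D (EFin \o g) ->
  {ae mu, forall x, D x -> f x <= g x} ->
  \int[mu]_(x in D) f x <= \int[mu]_(x in D) g x.
Proof.
move=> mD If Ig fg.
have mf : measurable_fun D f by case/integrableP: If => /measurable_EFinP.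
have mg : measurable_fun D g by case/integrableP: Ig => /measurable_EFinP.
have mm : measurable_fun D (fun x => Num.min (f x) (g x)) by exact: measurable_minr.
(* The minimum equals [f] almost everywhere and lies below [g] everywhere, which reduces the claim
   to a pointwise comparison. *)
have -> : \int[mu]_(x in D) f x = \int[mu]_(x in D) Num.min (f x) (g x).
  congr fine; apply: ae_Rintegral => //.
  by apply: (ae_imp fg) => x h Dx; rewrite min_l// h.
apply: le_Rintegral => //.
  apply: (@integrable_le _ T R mu D _ (fun x => `|f x| + `|g x|)) => //.
    move=> x _; rewrite /Order.min; case: ifP => _; first by rewrite lerDl.
    by rewrite lerDr.
  by apply: integrableDr => //; exact: integrable_norm.
by move=> x _; rewrite ge_min lexx orbT.
Qed.

Lemma integrable_patch D f : measurable D -> mu.-integrable D (EFin \o f) ->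
  mu.-integrable setT (EFin \o (f \_ D)).
Proof. by move=> mD /(integrable_mkcond _ mD); rewrite restrict_EFin. Qed.

Lemma ae_ip_le D f g : measurable D -> sqint mu D f -> sqint mu D g ->
  {ae mu, forall x, D x -> `|f x| <= `|g x|} -> ip mu D f f <= ip mu D g g.
Proof.
move=> mD Sf Sg fg; rewrite !ipE; apply: ae_le_Rintegral => //; [exact: sqint_int|exact: sqint_int|].
apply: (ae_imp fg) => x h Dx; rewrite -!expr2 -[leLHS]real_normK ?num_real//.
by rewrite -[leRHS]real_normK ?num_real// ler_sqr ?nnegrE// h.
Qed.

Lemma sqint_exhaust D (F : nat -> set T) f (K : R) : measurable D -> (forall n, measurable (F n)) ->
  (forall n, F n `<=` F n.+1) -> D = \bigcup_n F n ->
  (forall n, sqint mu (F n) f) -> (forall n, ip mu (F n) f f <= K) ->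
  sqint mu D f /\ ip mu D f f <= K.
Proof.
move=> mD mF ndF DE Sf hK.
have mf : measurable_fun D f.
  by rewrite DE; apply/measurable_fun_bigcup => // n; have [] := Sf n.
have C : (\int[mu]_(x in F n) (f x ^+ 2)%:E)%E @[n --> \oo] --> (\int[mu]_(x in D) (f x ^+ 2)%:E)%E.
  rewrite DE; apply: ge0_nondecreasing_set_cvg_integral => //.
  - by apply/nondecreasing_seqP => n; apply/subsetPset; exact: ndF.
  - by move=> n; apply/measurable_EFinP; apply: measurable_funX; have [] := Sf n.
  - by move=> n x _; rewrite lee_fin sqr_ge0.
have {}C : (\int[mu]_(x in D) (f x ^+ 2)%:E <= K%:E)%E.
  rewrite -(cvg_lim _ C)//; apply: lime_le; first by apply/cvg_ex; eexists; exact: C.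
  by apply: nearW => n; rewrite -ip_sqint// lee_fin hK.
have S : sqint mu D f.
  by apply/sqintP; split=> //; apply: le_lt_trans C _; rewrite ltry.
by split=> //; rewrite -lee_fin ip_sqint.
Qed.

End MoreIntegration.

(** * Cutoffs of small Dirichlet integral *)

Section Cutoff.
Context {R : realType}.
Local Notation R2 := (measurableTypeR R * measurableTypeR R)%type.
Local Notation leb2 := (@leb2 R).
Local Notation H := (halfplane : set R2).
Implicit Types (r L : R).

(* Equal to [1] on [[- r, r]] and supported in [[- 2 * r, 2 * r]]. *)
Definition cut r (t : R) : R := bS (t / (r / 3) + 6) - bS (t / (r / 3) + - 3).
Definition dcut r (t : R) : R :=
  bs (t / (r / 3) + 6) / (r / 3) - bs (t / (r / 3) + - 3) / (r / 3).

Lemma is_derive_cut r (t : R) : is_derive t (1 : R) (cut r) (dcut r t).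
Proof.
exact: is_deriveB (scaled_derive _ _ _ is_derive_bS) (scaled_derive _ _ _ is_derive_bS).
Qed.

Lemma dcut_cont r : continuous (dcut r).
Proof.
have C (c : R) : continuous (fun t : R => bs (t / (r / 3) + c) / (r / 3)).
  move=> t; apply: cvgM; last exact: cvg_cst.
  apply: (@continuous_comp _ _ _ (fun t : R => t / (r / 3) + c) bs); last exact: bs_cont.
  by apply: cvgD; [apply: cvgM; [exact: cvg_id|exact: cvg_cst]|exact: cvg_cst].
by move=> t; apply: cvgB; exact: C.
Qed.

Lemma cutP r t : 0 < r -> [/\ 0 <= cut r t <= 1, `|t| <= r -> cut r t = 1 /\ dcut r t = 0,
  ~~ (`|t| <= 2 * r) -> cut r t = 0 & `|dcut r t| <= 3 / r].
Proof.
move=> r0; rewrite /cut /dcut; set q := t / (r / 3).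
have tq : t = q * (r / 3) by rewrite /q divfK// gt_eqF// divr_gt0.
have i0 : 0 < (r / 3)^-1 by rewrite invr_gt0 divr_gt0.
have i3 : (r / 3)^-1 = 3 / r by rewrite invf_div.
split.
- have [q0|q0] := leP q 3.
    by have [_ _ ->] := @bs_lo R (q + -3) ltac:(lra); have [_ _] := bs_bounds (q + 6); lra.
  by have [_ _ ->] := @bs_hi R (q + 6) ltac:(lra); have [_ _] := bs_bounds (q + -3); lra.
- rewrite tq ler_norml => /andP[h1 h2].
  have q1 : - 3 <= q by nra.
  have q2 : q <= 3 by nra.
  have [-> _ ->] := @bs_hi R (q + 6) ltac:(lra).
  have [-> _ ->] := @bs_lo R (q + -3) ltac:(lra).
  by rewrite !mul0r !subr0.
- rewrite tq ler_norml negb_and -!ltNge => /orP[h|h].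
    have q1 : q < - 6 by nra.
    have [_ _ ->] := @bs_lo R (q + 6) ltac:(lra).
    by have [_ _ ->] := @bs_lo R (q + -3) ltac:(lra); rewrite subrr.
  have q1 : 6 < q by nra.
  have [_ _ ->] := @bs_hi R (q + 6) ltac:(lra).
  by have [_ _ ->] := @bs_hi R (q + -3) ltac:(lra); rewrite subrr.
- have [a _ _] := bs_bounds (q + 6); have [b _ _] := bs_bounds (q + -3).
  rewrite -mulrBl normrM (gtr0_norm i0) i3 ler_piMl//; first by rewrite divr_ge0// ltW.
  by rewrite ler_norml; lra.
Qed.

Lemma leb2_box L : 0 <= L -> leb2 (box L) = (4 * L ^+ 2)%:E.
Proof.
move=> L0; have h : (@lebesgue_measure R `[(- L)%R, L]%classic = (2 * L)%:E)%E.
  rewrite lebesgue_measure_itv/= lte_fin; case: ltP => h; first by rewrite -EFinB; congr EFin; ring.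
  by congr EFin; lra.
rewrite boxE [LHS]product_measure1E ?measurable_itv// [X in (X * _)%E]h [X in (_ * X)%E]h -EFinM.
by congr EFin; ring.
Qed.

Lemma ip_bounded_box f (L K : R) : 0 <= L -> measurable_fun setT (f : R2 -> R) -> vanish L f ->
  (forall x, `|f x| <= K) -> ip leb2 H f f <= K ^+ 2 * (4 * L ^+ 2).
Proof.
move=> L0 mf v hK; have K0 : 0 <= K := le_trans (normr_ge0 _) (hK (0, 0)).
rewrite ipE (@Rintegral_sub _ _ _ leb2 H (H `&` box L)); last 2 first.
- by move=> x [].
- by move=> x Hx nx; rewrite v ?mulr0// => bx; apply: nx.
have IK : leb2.-integrable (H `&` box L) (EFin \o cst (K ^+ 2)).
  apply: (@integrable_box R _ _ L (K ^+ 2)) => // [x [_ b] nb|x _ _]; first by case: nb.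
  by rewrite ger0_norm ?sqr_ge0.
have ff x : f x * f x <= K ^+ 2.
  by rewrite -expr2 -real_normK ?num_real// ler_sqr ?nnegrE.
apply: (@le_trans _ _ (\int[leb2]_(x in H `&` box L) (K ^+ 2))).
  apply: le_Rintegral => //.
  apply: (@integrable_box R _ _ L (K ^+ 2)) => //.
  - by apply: measurable_funTS; exact: measurable_funM.
  - by move=> x [_ b] nb; case: nb.
  - by move=> x _ _; rewrite ger0_norm -?expr2 ?sqr_ge0// expr2.
rewrite Rintegral_cst// ler_wpM2l ?sqr_ge0//.
rewrite -lee_fin fineK.
  by rewrite -leb2_box//; apply: le_measure; rewrite ?inE// => x [].
rewrite ge0_fin_numE//; apply: le_lt_trans (box_lty L).
by apply: le_measure; rewrite ?inE// => x [].
Qed.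

Lemma cutoff r : 1 <= r -> exists chi chi1 chi2, [/\ C1g chi chi1 chi2, vanish (2 * r) chi,
  forall x, 0 <= chi x <= 1, forall x, box r x -> [/\ chi x = 1, chi1 x = 0 & chi2 x = 0] &
  ip leb2 H chi1 chi1 <= 144 /\ ip leb2 H chi2 chi2 <= 144].
Proof.
move=> r1; have r0 : 0 < r by lra.
have C := C1g_prod (is_derive_cut r) (@dcut_cont r) (is_derive_cut r) (@dcut_cont r).
have v : vanish (2 * r) (fun x => cut r x.1 * cut r x.2).
  move=> x nx; have [_ _ z1 _] := cutP x.1 r0; have [_ _ z2 _] := cutP x.2 r0.
  have [h1|/z1 ->] := boolP (`|x.1| <= 2 * r); last by rewrite mul0r.
  have [h2|/z2 ->] := boolP (`|x.2| <= 2 * r); last by rewrite mulr0.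
  by case: nx.
do 3 eexists; split; [exact: C|exact: v| | |].
- move=> x; have [/andP[a b] _ _ _] := cutP x.1 r0; have [/andP[c e] _ _ _] := cutP x.2 r0.
  by rewrite mulr_ge0//= mulr_ile1.
- move=> x [b1 b2]; have [_ /(_ b1)[-> ->] _ _] := cutP x.1 r0.
  by have [_ /(_ b2)[-> ->] _ _] := cutP x.2 r0; rewrite !mulr0 !mul0r mulr1.
have [v1 v2] := vanish_d C v; have [_ c1 c2] := C.
have E : (3 / r) ^+ 2 * (4 * (2 * r) ^+ 2) = 144 by field; rewrite gt_eqF.
have cb t : `|cut r t| <= 1 by have [/andP[a b] _ _ _] := cutP t r0; rewrite ger0_norm.
have db t : `|dcut r t| <= 3 / r by have [_ _ _] := cutP t r0.
have t0 : 0 <= 3 / r by rewrite divr_ge0// ltW.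
split; rewrite -E; apply: ip_bounded_box => //; try lra.
- exact: continuous_measurable_fun2.
- by move=> x; rewrite normrM -[leRHS]mulr1; apply: ler_pM.
- exact: continuous_measurable_fun2.
- by move=> x; rewrite normrM -[leRHS]mul1r; apply: ler_pM.
Qed.

Lemma ipD_disjoint f g (L : R) : continuous f -> continuous g -> vanish L f -> vanish L g ->
  (forall x, f x * g x = 0) ->
  ip leb2 H (fun x => f x + g x) (fun x => f x + g x) = ip leb2 H f f + ip leb2 H g g.
Proof.
move=> cf cg vf vg fg.
have sf := cont_sqint (@measurable_halfplane R) cf vf.
have sg := cont_sqint (@measurable_halfplane R) cg vg.
rewrite ipDl ?ipDr//; try exact: sqintD.
rewrite [ip leb2 H g f]ipC.
have -> : ip leb2 H f g = 0 by rewrite ipE; apply: Rintegral0_eq.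
by rewrite addr0 add0r.
Qed.

Lemma cutoff_sum r (n : nat) : 1 <= r -> exists X X1 X2 L, [/\ C1g X X1 X2, vanish L X /\ r <= L,
  forall x, 0 <= X x <= n%:R, forall x, box r x -> X x = n%:R &
  ip leb2 H X1 X1 <= 144 * n%:R /\ ip leb2 H X2 X2 <= 144 * n%:R].
Proof.
move=> r1; elim: n => [|n [X [X1 [X2 [L [hX [vX rL] X01 Xr [i1 i2]]]]]]].
  exists (cst 0), (cst 0), (cst 0), r; split.
  - exact: C1g_cst.
  - by split.
  - by move=> x /=; rewrite lexx.
  - by [].
  - by split; rewrite mulr0 ipE Rintegral0_eq// => x _; rewrite mulr0.
have L1 : 1 <= L by lra.
have [chi [chi1 [chi2 [hc vc c01 cr [j1 j2]]]]] := cutoff L1.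
have [vX1 vX2] := vanish_d hX vX; have [vc1 vc2] := vanish_d hc vc.
have [_ cX1 cX2] := hX; have [_ cc1 cc2] := hc.
have L2 : L <= 2 * L by lra.
exists (fun x => X x + chi x), (fun x => X1 x + chi1 x), (fun x => X2 x + chi2 x), (2 * L); split.
- exact: C1gD.
- by split; [move=> x nx; rewrite vc// (vanishS L2 vX)// addr0|lra].
- by move=> x; rewrite -[n.+1%:R]natr1; have := X01 x; have := c01 x; lra.
- move=> x bx; rewrite -[n.+1%:R]natr1 Xr//; congr (_ + _).
  by have [] := cr x (sub_box rL bx).
- rewrite -[n.+1%:R]natr1 mulrDr mulr1; split; rewrite (@ipD_disjoint _ _ (2 * L))//.
  + exact: lerD.
  + exact: vanishS L2 vX1.
  + move=> x; have [b|b] := pselect (box L x); last by rewrite vX1// mul0r.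
    by have [_ -> _] := cr x b; rewrite mulr0.
  + exact: lerD.
  + exact: vanishS L2 vX2.
  + move=> x; have [b|b] := pselect (box L x); last by rewrite vX2// mul0r.
    by have [_ _ ->] := cr x b; rewrite mulr0.
Qed.

(* In the plane the capacity of a box vanishes: averaging cutoffs whose
   gradients live in disjoint annuli makes the Dirichlet integral small. *)
Lemma small_cutoff r (e : R) : 1 <= r -> 0 < e -> exists chi chi1 chi2 L,
  [/\ C1g chi chi1 chi2, vanish L chi, forall x, 0 <= chi x <= 1,
   forall x, box r x -> chi x = 1 & ip leb2 H chi1 chi1 <= e /\ ip leb2 H chi2 chi2 <= e].
Proof.
move=> r1 e0; have [m hm] := Rnat_bound (144 / e).
have [X [X1 [X2 [L [hX [vX rL] X01 Xr [i1 i2]]]]]] := cutoff_sum m.+1 r1.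
have n0 : 0 < m.+1%:R :> R by rewrite ltr0n.
pose k : R := m.+1%:R^-1; have k0 : 0 < k by rewrite invr_gt0.
have [vX1 vX2] := vanish_d hX vX; have [_ cX1 cX2] := hX.
have small f : continuous f -> vanish L f -> ip leb2 H f f <= 144 * m.+1%:R ->
    ip leb2 H (fun x => k * f x) (fun x => k * f x) <= e.
  move=> cf vf hf; have sf := cont_sqint (@measurable_halfplane R) cf vf.
  rewrite ipZl ?ipZr//; last exact: sqintZ.
  rewrite mulrA; apply: (@le_trans _ _ (k * k * (144 * m.+1%:R))).
    by rewrite ler_wpM2l// mulr_ge0// ltW.
  have -> : k * k * (144 * m.+1%:R) = 144 / m.+1%:R by rewrite /k; field; rewrite gt_eqF.
  rewrite ler_pdivrMr// mulrC -ler_pdivrMr//; apply: le_trans hm _.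
  by rewrite ler_nat.
exists (fun x => k * X x), (fun x => k * X1 x), (fun x => k * X2 x), L; split.
- exact: C1gZ.
- by move=> x nx; rewrite vX// mulr0.
- move=> x; have /andP[a b] := X01 x; rewrite (mulr_ge0 (ltW k0) a)/=.
  by rewrite /k mulrC ler_pdivrMr// mul1r.
- by move=> x bx; rewrite Xr// /k mulVf// gt_eqF.
- by split; exact: small.
Qed.

End Cutoff.

Lemma cross_arith (R : realType) (a b c a' b' c' k : R) : a + b + k * c = 0 ->
  a' + b' + k * c' = - ((a - a') + (b - b') + k * (c - c')).
Proof. by move=> E; apply/eqP; rewrite -subr_eq0; apply/eqP; rewrite -[RHS]E; ring. Qed.

Lemma box_line (R : realType) (r s : R) : - r <= s <= r -> box r (s, 0).
Proof. by move=> hs; split; rewrite /= ?normr0 ?ler_norml//; lra. Qed.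

Lemma energy_arith (R : realType) (a b c A B C G m : R) : 0 <= a -> 0 <= b -> 0 <= c ->
  2^-1 * a - 2 * m <= A -> 2^-1 * b - 2 * m <= B -> c - G <= C -> A + B + C = 0 ->
  [/\ a <= 2 * (4 * m + G), b <= 2 * (4 * m + G) & c <= 4 * m + G].
Proof. by move=> *; split; lra. Qed.

Section FiniteEnergy.
Context {R : realType}.
Local Notation R2 := (measurableTypeR R * measurableTypeR R)%type.
Local Notation mu1 := (@leb1 R).
Local Notation leb2 := (@leb2 R).
Local Notation H := (halfplane : set R2).
Variables (eps : R) (heps : 0 < eps) (delta : R * R).
Variables (f p1 p2 : R * R -> R) (t : R -> R) (M M0 : R).
Hypothesis hf : H1d f p1 p2 t.
Hypothesis hJ : forall psi psi1 psi2 L, C1g psi psi1 psi2 -> vanish L psi ->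
  0 <= Jf eps delta p1 p2 t psi psi1 psi2.
Hypothesis fM : {ae leb2, forall x, H x -> `|f x - delta.2 * x.2| <= M}.

Local Notation u := (ang eps (eps * 0)).
Local Notation u1 := (ang1 eps (eps * 0)).
Local Notation u2 := (ang2 eps (eps * 0)).
Let d (x : R * R) : R := f x - profile eps delta 0 x.
Let d1 (x : R * R) : R := p1 x - u1 x.
Let d2 (x : R * R) : R := p2 x - (u2 x + delta.2).
Let db (s : R) : R := t s - u (s, 0).
Let S (s : R) : R := s2 (t s) - s2 (u (s, 0)).

Lemma H1d_diff : H1d d d1 d2 db.
Proof.
by apply: eq_H1d (H1dD (-1) hf (H1d_profile heps delta 0)) => x *; rewrite mulN1r.
Qed.

Lemma diff_bounded : {ae leb2, forall x, H x -> `|d x| <= M + pi}.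
Proof.
apply: (ae_imp fM) => x h Hx.
have -> : d x = (f x - delta.2 * x.2) - u x.
  by rewrite /d /profile /ang kfE ?ltW//; ring.
apply: le_trans (ler_normB _ _) _; rewrite lerD//; first exact: h.
by have /andP[a b] := ang_bound eps (eps * 0) x; rewrite gtr0_norm// ltW.
Qed.

Lemma EL_diff psi psi1 psi2 L : C1g psi psi1 psi2 -> vanish L psi ->
  \int[leb2]_(x in H) (d1 x * psi1 x + d2 x * psi2 x) +
    (2 * eps)^-1 * \int[mu1]_s (S s * psi (s, 0)) = 0.
Proof.
move=> hp v; have hu := H1d_profile heps delta 0.
have hJu := (minimizerP eps delta hu).1 (profile_minimizer heps delta 0).
have E1 := euler_lagrange hf heps hJ hp v.
have E2 := euler_lagrange hu heps hJu hp v.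
have [v1 v2] := vanish_d hp v; have cp := C1g_cont hp; have [_ cp1 cp2] := hp.
have I q1 q2 : loc2 q1 -> loc2 q2 ->
    leb2.-integrable H (EFin \o (fun x => (q1 x - delta.1) * psi1 x + (q2 x - delta.2) * psi2 x)).
  have lc (a : R) p : loc2 p -> loc2 (fun x => p x - a).
    by move=> lp; apply: (loc2D lp); apply: cont_loc2 => x; exact: cvg_cst.
  move=> l1 l2; have i1 := loc2_int (lc delta.1 _ l1) cp1 v1.
  by have i2 := loc2_int (lc delta.2 _ l2) cp2 v2; exact: integrableDr.
have [_ l1 l2 lt _ _] := hf; have [_ m1 m2 mt _ _] := hu.
have -> : \int[leb2]_(x in H) (d1 x * psi1 x + d2 x * psi2 x) =
    \int[leb2]_(x in H) ((p1 x - delta.1) * psi1 x + (p2 x - delta.2) * psi2 x) -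
    \int[leb2]_(x in H) ((u1 x - delta.1) * psi1 x + (u2 x + delta.2 - delta.2) * psi2 x).
  rewrite -RintegralB//; [|exact: I|exact: I].
  by apply: eq_Rintegral => x _; rewrite /d1 /d2; ring.
have -> : \int[mu1]_s (S s * psi (s, 0)) =
    \int[mu1]_s (s2 (t s) * psi (s, 0)) - \int[mu1]_s (s2 (u (s, 0)) * psi (s, 0)).
  rewrite -RintegralB//; [|exact: s2_line_int lt cp v|exact: s2_line_int mt cp v].
  by apply: eq_Rintegral => x _; rewrite /S; ring.
by rewrite mulrBr; lra.
Qed.

Lemma S_measurable : measurable_fun (setT : set (measurableTypeR R)) S.
Proof.
have [_ _ _ lt _ _] := hf; have [_ _ _ mt _ _] := H1d_profile heps delta 0.
by apply: measurable_funB; apply: measurable_s2; exact: loc1_measurable.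
Qed.

Lemma S_loc1 : loc1 S.
Proof.
move=> L; apply: (@sqint_le _ (measurableTypeR R) R mu1 _ _ (cst 4)) => //.
- by apply: measurable_funTS; exact: S_measurable.
- move=> s _; rewrite /S /= (ger0_norm (_ : 0 <= 4))//.
  apply: le_trans (ler_normB _ _) _.
  by have := s2_bound (t s); have := s2_bound (u (s, 0)); lra.
- have h : loc1 (cst 4 : R -> R) by apply: cont_loc1 => s; exact: cvg_cst.
  exact: h.
Qed.

Lemma ip_restr (D : set R2) p q : (forall x, H x -> ~ D x -> q x = 0) -> D `<=` H ->
  \int[leb2]_(x in H) (p x * q x) = ip leb2 D p q.
Proof.
by move=> h DH; rewrite ipE; apply: Rintegral_sub => // x Hx nx; rewrite h ?mulr0.
Qed.

(** Extends [EL_diff] to test functions that are merely Sobolev with bounded support, such as a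
    squared cutoff times [d]. The equation for a nearby [psi] turns the left-hand side into pairings
    with [psi - q], which Cauchy-Schwarz makes arbitrarily small. *)
Lemma EL_ext q q1 q2 qb L : H1d q q1 q2 qb ->
  (forall x, H x -> ~ box L x -> [/\ q x = 0, q1 x = 0 & q2 x = 0]) ->
  (forall s, ~~ (- L <= s <= L) -> qb s = 0) ->
  ip leb2 (H `&` box (L + 4)) d1 q1 + ip leb2 (H `&` box (L + 4)) d2 q2 +
    (2 * eps)^-1 * ip mu1 `[- (L + 4), L + 4] S qb = 0.
Proof.
move=> hq vq vb; set D := H `&` box (L + 4); set I := `[_, _]%classic.
have mD : measurable D := @measurable_Hbox R _; have mI : measurable (I : set (measurableTypeR R)) := measurable_itv _.
have [_ ld1 ld2 _ _ _] := H1d_diff; have [_ lq1 lq2 lqb _ _] := hq.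
have sd1 : sqint leb2 D d1 := ld1 _; have sd2 : sqint leb2 D d2 := ld2 _.
have sq1 : sqint leb2 D q1 := lq1 _; have sq2 : sqint leb2 D q2 := lq2 _.
have sS : sqint mu1 I S := S_loc1 _; have sqb : sqint mu1 I qb := lqb _.
set k := (2 * eps)^-1; set X := _ + _.
pose A := ip leb2 D d1 d1; pose B := ip leb2 D d2 d2; pose C := ip mu1 I S S.
have A0 : 0 <= A by exact: ip_ge0. have B0 : 0 <= B by exact: ip_ge0.
have C0 : 0 <= C by exact: ip_ge0.
(* The factor 3 comes from bounding the square of a sum of three terms by three times the sum of
   squares; adding 1 keeps [K] positive. *)
pose K := 3 * (A + B + k ^+ 2 * C) + 1.
have K0 : 0 < K by rewrite /K; have := mulr_ge0 (sqr_ge0 k) C0; lra.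
apply/eqP; rewrite -sqrf_eq0; apply/eqP; apply: small_eq0; first exact: sqr_ge0.
move=> e e0; have eK : 0 < e / K by rewrite divr_gt0.
have [psi [psi1 [psi2 [hp v [_ h1 h2 hb]]]]] := density hq vq vb eK.
have [v1 v2] := vanish_d hp v; have cp := C1g_cont hp; have [_ cp1 cp2] := hp.
have mH := @measurable_halfplane R.
have DH : D `<=` H by move=> x [].
have nD x : H x -> ~ D x -> ~ box (L + 4) x by move=> Hx nx b; apply: nx.
have sp1 : sqint leb2 D psi1 := cont_sqint mD cp1 v1.
have sp2 : sqint leb2 D psi2 := cont_sqint mD cp2 v2.
have spb : sqint mu1 I (fun s => psi (s, 0)).
  exact: cont_sqint1 mI (continuous_slice1 (b := 0) cp) (fun s => vanish_line v (s := s)).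
have E := EL_diff hp v.
rewrite (Rintegral_split2 ld1 ld2 cp1 cp2 v1 v2) in E.
rewrite (ip_restr (D := D)) // in E; last by move=> x Hx nx; rewrite v1//; exact: nD.
rewrite (ip_restr (D := D)) // in E; last by move=> x Hx nx; rewrite v2//; exact: nD.
have Eb : \int[mu1]_s (S s * psi (s, 0)) = ip mu1 I S (fun s => psi (s, 0)).
  rewrite ipE; apply: Rintegral_sub => // s _ ns; rewrite (vanish_line v) ?mulr0//.
  by apply/negP => hs; apply: ns; rewrite /I/= in_itv.
rewrite Eb in E.
have XE : X = - (ip leb2 D d1 (fun x => psi1 x - q1 x) + ip leb2 D d2 (fun x => psi2 x - q2 x) +
    k * ip mu1 I S (fun s => psi (s, 0) - qb s)).
  rewrite !ipBr// /X; move: E; rewrite -/k; exact: cross_arith.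
have le1 : ip leb2 D d1 (fun x => psi1 x - q1 x) ^+ 2 <= A * (e / K).
  apply: le_trans (ip_cauchy mD sd1 (sqintB mD sp1 sq1)) _; rewrite ler_wpM2l//.
  apply: le_trans (ltW h1); apply: ip_subset => //; apply: sqintB => //.
    exact: cont_sqint cp1 v1.
  by apply: (loc2_vanish lq1) => x Hx nx; have [] := vq x Hx nx.
have le2 : ip leb2 D d2 (fun x => psi2 x - q2 x) ^+ 2 <= B * (e / K).
  apply: le_trans (ip_cauchy mD sd2 (sqintB mD sp2 sq2)) _; rewrite ler_wpM2l//.
  apply: le_trans (ltW h2); apply: ip_subset => //; apply: sqintB => //.
    exact: cont_sqint cp2 v2.
  by apply: (loc2_vanish lq2) => x Hx nx; have [] := vq x Hx nx.
have le3 : ip mu1 I S (fun s => psi (s, 0) - qb s) ^+ 2 <= C * (e / K).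
  apply: le_trans (ip_cauchy mI sS (sqintB mI spb sqb)) _; rewrite ler_wpM2l//.
  apply: le_trans (ltW hb); apply: ip_subset => //; apply: sqintB => //.
    exact: cont_sqint1 measurableT (continuous_slice1 (b := 0) cp) (fun s => vanish_line v (s := s)).
  apply: (@eq_sqint _ (measurableTypeR R) R mu1 setT (qb \_ `[- L, L]) qb) => //; last exact: loc1_patch.
  move=> s _; rewrite /patch; case: ifPn => // ns; rewrite vb//.
  by move: ns; rewrite notin_setE/= in_itv/= => /negP.
rewrite XE sqrrN; clear - K0 eK le1 le2 le3.
pose a := ip leb2 D d1 (fun x => psi1 x - q1 x); pose b := ip leb2 D d2 (fun x => psi2 x - q2 x).
pose c := ip mu1 I S (fun s => psi (s, 0) - qb s).
rewrite -/a in le1; rewrite -/b in le2; rewrite -/c in le3; rewrite -/a -/b -/c.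
have sq3 : (a + b + k * c) ^+ 2 <= 3 * (a ^+ 2 + b ^+ 2 + k ^+ 2 * c ^+ 2).
  rewrite -subr_ge0.
  have -> : 3 * (a ^+ 2 + b ^+ 2 + k ^+ 2 * c ^+ 2) - (a + b + k * c) ^+ 2 =
    (a - b) ^+ 2 + (a - k * c) ^+ 2 + (b - k * c) ^+ 2 by ring.
  by rewrite !addr_ge0 ?sqr_ge0.
apply: le_lt_trans sq3 _.
have le4 : k ^+ 2 * c ^+ 2 <= k ^+ 2 * (C * (e / K)) by rewrite ler_wpM2l// sqr_ge0.
have -> : e = K * (e / K) by rewrite mulrC divfK// gt_eqF.
have : 3 * (A * (e / K) + B * (e / K) + k ^+ 2 * (C * (e / K))) = (K - 1) * (e / K).
  by rewrite /K; ring.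
by move: (e / K) eK le1 le2 le4 => z eK le1 le2 le4; lra.
Qed.

Hypothesis tP : {ae mu1, forall s, M0 < s -> `|t s| <= 1 / 4}.
Hypothesis tN : {ae mu1, forall s, s < - M0 -> `|t s - pi| <= 1 / 4}.
Hypothesis uP : forall s, M0 < s -> `|u (s, 0)| <= 1 / 4.
Hypothesis uN : forall s, s < - M0 -> `|u (s, 0) - pi| <= 1 / 4.

Let db0 : R -> R := db \_ `[- M0, M0].
(** Defect of convexity: between [- M0] and [M0] the traces may be far from the wells, and there
    only [S * db >= - 4 * |db|] is available. It is integrable because [db0] is cut off to that
    interval. *)
Let g (s : R) : R := 4 * `|db0 s| + db0 s ^+ 2.

Lemma g_integrable : mu1.-integrable setT (EFin \o g).
Proof.
have [_ _ _ ldb _ _] := H1d_diff; have sdb := loc1_patch M0 ldb.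
have s1 : sqint mu1 setT (\1_(`[- M0, M0]%classic : set (measurableTypeR R))).
  by apply: sqint_indic => //; exact: leb1_bnd.
have i := sqint_int measurableT sdb s1.
apply: integrableDr => //; last by case: sdb.
apply: integrableZr' => //.
have := integrable_norm i; congr (_.-integrable _ _); apply/funext => s /=.
rewrite /db0 /patch indicE; case: (s \in _); first by rewrite mulr1.
by rewrite mulr0.
Qed.

Lemma S_db_lower : {ae mu1, forall s, db s ^+ 2 - g s <= S s * db s}.
Proof.
apply: (ae_imp2 tP tN) => s hP hN.
have [sP|sP] := ltP M0 s.
  have g0 : 0 <= g s by rewrite /g addr_ge0 ?sqr_ge0// mulr_ge0.
  by have := s2_mono0 (uP sP) (hP sP); rewrite -/(db s) -/(S s); lra.
have [sN|sN] := ltP s (- M0).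
  have g0 : 0 <= g s by rewrite /g addr_ge0 ?sqr_ge0// mulr_ge0.
  by have := s2_monopi (uN sN) (hN sN); rewrite -/(db s) -/(S s); lra.
have -> : g s = 4 * `|db s| + db s ^+ 2.
  by rewrite /g /db0 /patch mem_set//= in_itv/= sN sP.
have : `|S s * db s| <= 4 * `|db s|.
  rewrite normrM ler_wpM2r// /S; apply: le_trans (ler_normB _ _) _.
  by have := s2_bound (t s); have := s2_bound (u (s, 0)); lra.
by rewrite ler_norml => /andP[h _]; lra.
Qed.

Let k : R := (2 * eps)^-1.
Let K : R := 4 * (M + pi) ^+ 2 + k * \int[mu1]_s g s.

(** Caccioppoli's estimate. With [a = chi * q] and [b = chi1 * d] the pairing is [|a|^2 + 2 <a, b>],
    and Young's inequality absorbs half of [|a|^2]. *)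
Lemma ip_cross (D : set R2) q (chi chi1 : R * R -> R) : measurable D ->
  sqint leb2 D (fun x => chi x * q x) -> sqint leb2 D (fun x => chi1 x * d x) ->
  2^-1 * ip leb2 D (fun x => chi x * q x) (fun x => chi x * q x) -
    2 * ip leb2 D (fun x => chi1 x * d x) (fun x => chi1 x * d x) <=
  ip leb2 D q (fun x => chi x * chi x * q x + (chi x * chi1 x + chi x * chi1 x) * d x).
Proof.
move=> mD sa sb; set a := (fun x => chi x * q x) in sa *; set b := (fun x => chi1 x * d x) in sb *.
have -> : ip leb2 D q (fun x => chi x * chi x * q x + (chi x * chi1 x + chi x * chi1 x) * d x) =
   ip leb2 D a (fun x => a x + 2 * b x).
  by rewrite !ipE; apply: eq_Rintegral => x _; rewrite /a /b; ring.
rewrite ipDr ?ipZr//; last exact: sqintZ.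
have h2 : 0 < 2^-1 :> R by [].
have := ip_young mD (sqintZ (-1) mD sa) sb h2.
by rewrite invrK ipZl ?ipZr ?ipZl//; try exact: sqintZ; lra.
Qed.

(** The equation for the difference is tested against [chi * chi * d]. The bound [M + pi] on [d] and
    a Dirichlet bound 1 for [chi], the same for all [r], make the cross terms uniform; the boundary
    term is coercive up to the integral of [g]. Hence [K] does not depend on [r]. *)
Lemma energy_bound r : 1 <= r ->
  [/\ ip leb2 (H `&` box r) d1 d1 <= 2 * K, ip leb2 (H `&` box r) d2 d2 <= 2 * K &
    ip mu1 `[- r, r] db db <= 2 * eps * K].
Proof.
move=> r1; have [chi [chi1 [chi2 [L [hc vc c01 cr [i1 i2]]]]]] := small_cutoff r1 ltr01.
have cc := C1g_cont hc; have [_ cc1 cc2] := hc; have [vc1 vc2] := vanish_d hc vc.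
have hd := H1d_diff; have [ld ld1 ld2 ldb _ _] := hd.
have hq := H1d_mul (C1gM hc hc) hd.
have vq x : H x -> ~ box L x -> [/\ chi x * chi x * d x = 0,
    chi x * chi x * d1 x + (chi x * chi1 x + chi x * chi1 x) * d x = 0 &
    chi x * chi x * d2 x + (chi x * chi2 x + chi x * chi2 x) * d x = 0].
  by move=> _ nx; rewrite vc// !(mul0r, addr0).
have vb s : ~~ (- L <= s <= L) -> chi (s, 0) * chi (s, 0) * db s = 0.
  by move=> ns; rewrite (vanish_line vc ns) !mul0r.
have := EL_ext hq vq vb.
set D := H `&` box (L + 4); set I := `[_, _]%classic; rewrite -/k => E.
have mD : measurable D := @measurable_Hbox R _; have mI : measurable (I : set (measurableTypeR R)) := measurable_itv _.
have bL x : box r x -> box L x.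
  move=> bx; apply/not_notP => nx; have := cr x bx; rewrite vc// => /eqP.
  by rewrite eq_sym oner_eq0.
have bL4 x : box r x -> box (L + 4) x by move/bL; apply: sub_box; lra.
have core q qi chii : loc2 q -> continuous chii -> vanish L chii -> ip leb2 H chii chii <= 1 ->
   qi = (fun x => chi x * chi x * q x + (chi x * chii x + chi x * chii x) * d x) ->
   2^-1 * ip leb2 (H `&` box r) q q - 2 * (M + pi) ^+ 2 <= ip leb2 D q qi.
  move=> lq ci vi ii ->; have sa : sqint leb2 D (fun x => chi x * q x) := loc2_cM cc lq _.
  have sb : sqint leb2 D (fun x => chii x * d x) := loc2_cM ci ld _.
  apply: le_trans (ip_cross mD sa sb); apply: lerB.
    rewrite ler_pM2l ?invr_gt0//.
    have -> : ip leb2 (H `&` box r) q q = ip leb2 (H `&` box r) (fun x => chi x * q x) (fun x => chi x * q x).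
      have Q : {in (H `&` box r : set R2), q =1 (fun x => chi x * q x)}.
        by move=> x /set_mem[_ bx]; rewrite cr// mul1r.
      exact: eq_ip.
    by apply: ip_subset => // x [Hx /bL4].
  rewrite ler_pM2l//.
  have si : sqint leb2 D chii := cont_sqint mD ci vi.
  have siH : sqint leb2 H chii := cont_sqint (@measurable_halfplane R) ci vi.
  apply: (@le_trans _ _ (ip leb2 D (fun x => (M + pi) * chii x) (fun x => (M + pi) * chii x))).
    apply: ae_ip_le => //; first exact: sqintZ.
    apply: (ae_imp diff_bounded) => x h [Hx _]; rewrite mulrC !normrM ler_wpM2r//.
    by apply: le_trans (h Hx) _; exact: ler_norm.
  rewrite ipZl ?ipZr//; last exact: sqintZ.
  rewrite mulrA -expr2 -[leRHS]mulr1 ler_wpM2l ?sqr_ge0//.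
  by apply: le_trans ii; apply: ip_subset => // x [].
have e1 := core d1 _ chi1 ld1 cc1 vc1 i1 erefl; have e2 := core d2 _ chi2 ld2 cc2 vc2 i2 erefl.
have k0 : 0 < k by rewrite /k invr_gt0 mulr_gt0.
have G := g_integrable.
have GI : mu1.-integrable I (EFin \o g) by apply: (@integrableS _ (measurableTypeR R) R mu1 setT I).
have g0 s : 0 <= g s by rewrite /g addr_ge0 ?sqr_ge0// mulr_ge0.
have cb := continuous_slice1 (b := 0) cc.
have sqb : sqint mu1 I (fun s => chi (s, 0) * db s) := loc1_cM cb ldb _.
have sqq : sqint mu1 I (fun s => chi (s, 0) * chi (s, 0) * db s).
  exact: loc1_cM (fun s => cvgM (cb s) (cb s)) ldb _.
have eb : ip mu1 `[- r, r] db db - \int[mu1]_s g s <=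
    ip mu1 I S (fun s => chi (s, 0) * chi (s, 0) * db s).
  apply: (@le_trans _ _ (ip mu1 I (fun s => chi (s, 0) * db s) (fun s => chi (s, 0) * db s) -
      \int[mu1]_(s in I) g s)).
    apply: lerB.
      have -> : ip mu1 `[- r, r] db db = ip mu1 `[- r, r] (fun s => chi (s, 0) * db s) (fun s => chi (s, 0) * db s).
        have Q : {in (`[- r, r]%classic : set (measurableTypeR R)), db =1 (fun s => chi (s, 0) * db s)}.
          move=> s /set_mem/=; rewrite in_itv/= => hs; rewrite cr ?mul1r//.
          exact: box_line hs.
        exact: eq_ip.
      apply: ip_subset => // s /=; rewrite in_itv/= => hs.
      have /bL4 [] := box_line hs.
      by rewrite /I/= in_itv/= ler_norml.
    rewrite [leLHS]Rintegral_mkcond; apply: le_Rintegral => //.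
      exact: integrable_patch.
    by move=> s _; rewrite /patch; case: ifP.
  rewrite !ipE -RintegralB//; last exact: sqint_int.
  apply: ae_le_Rintegral => //.
  - by apply: integrableBr => //; exact: sqint_int.
  - by apply: sqint_int => //; exact: S_loc1.
  - apply: (ae_imp S_db_lower) => s h _.
    have /andP[a b] := c01 (s, 0); set c := chi (s, 0) in a b *.
    have c2 : c * c <= 1 by rewrite mulr_ile1.
    have c20 : 0 <= c * c by rewrite mulr_ge0.
    have h1 : c * c * (db s ^+ 2 - g s) <= c * c * (S s * db s) by rewrite ler_wpM2l.
    have h2 : c * c * g s <= g s by rewrite ler_piMl.
    have -> : S s * (c * c * db s) = c * c * (S s * db s) by ring.
    apply: le_trans h1; rewrite [leRHS]mulrBr.
    have -> : c * db s * (c * db s) = c * c * db s ^+ 2 by ring.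
    by rewrite lerD2l lerN2.
have keb := ler_wpM2l (ltW k0) eb; rewrite mulrBr in keb.
have P1 := ip_ge0 leb2 (H `&` box r) d1; have P2 := ip_ge0 leb2 (H `&` box r) d2.
have P3 := mulr_ge0 (ltW k0) (ip_ge0 mu1 `[- r, r] db).
have [b1 b2 b3] := energy_arith P1 P2 P3 e1 e2 keb E.
split=> //.
have -> : ip mu1 `[- r, r] db db = 2 * eps * (k * ip mu1 `[- r, r] db db).
  by rewrite mulrA mulfV ?mul1r// gt_eqF// mulr_gt0.
by rewrite ler_pM2l ?mulr_gt0.
Qed.

Lemma finite_energy : [/\ sqint leb2 H d1, sqint leb2 H d2 & sqint mu1 setT db].
Proof.
have [_ ld1 ld2 ldb _ _] := H1d_diff.
(* The boxes start at size 1 because [energy_bound] asks for [1 <= r]. *)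
have HE : H = \bigcup_n (H `&` box n.+1%:R).
  apply/seteqP; split=> [x Hx|x [n _ []]//].
  have [m hm] := Rnat_bound (`|x.1| + `|x.2|); exists m => //; split=> //.
  by apply: sub_box (in_box x); apply: le_trans hm _; rewrite ler_nat.
have n1 n : 1 <= n.+1%:R :> R by rewrite ler1n.
have ss n : (H `&` box n.+1%:R : set R2) `<=` H `&` box n.+2%:R.
  by move=> x [Hx b]; split=> //; apply: sub_box b; rewrite ler_nat.
split.
- by have [] := sqint_exhaust (@measurable_halfplane R) (fun n => @measurable_Hbox R n.+1%:R)
    ss HE (fun n => ld1 n.+1%:R) (fun n => let: And3 a _ _ := energy_bound (n1 n) in a).
- by have [] := sqint_exhaust (@measurable_halfplane R) (fun n => @measurable_Hbox R n.+1%:R)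
    ss HE (fun n => ld2 n.+1%:R) (fun n => let: And3 _ a _ := energy_bound (n1 n) in a).
- pose F n : set (measurableTypeR R) := `[- n.+1%:R, n.+1%:R]%classic.
  have TE : setT = \bigcup_n F n.
    apply/seteqP; split=> // s _; have [m hm] := Rnat_bound `|s|.
    exists m => //; rewrite /F/= in_itv/= -ler_norml; apply: le_trans hm _.
    by rewrite ler_nat.
  have FF n : F n `<=` F n.+1.
    move=> s; rewrite /F/= !in_itv/= -!ler_norml => h; apply: le_trans h _.
    by rewrite ler_nat.
  by have [] := sqint_exhaust measurableT (F := F) (fun n => measurable_itv _) FF TE
    (fun n => ldb n.+1%:R) (fun n => let: And3 _ _ a := energy_bound (n1 n) in a).
Qed.

End FiniteEnergy.

(** * The first order system *)

Section FiniteEnergyApproximation.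
Context {R : realType}.
Local Notation R2 := (measurableTypeR R * measurableTypeR R)%type.
Local Notation mu1 := (@leb1 R).
Local Notation leb2 := (@leb2 R).
Local Notation H := (halfplane : set R2).

(** A cutoff [c] equal to 1 on [F n] does no worse than the indicator of [F n], to which dominated
    convergence applies. The rank [N] is thus independent of [c], which is chosen only
    afterwards. *)
Lemma tail_small d (T : measurableType d) (mu : {measure set T -> \bar R}) (D : set T)
    (F : nat -> set T) (f : T -> R) (e : R) : measurable D -> (forall n, measurable (F n)) ->
  (forall x, exists N, forall n, (N <= n)%N -> F n x) -> sqint mu D f -> 0 < e ->
  exists N, forall n, (N <= n)%N -> forall c : T -> R, measurable_fun D c ->
    (forall x, 0 <= c x <= 1) -> (forall x, F n x -> c x = 1) ->
    ip mu D (fun x => c x * f x - f x) (fun x => c x * f x - f x) < e.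
Proof.
move=> mD mF hF Sf e0; have mf : measurable_fun D f by case: Sf.
have Sn : sqint mu D (fun x => `|f x|).
  by apply: (sqint_le mD _ _ Sf); [exact: measurableT_comp|move=> x _; rewrite normr_id].
have mfn n : measurable_fun D (f \_ (F n)).
  by apply/measurable_restrict => //; apply: measurable_funS mf => // x [].
have cv x : D x -> (fun n => (f \_ (F n)) x) @ \oo --> f x.
  move=> _; have [N hN] := hF x; apply: cvg_near_cst.
  by exists N => // n /= /hN Fx; rewrite /patch mem_set.
have le1 n x : D x -> `|(f \_ (F n)) x - f x| <= `|f x|.
  by move=> _; rewrite /patch; case: ifP => _; rewrite ?subrr ?normr0// sub0r normrN.
have [N hN] := sq_dct mD mfn mf Sn cv le1 e0.
exists N => n Nn c mc c01 c1; apply: le_lt_trans (hN n Nn).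
have cS : sqint mu D (fun x => c x * f x).
  by apply: (@sqint_bM _ _ _ mu D 1 c f) => // x _; have /andP[a b] := c01 x; rewrite ger0_norm.
apply: ip_le => //.
- exact: sqintB.
- apply: sqintB => //; apply: (sqint_le mD (mfn n) _ Sf) => x _.
  by rewrite /patch; case: ifP => // _; rewrite normr0.
- move=> x _; rewrite /patch; have [Fx|nFx] := pselect (F n x).
    by rewrite mem_set// c1// mul1r subrr normr0.
  rewrite memNset// sub0r normrN -{2}[f x]mul1r -mulrBl normrM ler_piMl//.
  by have /andP[a b] := c01 x; rewrite ler_norml; lra.
Qed.

(** Cut [d] off, then apply [density]. As [d] is only bounded, the term [chi1 * d] in the gradient
    is small because the capacity of the cutoff is, and [d] itself is approximated in L^2 on a box
    only. *)
Lemma finite_energy_density (d d1 d2 : R * R -> R) (db : R -> R) (D e r : R) :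
  H1d d d1 d2 db -> {ae leb2, forall x, H x -> `|d x| <= D} ->
  sqint leb2 H d1 -> sqint leb2 H d2 -> sqint mu1 setT db -> 0 < e -> 1 <= r ->
  exists psi psi1 psi2 L, [/\ C1g psi psi1 psi2, vanish L psi &
   [/\ ip leb2 H (fun x => psi1 x - d1 x) (fun x => psi1 x - d1 x) < e,
      ip leb2 H (fun x => psi2 x - d2 x) (fun x => psi2 x - d2 x) < e,
      ip mu1 setT (fun s => psi (s, 0) - db s) (fun s => psi (s, 0) - db s) < e &
      ip leb2 (H `&` box r) (fun x => psi x - d x) (fun x => psi x - d x) < e]].
Proof.
move=> hd dD s1 s2 sb e0 r1.
have mH := @measurable_halfplane R.
have e16 : 0 < e / 16 by lra.
have boxx (x : R2) : exists N, forall n, (N <= n)%N -> box n.+1%:R x.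
  have [m hm] := Rnat_bound (`|x.1| + `|x.2|); exists m => n mn.
  by apply: sub_box (in_box x); apply: le_trans hm _; rewrite ler_nat leqW.
have linex (s : measurableTypeR R) : exists N, forall n, (N <= n)%N -> `[- n.+1%:R, n.+1%:R]%classic s.
  have [m hm] := Rnat_bound `|s|; exists m => n mn; rewrite /= in_itv/= -ler_norml.
  by apply: le_trans hm _; rewrite ler_nat leqW.
have mB n : measurable (box n.+1%:R : set R2) by exact: measurable_box.
have mI n : measurable (`[- n.+1%:R, n.+1%:R]%classic : set (measurableTypeR R)) := measurable_itv _.
have [N1 h1] := tail_small mH mB boxx s1 e16.
have [N2 h2] := tail_small mH mB boxx s2 e16.
have [N3 h3] := tail_small measurableT mI linex sb e16.
have [N4 h4] := Rnat_bound r.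
pose n := maxn N1 (maxn N2 (maxn N3 N4)).
have n1 : (N1 <= n)%N by rewrite /n !leq_max leqnn.
have n2 : (N2 <= n)%N by rewrite /n !leq_max leqnn !orbT.
have n3 : (N3 <= n)%N by rewrite /n !leq_max leqnn !orbT.
have n4 : (N4 <= n)%N by rewrite /n !leq_max leqnn !orbT.
have D1 : 0 < 16 * (D ^+ 2 + 1) by rewrite mulr_gt0// ltr_wpDl ?sqr_ge0.
have eD : 0 < e / (16 * (D ^+ 2 + 1)) by rewrite divr_gt0.
have rn : r <= n.+1%:R by apply: le_trans h4 _; rewrite ler_nat leqW.
have [chi [chi1 [chi2 [L [hc vc c01 cr [i1 i2]]]]]] := small_cutoff (le_trans r1 rn) eD.
have cc := C1g_cont hc; have [_ cc1 cc2] := hc; have [vc1 vc2] := vanish_d hc vc.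
have hq := H1d_mul hc hd; have [ld ld1 ld2 ldb _ _] := hd; have [lq lq1 lq2 lqb _ _] := hq.
have vq x : H x -> ~ box L x -> [/\ chi x * d x = 0,
    chi x * d1 x + chi1 x * d x = 0 & chi x * d2 x + chi2 x * d x = 0].
  by move=> _ nx; rewrite vc// vc1// vc2// !mul0r addr0.
have vb s : ~~ (- L <= s <= L) -> chi (s, 0) * db s = 0.
  by move=> ns; rewrite (vanish_line vc ns) mul0r.
have [psi [psi1 [psi2 [hp v [k0 k1 k2 kb]]]]] := density hq vq vb e16.
have [v1 v2] := vanish_d hp v; have cp := C1g_cont hp; have [_ cp1 cp2] := hp.
have sp1 := cont_sqint mH cp1 v1; have sp2 := cont_sqint mH cp2 v2; have sp := cont_sqint mH cp v.
have mc : measurable_fun H chi.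
  by apply: measurable_funTS; exact: continuous_measurable_fun2.
(* Three errors of squared norm at most [e / 16]: approximation of the cut function, truncation of
   the gradient, and gradient of the cutoff. Two uses of [ipD_le] weight them by 2, 4 and 4. *)
have grad q chii psii : sqint leb2 H q -> continuous chii -> vanish L chii -> sqint leb2 H psii ->
   ip leb2 H chii chii <= e / (16 * (D ^+ 2 + 1)) ->
   ip leb2 H (fun x => chi x * q x - q x) (fun x => chi x * q x - q x) < e / 16 ->
   ip leb2 H (fun x => psii x - (chi x * q x + chii x * d x))
     (fun x => psii x - (chi x * q x + chii x * d x)) < e / 16 ->
   ip leb2 H (fun x => psii x - q x) (fun x => psii x - q x) < e.
  move=> sq ci vi sp' ii ta de.
  have sd : sqint leb2 H (fun x => chii x * d x).
    by apply: (@loc2_vanish R L); [exact: loc2_cM|move=> x _ nx; rewrite vi// mul0r].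
  have scq : sqint leb2 H (fun x => chi x * q x).
    by apply: (@sqint_bM _ _ _ leb2 H 1 chi q) => // x _; have /andP[a b] := c01 x; rewrite ger0_norm.
  have si := cont_sqint mH ci vi.
  have id : ip leb2 H (fun x => chii x * d x) (fun x => chii x * d x) <= e / 16.
    apply: (@le_trans _ _ (ip leb2 H (fun x => D * chii x) (fun x => D * chii x))).
      apply: ae_ip_le => //; first exact: sqintZ.
      apply: (ae_imp dD) => x h Hx; rewrite mulrC !normrM ler_wpM2r//.
      by apply: le_trans (h Hx) _; exact: ler_norm.
    rewrite ipZl ?ipZr//; last exact: sqintZ.
    rewrite mulrA -expr2; apply: (@le_trans _ _ (D ^+ 2 * (e / (16 * (D ^+ 2 + 1))))).
      by rewrite ler_wpM2l// sqr_ge0.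
    have -> : e / 16 = (D ^+ 2 + 1) * (e / (16 * (D ^+ 2 + 1))).
      by field; rewrite gt_eqF// ltr_wpDl ?sqr_ge0.
    by rewrite ler_wpM2r ?lerDl//; exact: ltW.
  have -> : (fun x => psii x - q x) = (fun x => (psii x - (chi x * q x + chii x * d x)) +
      ((chi x * q x - q x) + chii x * d x)) by apply/funext => x; ring.
  have sA : sqint leb2 H (fun x => psii x - (chi x * q x + chii x * d x)).
    by apply: sqintB => //; exact: sqintD.
  have sB : sqint leb2 H (fun x => chi x * q x - q x) by exact: sqintB.
  apply: le_lt_trans (ipD_le mH sA (sqintD mH sB sd)) _.
  have hB := ipD_le mH sB sd.
  move: (ip _ _ _ _) (ip _ _ _ _) (ip _ _ _ _) (ip _ _ _ _) ta de id hB => a b c c' ta de id hB.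
  by clear - e0 ta de id hB; lra.
exists psi, psi1, psi2, (L + 4); split=> //; split.
- exact: (grad d1 chi1 psi1 s1 cc1 vc1 sp1 i1 (h1 n n1 chi mc c01 cr) k1).
- exact: (grad d2 chi2 psi2 s2 cc2 vc2 sp2 i2 (h2 n n2 chi mc c01 cr) k2).
- have scb : sqint mu1 setT (fun s => chi (s, 0) * db s).
    apply: (@sqint_bM _ (measurableTypeR R) _ mu1 setT 1 (fun s => chi (s, 0)) db) => //.
      by apply: continuous_measurable_fun; exact: continuous_slice1.
    by move=> s _; have /andP[a b] := c01 (s, 0); rewrite ger0_norm.
  have tb := h3 n n3 (fun s => chi (s, 0)) (continuous_measurable_fun (continuous_slice1 (b := 0) cc))
    (fun s => c01 (s, 0)).
  have {}tb := tb _.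
  have -> : (fun s => psi (s, 0) - db s) = (fun s => (psi (s, 0) - chi (s, 0) * db s) +
      (chi (s, 0) * db s - db s)) by apply/funext => s; ring.
  have spb : sqint mu1 setT (fun s => psi (s, 0)).
    exact: cont_sqint1 measurableT (continuous_slice1 (b := 0) cp) (fun s => vanish_line v (s := s)).
  apply: le_lt_trans (ipD_le measurableT (sqintB measurableT spb scb) (sqintB measurableT scb sb)) _.
  have {}tb : ip mu1 setT (fun s => chi (s, 0) * db s - db s) (fun s => chi (s, 0) * db s - db s) < e / 16.
    apply: tb => s; rewrite /= in_itv/= -ler_norml => hs; apply: cr.
    by split; rewrite /= ?normr0.
  move: (ip _ _ _ _) (ip _ _ _ _) tb kb => a b tb kb.
  by clear - e0 tb kb; lra.
- have Q : {in (H `&` box r : set R2), (fun x => psi x - d x) =1 (fun x => psi x - chi x * d x)}.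
    by move=> x /set_mem[_ bx]; rewrite cr ?mul1r//; exact: sub_box bx.
  rewrite (eq_ip _ Q Q); apply: (@le_lt_trans _ _ (e / 16)); last by clear - e0; lra.
  apply: le_trans (ltW k0); apply: ip_subset => //.
  apply: sqintB => //; apply: (@loc2_vanish R L _ lq) => x _ nx.
  by rewrite vc// mul0r.
Qed.

End FiniteEnergyApproximation.

(** With [r = t - a - psi] one has [a + psi = t - r] and [t - psi = a + r]: for [r = 0] the
    variation merely swaps [a] and [t], and the sum cancels. In general it equals [sin r * (sin (2 *
    a + r) - sin (2 * t - r))], to which Young's inequality applies. *)
Lemma sin2_exchange (R : realType) (a t psi s : R) : 0 < s ->
  (sin (a + psi) ^+ 2 - sin a ^+ 2) + (sin (t - psi) ^+ 2 - sin t ^+ 2) <=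
  s * (t - a) ^+ 2 + (s^-1 + 2) * (t - a - psi) ^+ 2.
Proof.
move=> s0; set r := t - a - psi.
have -> : t - psi = a + r by rewrite /r; ring.
have -> : a + psi = t + - r by rewrite /r; ring.
have -> : sin (t + - r) ^+ 2 - sin a ^+ 2 + (sin (a + r) ^+ 2 - sin t ^+ 2) =
  (sin (t + - r) ^+ 2 - sin t ^+ 2) + (sin (a + r) ^+ 2 - sin a ^+ 2) by ring.
rewrite !sin2_diff sinN.
have -> : - sin r * sin (2 * t + - r) + sin r * sin (2 * a + r) =
  sin r * (sin (2 * a + r) - sin (2 * t + - r)) by ring.
apply: le_trans (ler_norm _) _; rewrite normrM.
have h1 := sin_le_id r; have h2 := sin_lip (2 * t + - r) (2 * a + r).
have h3 : `|2 * a + r - (2 * t + - r)| <= 2 * `|r| + 2 * `|t - a|.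
  have -> : 2 * a + r - (2 * t + - r) = 2 * r - 2 * (t - a) by ring.
  by apply: le_trans (ler_normB _ _) _; rewrite !normrM (ger0_norm (_ : 0 <= 2)).
apply: (@le_trans _ _ (`|r| * (2 * `|r| + 2 * `|t - a|))).
  by apply: ler_pM => //; exact: le_trans h2 h3.
rewrite -[r ^+ 2]real_normK ?num_real// -[(t - a) ^+ 2]real_normK ?num_real//.
set x : R := `|r|; set y : R := `|t - a|; rewrite -subr_ge0.
have -> : s * y ^+ 2 + (s^-1 + 2) * x ^+ 2 - x * (2 * x + 2 * y) = s^-1 * (s * y - x) ^+ 2.
  by field; rewrite gt_eqF.
by rewrite mulr_ge0 ?invr_ge0 ?sqr_ge0// ltW.
Qed.

Lemma defect_arith (R : realType) (s k c A1 A2 B1 B2 N1 N2 Nb a1 a2 y1 y2 yb z : R) :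
  0 <= k -> 0 <= c -> A1 + B1 = a1 + a2 -> a1 <= s * N1 + c * y1 -> a2 <= s * N2 + c * y2 ->
  y1 <= z -> y2 <= z -> A2 + B2 <= s * Nb + c * yb -> yb <= z ->
  A1 + k * A2 + (B1 + k * B2) <= s * (N1 + N2 + k * Nb) + c * z * (2 + k).
Proof.
move=> k0 c0 E1 Y1 Y2 z1 z2 E2 zb.
have h1 := ler_wpM2l c0 z1; have h2 := ler_wpM2l c0 z2.
have h3 := ler_wpM2l k0 (le_trans E2 (lerD (lexx _) (ler_wpM2l c0 zb))).
have -> : A1 + k * A2 + (B1 + k * B2) = a1 + a2 + k * (A2 + B2) by rewrite -E1; ring.
have -> : s * (N1 + N2 + k * Nb) + c * z * (2 + k) =
  (s * N1 + c * z) + (s * N2 + c * z) + k * (s * Nb + c * z) by ring.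
lra.
Qed.

Lemma almost_arith (R : realType) (a b p q e : R) : 0 < e -> 2^-1 * (a + b) <= p + q ->
  p < e / 8 -> q <= e / 8 -> 0 <= b -> a < e.
Proof. by move=> *; lra. Qed.

Lemma young_arith (R : realType) (a c x y : R) : 2 * a <= x + y -> 0 <= x -> 0 <= y -> 0 <= c ->
  c + a <= x + (y + 2 * c).
Proof. by move=> *; lra. Qed.

(** A generalized form of [grad w = F (x, w)] that mentions no derivative of [w]. The defect is
    small on the whole half-plane, whereas closeness to [w] is required on bounded sets only. *)
Definition characteristic_limit {R : realType} (eps : R) (w : R * R -> R) :=
  forall e r : R, 0 < e -> 1 <= r -> exists W W1 W2, [/\ C1g W W1 W2,
    sqint (@leb2 R) halfplane (fun x => W1 x - F1 eps x (W x)) /\ sqint (@leb2 R) halfplane (fun x => W2 x - F2 eps x (W x)) &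
    [/\ ip (@leb2 R) halfplane (fun x => W1 x - F1 eps x (W x)) (fun x => W1 x - F1 eps x (W x)) < e,
      ip (@leb2 R) halfplane (fun x => W2 x - F2 eps x (W x)) (fun x => W2 x - F2 eps x (W x)) < e &
      ip (@leb2 R) (halfplane `&` box r) (fun x => W x - w x) (fun x => W x - w x) < e]].

(** * From minimality to almost solutions of the first order system *)

Section AlmostCharacteristic.
Context {R : realType}.
Local Notation R2 := (measurableTypeR R * measurableTypeR R)%type.
Local Notation mu1 := (@leb1 R).
Local Notation leb2 := (@leb2 R).
Local Notation H := (halfplane : set R2).
Variables (eps : R) (heps : 0 < eps) (delta : R * R).
Variables (f p1 p2 : R * R -> R) (t : R -> R).
Hypothesis hf : H1d f p1 p2 t.
Hypothesis hJ : forall psi psi1 psi2 L, C1g psi psi1 psi2 -> vanish L psi ->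
  0 <= Jf eps delta p1 p2 t psi psi1 psi2.
Local Notation u := (ang eps (eps * 0)).
Local Notation u1 := (ang1 eps (eps * 0)).
Local Notation u2 := (ang2 eps (eps * 0)).
Local Notation d := (fun x : R * R => f x - profile eps delta 0 x).
Local Notation d1 := (fun x : R * R => p1 x - u1 x).
Local Notation d2 := (fun x : R * R => p2 x - (u2 x + delta.2)).
Local Notation db := (fun s : R => t s - u (s, 0)).
Hypothesis s1 : sqint leb2 H d1.
Hypothesis s2 : sqint leb2 H d2.
Hypothesis sb : sqint mu1 setT db.
Local Notation k := ((2 * eps)^-1).

Lemma sin2_line_int (psi : R * R -> R) (g : R -> R) (L : R) : loc1 g -> continuous psi -> vanish L psi ->
  mu1.-integrable setT (EFin \o (fun s => sin (g s + psi (s, 0)) ^+ 2 - sin (g s) ^+ 2)).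
Proof.
move=> lg cp v; have mg := loc1_measurable lg.
have mp : measurable_fun (setT : set (measurableTypeR R)) (fun s => psi (s, 0)).
  by apply: continuous_measurable_fun; exact: continuous_slice1.
apply: (@integrable_le _ (measurableTypeR R) R mu1 _ _ (fun s => `|psi (s, 0)|)) => //.
- by apply: measurable_funB; apply: measurable_sin2 => //; exact: measurable_funD.
- by move=> s _; exact: sin2_diff_le.
- by apply: integrable_norm; exact: cont_line_int cp v.
Qed.

(** The increment of [f] under [- psi] is nonnegative and may be added. In the sum the gradient
    terms collapse to pairings of [psi1] with [psi1 - d1] and of [psi2] with [psi2 - d2], and the
    boundary terms to the situation of [sin2_exchange]; all of them are small when [psi] is close to
    the difference. *)
Lemma calibrated_defect psi psi1 psi2 L s z : C1g psi psi1 psi2 -> vanish L psi -> 0 < s ->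
  ip leb2 H (fun x => psi1 x - d1 x) (fun x => psi1 x - d1 x) <= z ->
  ip leb2 H (fun x => psi2 x - d2 x) (fun x => psi2 x - d2 x) <= z ->
  ip mu1 setT (fun s => psi (s, 0) - db s) (fun s => psi (s, 0) - db s) <= z ->
  Jf eps delta u1 (fun x => u2 x + delta.2) (fun s => u (s, 0)) psi psi1 psi2 <=
  s * (ip leb2 H d1 d1 + ip leb2 H d2 d2 + k * ip mu1 setT db db) +
  (s^-1 + 2) * z * (2 + k).
Proof.
move=> hp v s0 z1 z2 zb.
have mH := @measurable_halfplane R.
have [v1 v2] := vanish_d hp v; have cp := C1g_cont hp; have [_ cp1 cp2] := hp.
have sp1 := cont_sqint mH cp1 v1; have sp2 := cont_sqint mH cp2 v2.
have spb : sqint mu1 setT (fun s => psi (s, 0)).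
  exact: cont_sqint1 measurableT (continuous_slice1 (b := 0) cp) (fun s => vanish_line v (s := s)).
have [_ l1 l2 lt _ _] := hf; have [_ m1 m2 mt _ _] := H1d_profile heps delta 0.
have lc (a : R) p : loc2 p -> loc2 (fun x => p x - a).
  by move=> lp; apply: (loc2D lp); apply: cont_loc2 => x; exact: cvg_cst.
have vN : vanish L (fun x => - psi x) by move=> x nx; rewrite v// oppr0.
have cN : continuous (fun x => - psi x) by move=> x; apply: cvgN; exact: cp.
have iq : leb2.-integrable H (EFin \o (fun x => 2^-1 * (psi1 x ^+ 2 + psi2 x ^+ 2))).
  apply: (@C1g_intH R _ L).
    move=> x; apply: cvgM; first exact: cvg_cst.
    by apply: cvgD; apply: cvgM; [exact: cp1|exact: cp1|exact: cp2|exact: cp2].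
  by move=> x nx; rewrite v1// v2// expr0n/= addr0 mulr0.
have I q1 q2 : loc2 q1 -> loc2 q2 ->
    leb2.-integrable H (EFin \o (fun x => (q1 x - delta.1) * psi1 x + (q2 x - delta.2) * psi2 x)).
  move=> lq1 lq2; have i1 := loc2_int (lc delta.1 _ lq1) cp1 v1.
  by have i2 := loc2_int (lc delta.2 _ lq2) cp2 v2; exact: integrableDr.
have Iu := integrableDr mH iq (I _ _ m1 m2); have If := integrableBr mH iq (I _ _ l1 l2).
have B0 := hJ (C1gN hp) vN.
have ku : 0 < k by rewrite invr_gt0 mulr_gt0.
apply: (@le_trans _ _ (Jf eps delta u1 (fun x => u2 x + delta.2) (fun s => u (s, 0)) psi psi1 psi2 +
  Jf eps delta p1 p2 t (fun x => - psi x) (fun x => - psi1 x) (fun x => - psi2 x))); first by rewrite lerDl.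
have iu := sin2_line_int mt cp v; have it := sin2_line_int lt cN vN.
rewrite /Jf.
set A1 := Rintegral leb2 _ _; set A2 := Rintegral mu1 _ _; set B1 := Rintegral leb2 _ _; set B2 := Rintegral mu1 _ _.
have E1 : A1 + B1 = ip leb2 H psi1 (fun x => psi1 x - d1 x) + ip leb2 H psi2 (fun x => psi2 x - d2 x).
  have -> : B1 = \int[leb2]_(x in H) (2^-1 * (psi1 x ^+ 2 + psi2 x ^+ 2) -
      ((p1 x - delta.1) * psi1 x + (p2 x - delta.2) * psi2 x)).
    by apply: eq_Rintegral => x _; ring.
  rewrite /A1 -RintegralD// !ipE -RintegralD//; [|by apply: sqint_int => //; exact: sqintB..].
  by apply: eq_Rintegral => x _; field.
have E2 : A2 + B2 <= s * ip mu1 setT db db +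
    (s^-1 + 2) * ip mu1 setT (fun s => psi (s, 0) - db s) (fun s => psi (s, 0) - db s).
  have sd := sqintB measurableT spb sb.
  have j1 := integrableZr' s measurableT (sqint_int measurableT sb sb).
  have j2 := integrableZr' (s^-1 + 2) measurableT (sqint_int measurableT sd sd).
  rewrite /A2 /B2 -RintegralD// !ipE -RintegralZl//; last exact: sqint_int.
  rewrite -RintegralZl//; last exact: sqint_int.
  rewrite -RintegralD//; apply: le_Rintegral => //.
  - exact: integrableDr.
  - exact: integrableDr.
  - move=> r _; apply: le_trans (sin2_exchange (u (r, 0)) (t r) (psi (r, 0)) s0) _.
    rewrite le_eqVlt; apply/orP; left; apply/eqP; ring.
have Y p q (sp : sqint leb2 H p) (sq : sqint leb2 H q) :
    ip leb2 H p (fun x => p x - q x) <= s * ip leb2 H q q +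
    (s^-1 + 2) * ip leb2 H (fun x => p x - q x) (fun x => p x - q x).
  have sz := sqintB mH sp sq; have := ip_young mH sq sz s0.
  have -> : ip leb2 H p (fun x => p x - q x) =
     ip leb2 H (fun x => p x - q x) (fun x => p x - q x) + ip leb2 H q (fun x => p x - q x).
    rewrite -ipDl//; congr ip; apply/funext => x; ring.
  have := ip_ge0 leb2 H q; have := ip_ge0 leb2 H (fun x => p x - q x).
  have i0 : 0 < s^-1 by rewrite invr_gt0.
  move: (ip _ _ _ _) (ip _ _ _ _) (ip _ _ _ _) => a b c a0 b0 h.
  have h1 := mulr_ge0 (ltW s0) b0; have h2 := mulr_ge0 (ltW i0) a0.
  by rewrite mulrDl; exact: young_arith h h1 h2 a0.
have Y1 := Y _ _ sp1 s1; have Y2 := Y _ _ sp2 s2.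
have si : 0 <= s^-1 + 2 by rewrite addr_ge0// invr_ge0 ltW.
exact: defect_arith (ltW ku) si E1 Y1 Y2 z1 z2 E2 zb.
Qed.

Lemma almost_characteristic (D : R) : {ae leb2, forall x, H x -> `|d x| <= D} ->
  characteristic_limit eps (fun x => f x - delta.2 * x.2).
Proof.
move=> dD e r e0 r1; have mH := @measurable_halfplane R.
pose N := ip leb2 H d1 d1 + ip leb2 H d2 d2 + k * ip mu1 setT db db.
have ku : 0 < k by rewrite invr_gt0 mulr_gt0.
have N0 : 0 <= N by rewrite /N !addr_ge0 ?ip_ge0// mulr_ge0 ?ip_ge0// ltW.
(* Order of choice: [s] makes the term with the fixed energy [N] small; the closeness [z] is taken
   afterwards, since its factor contains [s^-1]. *)
pose s := e / (8 * (N + 1)); have s0 : 0 < s by rewrite divr_gt0// mulr_gt0// ltr_wpDl.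
pose c := (s^-1 + 2) * (2 + k).
have c0 : 0 < c by rewrite mulr_gt0// addr_gt0// invr_gt0.
pose z := Num.min e (e / (8 * c)).
have z0 : 0 < z by rewrite lt_min e0 divr_gt0// mulr_gt0.
have hd := H1d_diff heps delta hf.
have [psi [psi1 [psi2 [L [hp v [k1 k2 kb kr]]]]]] := finite_energy_density hd dD s1 s2 sb z0 r1.
have J := calibrated_defect hp v s0 (ltW k1) (ltW k2) (ltW kb).
rewrite (calibration heps _ _ hp v) -/N in J.
have hu := C1g_ang heps (eps * 0); have hW := C1gD hu hp.
have [v1 v2] := vanish_d hp v; have cp := C1g_cont hp; have cu := C1g_cont hu.
pose G1 x := u1 x + psi1 x - F1 eps x (u x + psi x).
pose G2 x := u2 x + psi2 x - F2 eps x (u x + psi x).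
have cW := C1g_cont hW; have [_ cW1 cW2] := hW.
have csin : continuous (fun x => sin (u x + psi x)).
  by move=> x; apply: (@continuous_comp _ _ _ (fun x => u x + psi x) (@sin R)); [exact: cW|exact: continuous_sin].
have ccos : continuous (fun x => cos (u x + psi x)).
  by move=> x; apply: (@continuous_comp _ _ _ (fun x => u x + psi x) (@cos R)); [exact: cW|exact: continuous_cos].
have ck : continuous (fun x : R * R => kf eps x.2).
  by have := C1g_cont (C1g_of2 (is_derive_kf heps) (dkf_cont heps)).
have cG1 : continuous G1.
  move=> x; apply: cvgB; first exact: cW1.
  by apply: cvgN; apply: cvgM; [exact: ck|apply: cvgM; exact: csin].
have cG2 : continuous G2.
  move=> x; apply: cvgB; first exact: cW2.
  by apply: cvgM; [exact: ck|apply: cvgM; [exact: csin|exact: ccos]].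
have sG1 : sqint leb2 H G1.
  apply: (@loc2_vanish R L); first exact: cont_loc2.
  move=> x Hx nx; rewrite /G1 v// v1// !addr0.
  by have [-> _] := angF eps (eps * 0) (ltW Hx); rewrite subrr.
have sG2 : sqint leb2 H G2.
  apply: (@loc2_vanish R L); first exact: cont_loc2.
  move=> x Hx nx; rewrite /G2 v// v2// !addr0.
  by have [_ ->] := angF eps (eps * 0) (ltW Hx); rewrite subrr.
have JE : \int[leb2]_(x in H) (2^-1 * (G1 x ^+ 2 + G2 x ^+ 2)) = 2^-1 * (ip leb2 H G1 G1 + ip leb2 H G2 G2).
  rewrite !ipE -RintegralD//; [|exact: sqint_int|exact: sqint_int].
  by rewrite -RintegralZl//; apply: integrableDr => //; exact: sqint_int.
rewrite -[X in X <= _]/(\int[leb2]_(x in H) (2^-1 * (G1 x ^+ 2 + G2 x ^+ 2))) JE in J.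
have sN : s * N < e / 8.
  have -> : e / 8 = s * (N + 1).
    by rewrite /s; field; rewrite gt_eqF// ltr_wpDl.
  by rewrite ltr_pM2l// ltrDl.
have cz : (s^-1 + 2) * z * (2 + k) <= e / 8.
  have -> : e / 8 = c * (e / (8 * c)) by field; rewrite gt_eqF.
  have -> : (s^-1 + 2) * z * (2 + k) = c * z by rewrite /c; ring.
  by rewrite ler_pM2l// /z ge_min lexx orbT.
have g1 := ip_ge0 leb2 H G1; have g2 := ip_ge0 leb2 H G2.
exists (fun x => u x + psi x), (fun x => u1 x + psi1 x), (fun x => u2 x + psi2 x); split=> //.
split; [exact: almost_arith e0 J sN cz g2|by rewrite addrC in J; exact: almost_arith e0 J sN cz g1|].
have Q : {in (H `&` box r : set R2), (fun x => u x + psi x - (f x - delta.2 * x.2)) =1 (fun x => psi x - d x)}.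
  by move=> x /set_mem[Hx _]; rewrite /profile /ang kfE ?ltW//; ring.
by rewrite (eq_ip _ Q Q); apply: lt_le_trans kr _; rewrite /z ge_min lexx.
Qed.

End AlmostCharacteristic.

(** * Functions with vanishing weak gradient *)

Section ZeroGradient.
Context {R : realType}.
Local Notation R2 := (measurableTypeR R * measurableTypeR R)%type.
Local Notation leb2 := (@leb2 R).
Local Notation H := (halfplane : set R2).

Lemma C1g_zero_grad_const (k k1 k2 : R * R -> R) (L : R) : C1g k k1 k2 ->
  (forall x, (H `&` box L) x -> k1 x = 0 /\ k2 x = 0) ->
  forall x y, (H `&` box L) x -> (H `&` box L) y -> k x = k y.
Proof.
move=> hk z x y [Hx [bx1 bx2]] [Hy [by1 by2]].
rewrite /halfplane/= in Hx Hy.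
have Eh : k (x.1, x.2) = k (y.1, x.2).
  have [c hc /eqP] := mvt y.1 x.1 (fun s => C1g_slice1 x.2 s hk).
  have cL := hc (- L) L; rewrite -!ler_norml in cL.
  by rewrite (z (c, x.2) _).1 ?mul0r ?subr_eq0 => [/eqP|]; [|split=> //; split=> //; exact: cL].
have Ev : k (y.1, x.2) = k (y.1, y.2).
  have [c hc /eqP] := mvt y.2 x.2 (fun s => C1g_slice2 y.1 s hk).
  have cL := hc (- L) L; rewrite -!ler_norml in cL.
  have c0 : 0 < c.
    have [xy|yx] := leP x.2 y.2.
      by have := hc x.2 y.2; rewrite xy !lexx => /(_ isT isT) /andP[+ _]; exact: lt_le_trans.
    by have := hc y.2 x.2; rewrite (ltW yx) !lexx => /(_ isT isT) /andP[+ _]; exact: lt_le_trans.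
  by rewrite (z (y.1, c) _).2 ?mul0r ?subr_eq0 => [/eqP|]; [|split=> //; split=> //; exact: cL].
by rewrite [x]surjective_pairing [y]surjective_pairing Eh Ev.
Qed.

Definition zero_weak_grad (f : R * R -> R) := forall eta eta1 eta2 (L c : R),
  C1g eta eta1 eta2 -> vanish L eta -> 0 < c -> (forall x, x.2 < c -> eta x = 0) ->
  \int[leb2]_(x in H) (f x * eta1 x) = 0 /\ \int[leb2]_(x in H) (f x * eta2 x) = 0.

(** At points of the half-plane [k2 h] is an admissible test function, so the mollification of [f]
    has zero gradient there and is constant on the box. *)
Lemma zero_weak_grad_approx f (n : nat) (e : R) : loc2 f -> zero_weak_grad f -> 0 < e ->
  exists kap, ip leb2 (H `&` box n.+1%:R) (fun x => kap - f x) (fun x => kap - f x) < e.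
Proof.
move=> lf zf e0; pose L : R := n.+1%:R + 4.
have mD := @measurable_Hbox R L.
have Lp : sqint leb2 setT (f \_ (H `&` box L)).
  by apply: sqint_patch => //; rewrite setTI.
have [_ /(_ e e0)[N /(_ N (leqnn N))]] := approx2 Lp.
have h0 := @hn_gt0 R N; have h1 : hn N <= 1 :> R by rewrite /hn invf_le1// ler1n.
set h := hn N in h0 h1 *; set K := Kop _ _ _ => hK.
have If : leb2.-integrable setT (EFin \o (f \_ (H `&` box L))).
  have Sb : sqint leb2 setT (\1_(box L : set R2)).
    by apply: sqint_indic; [exact: measurable_box|exact: box_lty].
  have := @sqint_int _ _ _ leb2 setT _ _ measurableT Lp Sb; congr (_.-integrable _ _).
  apply/funext => y /=; rewrite indicE /patch in_setI; case: (y \in box L); first by rewrite mulr1.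
  by rewrite andbF mulr0.
have C := mollifier_C1g h0 If.
have x0 : (H `&` box n.+1%:R) ((0, 1) : R2).
  by split; rewrite /halfplane/box/= ?normr0 ?normr1//; split=> //; rewrite ler1n.
have Kc x : (H `&` box n.+1%:R) x -> K (0, 1) = K x.
  move=> Hbx; apply: (C1g_zero_grad_const (L := n.+1%:R) C _ x0 Hbx).
  move=> y [Hy b]; have v : vanish L (k2 h y).
    by apply: vanishS (k2_vanish h0 b); rewrite /L; lra.
  have [|z1 z2] := zf _ _ _ L h (C1g_k2 y h0) v h0.
    by move=> z hz; apply: k2_below => //; move: Hy; rewrite /halfplane/=; lra.
  have [v1 v2] := vanish_d (C1g_k2 y h0) v.
  rewrite !Rintegral_patchM !setTI; split; apply/eqP; rewrite oppr_eq0; apply/eqP.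
    rewrite -[RHS]z1; apply/esym.
    by apply: Rintegral_sub => [z []//|z Hz nz]; rewrite v1 ?mulr0// => bz; apply: nz.
  rewrite -[RHS]z2; apply/esym.
  by apply: Rintegral_sub => [z []//|z Hz nz]; rewrite v2 ?mulr0// => bz; apply: nz.
exists (K (0, 1)); apply: le_lt_trans hK.
have SK : sqint leb2 setT (fun x => K x - (f \_ (H `&` box L)) x).
  by apply: sqintB => //; apply: (Kop_sqint (k2_bound h0)).
apply: le_trans (ip_subset measurableT (measurable_Hbox n.+1%:R) (@subsetT _ _) SK).
rewrite le_eqVlt; apply/orP; left; apply/eqP.
have Q : {in (H `&` box n.+1%:R : set R2), (fun x => K (0, 1) - f x) =1 (fun x => K x - (f \_ (H `&` box L)) x)}.
  move=> x /set_mem Hbx; rewrite (Kc x Hbx) /patch mem_set//; case: Hbx => Hx bx; split=> //.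
  by apply: sub_box bx; rewrite /L; lra.
exact: eq_ip.
Qed.

Definition unit_square : set R2 := `]0, 1]%classic `*` `]0, 1]%classic.

Lemma leb2_unit_square : leb2 unit_square = 1%E.
Proof.
have h : (@lebesgue_measure R `]0%R, 1%R]%classic = 1)%E.
  by rewrite lebesgue_measure_itv/= lte_fin ltr01 -EFinB subr0.
by rewrite [LHS]product_measure1E ?measurable_itv// [X in (X * _)%E]h [X in (_ * X)%E]h mule1.
Qed.

Lemma measurable_unit_square : measurable unit_square.
Proof. by apply: measurableX; exact: measurable_itv. Qed.

(** The constants of [zero_weak_grad_approx] depend on the box and on the error. The mean of [f]
    over a unit square contained in all the boxes is a common candidate: by Cauchy-Schwarz it is as
    close to each of them as they are to [f]. *)
Lemma zero_weak_grad_const f : loc2 f -> zero_weak_grad f ->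
  exists kap, {ae leb2, forall x, H x -> f x = kap}.
Proof.
move=> lf zf; pose Q := unit_square; have mQ := measurable_unit_square.
have QH n : Q `<=` H `&` box n.+1%:R.
  move=> x [] /=; rewrite !in_itv/= => /andP[a b] /andP[c e]; split=> //.
  have n1 : 1 <= n.+1%:R :> R by rewrite ler1n.
  by split; rewrite gtr0_norm//; apply: le_trans n1.
have S1 D : measurable D -> (leb2 D < +oo)%E -> sqint leb2 D (cst 1 : R2 -> R).
  move=> mD Df; have sI := sqintS measurableT mD (@subsetT _ _) (sqint_indic (mu := leb2) mD Df).
  by apply: eq_sqint sI => // x xD; rewrite indicE xD.
have fin n : (leb2 (H `&` box n.+1%:R) < +oo)%E.
  by apply: le_lt_trans (box_lty n.+1%:R); apply: le_measure; rewrite ?inE.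
have Q1 : ip leb2 Q (cst 1) (cst 1) = 1.
  have Qf : (leb2 Q < +oo)%E by rewrite leb2_unit_square ltry.
  apply: EFin_inj; rewrite ip_sqint//; last exact: S1.
  rewrite (eq_integral (cst 1%E)); last by move=> x _; rewrite /= expr1n.
  apply: etrans (integral_cst _ mQ 1) _; rewrite mul1e; exact: leb2_unit_square.
pose m := ip leb2 Q f (cst 1); exists m.
have Zn (n : nat) : {ae leb2, forall x, (H `&` box n.+1%:R) x -> m - f x = 0}.
  have mB := @measurable_Hbox R n.+1%:R.
  pose V := ip leb2 (H `&` box n.+1%:R) (cst 1) (cst 1).
  have V0 : 0 <= V by exact: ip_ge0.
  have sf : sqint leb2 (H `&` box n.+1%:R) f := lf _.
  have s1 := S1 _ mB (fin n).
  have sc a : sqint leb2 (H `&` box n.+1%:R) (cst a : R2 -> R).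
    by have := sqintZ a mB s1; congr sqint; apply/funext => x; rewrite /= mulr1.
  apply: (@ip_eq0_ae _ R2 R leb2 _ (fun x => m - f x) mB); first exact: (sqintB mB (sc m) sf).
  apply: small_eq0 => [|e e0]; first exact: ip_ge0.
  have e1 : 0 < e / (2 * (1 + V)) by rewrite divr_gt0// mulr_gt0// ltr_wpDr.
  have [kap hkap] := zero_weak_grad_approx n lf zf e1.
  set z := e / _ in e1 hkap.
  have mk : (m - kap) ^+ 2 <= z.
    have sQ g : sqint leb2 (H `&` box n.+1%:R) g -> sqint leb2 Q g.
      by move=> sg; apply: (sqintS mB mQ (QH n) sg).
    have -> : m - kap = - ip leb2 Q (fun x => kap - f x) (cst 1).
      have E1 : ip leb2 Q (cst kap) (cst 1) = kap.
        have -> : cst kap = (fun x : R2 => kap * (cst 1 : R2 -> R) x).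
          by apply/funext => x; rewrite /= mulr1.
        by rewrite (ipZl kap mQ (sQ _ s1) (sQ _ s1)) Q1 mulr1.
      by rewrite (ipBl mQ (sQ _ (sc kap)) (sQ _ sf) (sQ _ s1)) E1 opprB.
    have sk := sqintB mB (sc kap) sf.
    rewrite sqrrN; apply: le_trans (ip_cauchy mQ (sQ _ sk) (sQ _ s1)) _.
    rewrite Q1 mulr1; apply: le_trans (ltW hkap); exact: ip_subset mB mQ (QH n) sk.
  have -> : (fun x => m - f x) = (fun x : R2 => (m - kap) * (cst 1 : R2 -> R) x + (kap - f x)).
    by apply/funext => x; rewrite /=; ring.
  apply: le_lt_trans (ipD_le mB (sqintZ (m - kap) mB s1) (sqintB mB (sc kap) sf)) _.
  rewrite ipZl ?ipZr//; last exact: sqintZ.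
  rewrite -/V.
  have -> : e = 2 * (V * z) + 2 * z by rewrite /z; field; rewrite gt_eqF// ltr_wpDr.
  rewrite ler_ltD// ?ltr_pM2l// ler_pM2l// mulrA -expr2 mulrC ler_wpM2l//.
have := ae_nat Zn; apply: filterS => x hx Hx.
have [n hn'] := Rnat_bound (`|x.1| + `|x.2|).
have := hx n; rewrite /setI/= => h; apply/esym/eqP; rewrite -subr_eq0; apply/eqP/h.
by split=> //; apply: sub_box (in_box x); apply: le_trans hn' _; rewrite ler_nat.
Qed.

End ZeroGradient.

Section Inverse.
Context {R : realType}.

Lemma C1g_inv (f f1 f2 : R * R -> R) : (forall x, f x != 0) -> C1g f f1 f2 ->
  C1g (fun x => (f x)^-1) (fun x => - (f x) ^- 2 * f1 x) (fun x => - (f x) ^- 2 * f2 x).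
Proof.
move=> f0 hf; have cf := C1g_cont hf; move: hf => [df c1 c2].
have ci : continuous (fun x => - (f x) ^- 2).
  move=> x; apply: cvgN; apply: cvgV; first by rewrite expf_neq0.
  by apply: cvgM; exact: cf.
split.
- move=> x; have h1 := df x.
  have h2 : is_diff (f x) (@GRing.inv R) (fun h : R => - (f x) ^- 2 *: h).
    by apply: DiffDef; [exact: differentiable_Rinv|exact: diff_Rinv].
  apply: (@is_diff_eq _ _ _ _ _ _ _ (is_diff_comp h1 h2)).
  by apply/funext => v; rewrite /= /GRing.scale/=; ring.
- by move=> x; apply: cvgM; [exact: ci|exact: c1].
- by move=> x; apply: cvgM; [exact: ci|exact: c2].
Qed.

Lemma measurable_funVpos d (T : measurableType d) (D : set T) (f : T -> R) : measurable D ->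
  measurable_fun D f -> (forall x, D x -> 0 < f x) -> measurable_fun D (fun x => (f x)^-1).
Proof.
move=> mD mf f0; apply: (eq_measurable_fun (fun x => expR (- ln (f x)))).
  by move=> x /set_mem Dx; rewrite expRN lnK// posrE f0.
apply: (measurableT_comp (@measurable_expR R)); apply: measurable_funN.
exact: (measurableT_comp (@measurable_ln R)).
Qed.

End Inverse.

(** Integration by parts passes to L^2 limits: the pairing for [h] and [p] equals the pairing for
    [h - G] and [p - Gi]. *)
Lemma pairing_limit d (T : measurableType d) (R : realType) (mu : {measure set T -> \bar R})
    (D : set T) (eta etai h p : T -> R) : measurable D ->
  sqint mu D eta -> sqint mu D etai -> sqint mu D h -> sqint mu D p ->
  (forall e : R, 0 < e -> exists G Gi, [/\ sqint mu D G, sqint mu D Gi,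
     ip mu D G etai + ip mu D Gi eta = 0,
     ip mu D (fun x => h x - G x) (fun x => h x - G x) < e &
     ip mu D (fun x => p x - Gi x) (fun x => p x - Gi x) < e]) ->
  ip mu D h etai + ip mu D p eta = 0.
Proof.
move=> mD se sei sh sp H; set X := _ + _.
pose N := ip mu D etai etai + ip mu D eta eta.
have N1 : 0 <= ip mu D etai etai by exact: ip_ge0.
have N2 : 0 <= ip mu D eta eta by exact: ip_ge0.
apply/eqP; rewrite -sqrf_eq0; apply/eqP; apply: small_eq0; first exact: sqr_ge0.
move=> e e0; have C0 : 0 < 2 * (N + 1) by rewrite /N; lra.
have [G [Gi [sG sGi E h1 h2]]] := H _ (divr_gt0 e0 C0).
set z := e / _ in h1 h2.
have -> : X = ip mu D (fun x => h x - G x) etai + ip mu D (fun x => p x - Gi x) eta.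
  by rewrite !ipBl// /X -[LHS]subr0 -E; ring.
have a1 := le_trans (ip_cauchy mD (sqintB mD sh sG) sei) (ler_wpM2r N1 (ltW h1)).
have a2 := le_trans (ip_cauchy mD (sqintB mD sp sGi) se) (ler_wpM2r N2 (ltW h2)).
have z0 : 0 < z by rewrite divr_gt0.
have ze : e = z * (2 * (N + 1)) by rewrite /z divfK// gt_eqF.
set a := ip mu D (fun x => h x - G x) etai in a1 *; set b := ip mu D (fun x => p x - Gi x) eta in a2 *.
have ab : (a + b) ^+ 2 <= 2 * a ^+ 2 + 2 * b ^+ 2.
  rewrite -subr_ge0; have -> : 2 * a ^+ 2 + 2 * b ^+ 2 - (a + b) ^+ 2 = (a - b) ^+ 2 by ring.
  exact: sqr_ge0.
apply: le_lt_trans ab _; rewrite ze /N.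
have -> : z * (2 * (ip mu D etai etai + ip mu D eta eta + 1)) =
  2 * (z * ip mu D etai etai) + 2 * (z * ip mu D eta eta) + 2 * z by ring.
lra.
Qed.

Section Characteristic.
Context {R : realType}.
Local Notation R2 := (measurableTypeR R * measurableTypeR R)%type.
Local Notation leb2 := (@leb2 R).
Local Notation H := (halfplane : set R2).
Variables (eps : R) (heps : 0 < eps) (w : R * R -> R).
Hypothesis lw : loc2 w.
Hypothesis hA : characteristic_limit eps w.

Section Chain.
Variables (h m P1 P2 : R * R -> R -> R).
Hypothesis hC : forall W W1 W2, C1g W W1 W2 -> exists G1 G2,
  C1g (fun x => h x (W x)) G1 G2 /\ forall x, H x ->
    G1 x = P1 x (W x) + m x (W x) * (W1 x - F1 eps x (W x)) /\
    G2 x = P2 x (W x) + m x (W x) * (W2 x - F2 eps x (W x)).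
Hypothesis hK : forall L, exists2 K, 0 <= K & forall x v v', (H `&` box L) x ->
  [/\ `|m x v| <= K, `|h x v - h x v'| <= K * `|v - v'|,
    `|P1 x v - P1 x v'| <= K * `|v - v'| & `|P2 x v - P2 x v'| <= K * `|v - v'|].
Hypothesis lh : loc2 (fun x => h x (w x)).
Hypothesis lP1 : loc2 (fun x => P1 x (w x)).
Hypothesis lP2 : loc2 (fun x => P2 x (w x)).

(* The chain rule for [h (x, w x)]: since [w] is a limit of functions [W] whose
   gradient is almost [F (x, W)], its gradient is [P (x, w x)]. *)
Lemma chain_rule eta eta1 eta2 L : C1g eta eta1 eta2 -> vanish L eta ->
  (exists2 c, 0 < c & forall x, x.2 < c -> eta x = 0) ->
  \int[leb2]_(x in H) (h x (w x) * eta1 x) = - (\int[leb2]_(x in H) (P1 x (w x) * eta x)) /\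
  \int[leb2]_(x in H) (h x (w x) * eta2 x) = - (\int[leb2]_(x in H) (P2 x (w x) * eta x)).
Proof.
move=> he v [c c0 vc].
pose r := `|L| + 1; have r1 : 1 <= r by rewrite lerDr.
have vr : vanish r eta by apply: vanishS v; rewrite /r; have := ler_norm L; lra.
have [v1 v2] := vanish_d he vr; have ce := C1g_cont he; have [_ ce1 ce2] := he.
pose D : set R2 := H `&` box r; have mD : measurable D := @measurable_Hbox R _.
have [K K0 hKr] := hK r.
have restr k eta' : vanish r eta' -> \int[leb2]_(x in H) (k x * eta' x) = ip leb2 D k eta'.
  move=> ve'; rewrite ipE; apply: Rintegral_sub => [x []//|x Hx nx].
  by rewrite ve' ?mulr0// => b; apply: nx.
have se := cont_sqint mD ce vr; have se1 := cont_sqint mD ce1 v1; have se2 := cont_sqint mD ce2 v2.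
have sD k : loc2 k -> sqint leb2 D k by move=> lk; exact: lk.
(* Here [Wi] is a component of the defect. The difference [P (x, w) - Gi] splits into a Lipschitz
   error, at most [K * |W - w|], and the multiple [m] of the defect, at most [K * |Wi|]; this is the
   origin of [4 * K ^+ 2]. *)
have core (P : R * R -> R -> R) (etai : R * R -> R) (Wi Gi : R * R -> R) (W : R * R -> R) e G1 G2 :
    0 < e -> continuous W -> continuous Gi -> loc2 (fun x => P x (w x)) ->
    C1g (fun x => h x (W x)) G1 G2 ->
    (forall x, D x -> Gi x = P x (W x) + m x (W x) * Wi x) ->
    (forall x v v', D x -> `|P x v - P x v'| <= K * `|v - v'|) ->
    sqint leb2 H Wi -> ip leb2 H Wi Wi < e / (4 * (K ^+ 2 + 1)) ->
    ip leb2 D (fun x => W x - w x) (fun x => W x - w x) < e / (4 * (K ^+ 2 + 1)) ->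
    [/\ sqint leb2 D (fun x => h x (W x)), sqint leb2 D Gi,
     ip leb2 D (fun x => h x (w x) - h x (W x)) (fun x => h x (w x) - h x (W x)) < e &
     ip leb2 D (fun x => P x (w x) - Gi x) (fun x => P x (w x) - Gi x) < e].
  move=> e0 cW cGi lP hG GE PK sWi iW iw.
  have K1 : 0 < K ^+ 2 + 1 by rewrite ltr_wpDl ?sqr_ge0.
  set z := e / _ in iW iw.
  have z0 : 0 < z by rewrite divr_gt0// mulr_gt0.
  have eE : e = 4 * (K ^+ 2 * z) + 4 * z by rewrite /z; field; rewrite gt_eqF.
  have lt4 : 4 * (K ^+ 2 * z) < e by rewrite [ltRHS]eE ltrDl mulr_gt0.
  have lt1 : K ^+ 2 * z < e.
    by apply: le_lt_trans lt4; rewrite ler_peMl ?ler1n// mulr_ge0 ?sqr_ge0// ltW.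
  have Kz : 0 <= K ^+ 2 * z by rewrite mulr_ge0 ?sqr_ge0// ltW.
  have sh : sqint leb2 D (fun x => h x (W x)) := sD _ (cont_loc2 (C1g_cont hG)).
  have sG : sqint leb2 D Gi := sD _ (cont_loc2 cGi).
  have sWw : sqint leb2 D (fun x => W x - w x).
    by apply: sqintB => //; [exact: sD (cont_loc2 cW)|exact: sD].
  have sKW : sqint leb2 D (fun x => K * (W x - w x)) by exact: sqintZ.
  have sWiD : sqint leb2 D Wi by apply: (sqintS _ mD _ sWi) => // x [].
  have iKW : ip leb2 D (fun x => K * (W x - w x)) (fun x => K * (W x - w x)) <= K ^+ 2 * z.
    rewrite (ipZl K mD sWw sKW) (ipZr K mD sWw sWw) mulrA -expr2.
    by rewrite ler_wpM2l ?sqr_ge0// ltW.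
  have sKi : sqint leb2 D (fun x => K * Wi x) by exact: sqintZ.
  have iKi : ip leb2 D (fun x => K * Wi x) (fun x => K * Wi x) <= K ^+ 2 * z.
    rewrite (ipZl K mD sWiD sKi) (ipZr K mD sWiD sWiD) mulrA -expr2.
    rewrite ler_wpM2l ?sqr_ge0//; apply: le_trans (ltW iW).
    by apply: ip_subset => // x [].
  split=> //.
    apply: (@le_lt_trans _ _ (K ^+ 2 * z)); last exact: lt1.
    apply: le_trans iKW; apply: ip_le => //.
      by apply: sqintB => //; exact: sD.
    move=> x Dx; have [_ hx _ _] := hKr x (w x) (W x) Dx; apply: le_trans hx _.
    by rewrite normrM (ger0_norm K0) distrC.
  have sn k : sqint leb2 D k -> sqint leb2 D (fun x => `|k x|).
    move=> sk; apply: (sqint_le mD _ _ sk); last by move=> x _; rewrite normr_id.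
    by apply: measurableT_comp => //; case: sk.
  have nn k : ip leb2 D (fun x => `|k x|) (fun x => `|k x|) = ip leb2 D k k.
    by rewrite !ipE; apply: eq_Rintegral => x _; rewrite -!expr2 real_normK ?num_real.
  apply: (@le_lt_trans _ _ (4 * (K ^+ 2 * z))); last exact: lt4.
  apply: (@le_trans _ _ (ip leb2 D (fun x => `|K * (W x - w x)| + `|K * Wi x|)
      (fun x => `|K * (W x - w x)| + `|K * Wi x|))).
    apply: ip_le => //.
    - by apply: sqintB => //; exact: sD.
    - by apply: sqintD => //; exact: sn.
    - move=> x Dx; have [mx _ _ _] := hKr x (W x) (W x) Dx.
      rewrite GE// opprD addrA [leRHS]ger0_norm ?addr_ge0//.
      apply: le_trans (ler_normB _ _) _; rewrite !normrM (ger0_norm K0); apply: lerD.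
        by apply: le_trans (PK x _ _ Dx) _; rewrite distrC.
      by rewrite ler_wpM2r.
  apply: le_trans (ipD_le mD (sn _ sKW) (sn _ sKi)) _; rewrite !nn.
  have -> : 4 * (K ^+ 2 * z) = 2 * (K ^+ 2 * z) + 2 * (K ^+ 2 * z) by ring.
  by apply: lerD; rewrite ler_pM2l.
have eK (e : R) : 0 < e -> 0 < e / (4 * (K ^+ 2 + 1)).
  by move=> e0; rewrite divr_gt0// mulr_gt0// ltr_wpDl ?sqr_ge0.
split; rewrite !restr//; apply/eqP; rewrite -addr_eq0; apply/eqP; apply: pairing_limit => //;
  try exact: sD; move=> e e0;
  have [W [W1 [W2 [hW [sW1 sW2] [i1 i2 iw]]]]] := hA (eK e e0) r1;
  have [G1 [G2 [hG GE]]] := hC hW; have [_ cG1 cG2] := hG; have cW := C1g_cont hW;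
  have hd := H1d_C1g hG.
- have [s1 s2 s3 s4] := core P1 eta1 _ G1 W e G1 G2 e0 cW cG1 lP1 hG (fun x Dx => (GE x Dx.1).1)
    (fun x a b Dx => let: And4 _ _ q _ := hKr x a b Dx in q) sW1 i1 iw.
  exists (fun x => h x (W x)), G1; split=> //.
  have := H1d_wk1 hd he vr c0 vc; rewrite !restr// => ->; exact: addNr.
- have [s1 s2 s3 s4] := core P2 eta2 _ G2 W e G1 G2 e0 cW cG2 lP2 hG (fun x Dx => (GE x Dx.1).2)
    (fun x a b Dx => let: And4 _ _ _ q := hKr x a b Dx in q) sW2 i2 iw.
  exists (fun x => h x (W x)), G2; split=> //.
  have := wk2_wki (H1d_f hd) (H1d_2 hd) (H1d_wk2 hd) he vr c0 vc; rewrite !restr// => ->; exact: addNr.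
Qed.

End Chain.

End Characteristic.

(** * Projective invariants of the first order system *)

Section Invariants.
Context {R : realType}.
Local Notation R2 := (measurableTypeR R * measurableTypeR R)%type.
Local Notation leb2 := (@leb2 R).
Local Notation H := (halfplane : set R2).
Variables (eps : R) (heps : 0 < eps).
Implicit Types (x : R * R) (v : R).

(* Along the flow [grad w = F (x, w)] both [sin w] and [y cos w - x1 sin w] are
   multiplied by the same factor, so their homogeneous ratios are constant. *)
Definition Qf x v := yf eps x.2 * cos v - x.1 * sin v.
Definition Df x v := sin v * sin v + Qf x v * Qf x v.
(** With [inv2], an entry of the orthogonal projection onto the line spanned by [(sin v, Qf x v)].
    This bounded description of the projective point stays smooth where [sin v] or [Qf x v]
    vanishes, unlike the quotient of the two. *)
Definition inv1 x v := sin v * sin v * (Df x v)^-1.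
Definition inv2 x v := sin v * Qf x v * (Df x v)^-1.
Definition dQf x v := - (yf eps x.2 * sin v) - x.1 * cos v.
(** The derivative of [inv1 x] in [v], which is also the factor multiplying the defect when [inv1]
    is differentiated along a graph; likewise [minv2] for [inv2]. *)
Definition minv1 x v := yf eps x.2 * (2 * (sin v * Qf x v)) * (Df x v) ^- 2.
Definition minv2 x v := yf eps x.2 * (Qf x v * Qf x v - sin v * sin v) * (Df x v) ^- 2.

Lemma cos2E v : cos v ^+ 2 = 1 - sin v ^+ 2 :> R.
Proof. by rewrite -(cos2Dsin2 v) addrK. Qed.

Lemma wronskian x v : cos v * Qf x v - dQf x v * sin v = yf eps x.2.
Proof.
have -> : cos v * Qf x v - dQf x v * sin v = yf eps x.2 * (cos v ^+ 2 + sin v ^+ 2).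
  by rewrite /Qf /dQf; ring.
by rewrite cos2Dsin2 mulr1.
Qed.

(** Cauchy-Schwarz applied to the Wronskian: [sin] and [Qf] cannot both be small, as their Wronskian
    in [v] is [yf], while their [v]-derivatives are bounded on boxes. *)
Lemma Df_lower x v : yf eps x.2 ^+ 2 <= (1 + x.1 ^+ 2 + yf eps x.2 ^+ 2) * Df x v.
Proof.
rewrite -{1}(wronskian x v); set a := cos v; set b := dQf x v.
have D0 : 0 <= Df x v by rewrite /Df -!expr2 addr_ge0 ?sqr_ge0.
have ab : a ^+ 2 + b ^+ 2 <= 1 + x.1 ^+ 2 + yf eps x.2 ^+ 2.
  have E : yf eps x.2 ^+ 2 + x.1 ^+ 2 - b ^+ 2 = (yf eps x.2 * cos v - x.1 * sin v) ^+ 2.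
    have -> : yf eps x.2 ^+ 2 + x.1 ^+ 2 = (yf eps x.2 ^+ 2 + x.1 ^+ 2) * (cos v ^+ 2 + sin v ^+ 2).
      by rewrite cos2Dsin2 mulr1.
    by rewrite /b /dQf; ring.
  have a1 : a ^+ 2 <= 1 by rewrite /a cos2E; have := sqr_ge0 (sin v); lra.
  have := sqr_ge0 (yf eps x.2 * cos v - x.1 * sin v); rewrite -E; lra.
apply: (@le_trans _ _ ((a ^+ 2 + b ^+ 2) * Df x v)); last by rewrite ler_wpM2r.
rewrite -subr_ge0.
have -> : (a ^+ 2 + b ^+ 2) * Df x v - (a * Qf x v - b * sin v) ^+ 2 = (a * sin v + b * Qf x v) ^+ 2.
  by rewrite /Df; ring.
exact: sqr_ge0.
Qed.

Lemma Df_gt0 x v : 0 < Df x v.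
Proof.
have y0 := yf_gt0 heps x.2; have := Df_lower x v; rewrite lt0r => h.
have D0 : 0 <= Df x v by rewrite /Df -!expr2 addr_ge0 ?sqr_ge0.
rewrite D0 andbT; apply/negP => /eqP E; move: h; rewrite E mulr0 leNgt exprn_gt0//.
Qed.

Lemma prod_bounds (a b : R) : [/\ `|a * a| <= a * a + b * b, `|a * b| <= a * a + b * b,
  `|2 * (a * b)| <= a * a + b * b & `|b * b - a * a| <= a * a + b * b].
Proof.
have h1 := sqr_ge0 (a - b); have h2 := sqr_ge0 (a + b); have h3 := sqr_ge0 a; have h4 := sqr_ge0 b.
by split; rewrite ler_norml; apply/andP; split; nra.
Qed.

Lemma inv_bounds x v : `|inv1 x v| <= 1 /\ `|inv2 x v| <= 1.
Proof.
have D0 := Df_gt0 x v; have Di : 0 < (Df x v)^-1 by rewrite invr_gt0.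
have S0 := sqr_ge0 (sin v); have Q0 := sqr_ge0 (Qf x v).
rewrite /inv1 /inv2 !normrM (gtr0_norm Di) -/(_ / _) -/(_ / _).
rewrite !ler_pdivrMr// !mul1r -!normrM /Df.
by have [a b _ _] := prod_bounds (sin v) (Qf x v).
Qed.

(** The quadratic factor of the numerator is at most [Df], which leaves [yf / Df]; then [Df_lower]
    and [eps <= yf] conclude. *)
Lemma minv_bounds x v : 0 <= x.2 ->
  `|minv1 x v| <= (1 + x.1 ^+ 2 + yf eps x.2 ^+ 2) / eps /\
  `|minv2 x v| <= (1 + x.1 ^+ 2 + yf eps x.2 ^+ 2) / eps.
Proof.
move=> x0; have D0 := Df_gt0 x v; have y0 := yf_gt0 heps x.2; have L := Df_lower x v.
have S0 := sqr_ge0 (sin v); have Q0 := sqr_ge0 (Qf x v).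
set T := 1 + _ + _ in L *.
have T0 : 0 < T by rewrite /T -addrA ltr_pwDl// addr_ge0 ?sqr_ge0.
have ye : eps <= yf eps x.2 by rewrite /yf /q2 q1_ge// subrr mulr0 addr0 lerDl.
have key z : `|z| <= Df x v -> `|yf eps x.2 * z * (Df x v) ^- 2| <= T / eps.
  move=> hz; rewrite !normrM (gtr0_norm y0) (@gtr0_norm _ (_ ^- 2)) ?invr_gt0 ?exprn_gt0//.
  apply: (@le_trans _ _ (yf eps x.2 / Df x v)).
    have -> : yf eps x.2 / Df x v = yf eps x.2 * Df x v * (Df x v) ^- 2 by field; rewrite gt_eqF.
    apply: ler_wpM2r; first by rewrite invr_ge0 exprn_ge0// ltW.
    by rewrite ler_wpM2l// ltW.
  rewrite ler_pdivrMr// mulrAC ler_pdivlMr//.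
  apply: (le_trans _ L); rewrite expr2 ler_wpM2l// ltW//.
rewrite /minv1 /minv2; split; apply: key; rewrite /Df.
  by have [_ _ a _] := prod_bounds (sin v) (Qf x v).
by have [_ _ _ a] := prod_bounds (sin v) (Qf x v).
Qed.

(** [S] and [Q] have derivatives [l * S + a * r] and [l * Q + b * r]. The common rate [l] drops out
    because the quotient is homogeneous of degree zero, and the defect [r] enters only through the
    Wronskian [y]. *)
Lemma inv1_id (S Q l a b r y D : R) : D = S * S + Q * Q -> D != 0 -> a * Q - b * S = y ->
  S * S * (- D ^- 2 * (S * (l * S + a * r) + S * (l * S + a * r) +
     (Q * (l * Q + b * r) + Q * (l * Q + b * r)))) +
  D^-1 * (S * (l * S + a * r) + S * (l * S + a * r)) = y * (2 * (S * Q)) * D ^- 2 * r.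
Proof. by move=> -> D0 <-; field. Qed.

Lemma inv2_id (S Q l a b r y D : R) : D = S * S + Q * Q -> D != 0 -> a * Q - b * S = y ->
  S * Q * (- D ^- 2 * (S * (l * S + a * r) + S * (l * S + a * r) +
     (Q * (l * Q + b * r) + Q * (l * Q + b * r)))) +
  D^-1 * (S * (l * Q + b * r) + Q * (l * S + a * r)) = y * (Q * Q - S * S) * D ^- 2 * r.
Proof. by move=> -> D0 <-; field. Qed.

Lemma is_derive_inv x v :
  is_derive v (1 : R) (inv1 x) (minv1 x v) /\ is_derive v (1 : R) (inv2 x) (minv2 x v).
Proof.
have D0 := lt0r_neq0 (Df_gt0 x v).
have dS : is_derive v (1 : R) sin (cos v) by exact: is_derive_sin.
have dQ : is_derive v (1 : R) (Qf x) (dQf x v).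
  rewrite /Qf; apply: is_derive_eq; rewrite /dQf /GRing.scale/=; ring.
have dD := is_deriveD (is_deriveM dS dS) (is_deriveM dQ dQ).
have dI := is_deriveV (f := Df x) D0 dD.
have W := wronskian x v.
split.
  apply: (is_derive_eq (is_deriveM (is_deriveM dS dS) dI)).
  (* The choice [l = 0], [r = 1] specializes the identity to plain differentiation in [v]. *)
  have := @inv1_id (sin v) (Qf x v) 0 (cos v) (dQf x v) 1 (yf eps x.2) (Df x v) erefl D0 W.
  move=> E; rewrite [RHS]mulr1 in E; apply: etrans _ E.
  change (sin v * sin v * (- Df x v ^- 2 * (sin v * cos v + sin v * cos v +
    (Qf x v * dQf x v + Qf x v * dQf x v))) + (Df x v)^-1 * (sin v * cos v + sin v * cos v) =
    sin v * sin v * (- Df x v ^- 2 * (sin v * (0 * sin v + cos v * 1) + sin v * (0 * sin v + cos v * 1) +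
     (Qf x v * (0 * Qf x v + dQf x v * 1) + Qf x v * (0 * Qf x v + dQf x v * 1)))) +
    (Df x v)^-1 * (sin v * (0 * sin v + cos v * 1) + sin v * (0 * sin v + cos v * 1))).
  by rewrite !mul0r !add0r !mulr1.
apply: (is_derive_eq (is_deriveM (is_deriveM dS dQ) dI)).
have := @inv2_id (sin v) (Qf x v) 0 (cos v) (dQf x v) 1 (yf eps x.2) (Df x v) erefl D0 W.
move=> E; rewrite [RHS]mulr1 in E; apply: etrans _ E.
change (sin v * Qf x v * (- Df x v ^- 2 * (sin v * cos v + sin v * cos v +
    (Qf x v * dQf x v + Qf x v * dQf x v))) + (Df x v)^-1 * (sin v * dQf x v + Qf x v * cos v) =
    sin v * Qf x v * (- Df x v ^- 2 * (sin v * (0 * sin v + cos v * 1) + sin v * (0 * sin v + cos v * 1) +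
     (Qf x v * (0 * Qf x v + dQf x v * 1) + Qf x v * (0 * Qf x v + dQf x v * 1)))) +
    (Df x v)^-1 * (sin v * (0 * Qf x v + dQf x v * 1) + Qf x v * (0 * sin v + cos v * 1))).
by rewrite !mul0r !add0r !mulr1.
Qed.

Lemma C1g_inv12 W W1 W2 : C1g W W1 W2 -> exists G1 G2 K1 K2,
  [/\ C1g (fun x => inv1 x (W x)) G1 G2, C1g (fun x => inv2 x (W x)) K1 K2 &
  forall x, H x ->
    [/\ G1 x = minv1 x (W x) * (W1 x - F1 eps x (W x)), G2 x = minv1 x (W x) * (W2 x - F2 eps x (W x)),
       K1 x = minv2 x (W x) * (W1 x - F1 eps x (W x)) & K2 x = minv2 x (W x) * (W2 x - F2 eps x (W x))]].
Proof.
move=> hW.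
(* Common growth rates of [sin W] and [Qf] in the two directions when the defects [r1] and [r2]
   vanish. *)
pose l1 x := - (kf eps x.2 * (sin (W x) * cos (W x))); pose l2 x := kf eps x.2 * cos (W x) ^+ 2.
pose r1 x := W1 x - F1 eps x (W x); pose r2 x := W2 x - F2 eps x (W x).
have cns : continuous (fun s : R => - sin s) by move=> s; apply: cvgN; exact: continuous_sin.
have hS := C1g_comp (@is_derive_sin R) (@continuous_cos R) hW.
have hc := C1g_comp (@is_derive_cos R) cns hW.
have [q1 [q2 [hQ qE]]] : exists q1 q2, C1g (fun x => Qf x (W x)) q1 q2 /\ forall x, H x ->
    q1 x = l1 x * Qf x (W x) + dQf x (W x) * r1 x /\ q2 x = l2 x * Qf x (W x) + dQf x (W x) * r2 x.
  have hy := C1g_of2 (is_derive_yf heps) (@dyf_cont R eps).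
  do 2 eexists; split; first exact: C1gB (C1gM hy hc) (C1gM (@C1g_fst R) hS).
  move=> x Hx /=; have x0 : 0 <= x.2 := ltW Hx.
  have ky : kf eps x.2 * yf eps x.2 = 1 by rewrite /kf mulVf// gt_eqF// yf_gt0.
  have -> : dyf eps x.2 = 1 by rewrite /dyf q1_ge// subrr mulr0 addr0.
  split; apply/eqP; rewrite -subr_eq0; apply/eqP.
    transitivity (sin (W x) * ((cos (W x) ^+ 2 + sin (W x) ^+ 2) * (kf eps x.2 * yf eps x.2) - 1)).
      by rewrite /l1 /r1 /F1 /Qf /dQf; ring.
    by rewrite cos2Dsin2 ky mul1r subrr mulr0.
  transitivity (- cos (W x) * ((cos (W x) ^+ 2 + sin (W x) ^+ 2) * (kf eps x.2 * yf eps x.2) - 1)).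
    by rewrite /l2 /r2 /F2 /Qf /dQf; ring.
  by rewrite cos2Dsin2 ky mul1r subrr mulr0.
have [s1 [s2 [{}hS sE]]] : exists s1 s2, C1g (fun x => sin (W x)) s1 s2 /\ forall x, H x ->
    s1 x = l1 x * sin (W x) + cos (W x) * r1 x /\ s2 x = l2 x * sin (W x) + cos (W x) * r2 x.
  do 2 eexists; split; first exact: hS.
  by move=> x Hx /=; split; [rewrite /l1 /r1 /F1|rewrite /l2 /r2 /F2]; ring.
have hD := C1gD (C1gM hS hS) (C1gM hQ hQ).
have hI := C1g_inv (fun x => lt0r_neq0 (Df_gt0 x (W x))) hD.
have h1 := C1gM (C1gM hS hS) hI; have h2 := C1gM (C1gM hS hQ) hI.
do 4 eexists; split; [exact: h1|exact: h2|] => x Hx.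
have D0 := lt0r_neq0 (Df_gt0 x (W x)); have Wr := wronskian x (W x).
have [S1 S2] := sE x Hx; have [Q1 Q2] := qE x Hx.
rewrite /= S1 S2 Q1 Q2 -/(Df x (W x)) -/(r1 x) -/(r2 x).
split.
- exact: inv1_id.
- exact: inv1_id.
- exact: inv2_id.
- exact: inv2_id.
Qed.

(** The quotient [k2 / k1] is [Qf / sin v], that is [yf] times the cotangent of [v] minus [x.1]: it
    is the horizontal shift of the profile through [v]. When [k1 = 0] the sine vanishes and so does
    [F]. *)
Lemma inv_angle x v k1 k2 : inv1 x v = k1 -> inv2 x v = k2 -> 0 <= x.2 ->
  if k1 == 0 then F1 eps x v = 0 /\ F2 eps x v = 0
  else F1 eps x v = F1 eps x (ang eps (k2 / k1) x) /\ F2 eps x v = F2 eps x (ang eps (k2 / k1) x).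
Proof.
move=> E1 E2 x0; have D0 := Df_gt0 x v; have D1 := lt0r_neq0 D0.
case: ifPn => [/eqP k10|k10].
  move: E1; rewrite k10 /inv1 => /eqP; rewrite mulf_eq0 invr_eq0 (negPf D1) orbF mulf_eq0 orbb => /eqP S.
  by rewrite /F1 /F2 S expr0n/= mul0r mulr0 oppr0.
have S0 : sin v != 0.
  by apply: contra k10 => /eqP S; rewrite -E1 /inv1 S !mul0r.
have [a1 a2] := angF eps (k2 / k1) x0; rewrite -a1 -a2 /ang1 /ang2 dkfE//.
have cE : k2 / k1 = Qf x v / sin v.
  by rewrite -E1 -E2 /inv1 /inv2; field; rewrite S0.
have y0 := yf_gt0 heps x.2.
have cz : (x.1 + k2 / k1) * kf eps x.2 = cos v / sin v.
  by rewrite cE /Qf /kf; field; rewrite S0 gt_eqF.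
have -> : (x.1 + k2 / k1) * - kf eps x.2 ^+ 2 = - (cos v / sin v) * kf eps x.2.
  by rewrite -cz; ring.
rewrite cz.
have -> : (1 + (cos v / sin v) ^+ 2)^-1 = sin v ^+ 2.
  have -> : 1 + (cos v / sin v) ^+ 2 = (cos v ^+ 2 + sin v ^+ 2) / sin v ^+ 2.
    by field.
  by rewrite cos2Dsin2 mul1r invrK.
rewrite /F1 /F2; split; [ring|field; exact: S0].
Qed.

End Invariants.

(** * Explicit form of the limits of almost solutions *)

Section Rigidity.
Context {R : realType}.
Local Notation R2 := (measurableTypeR R * measurableTypeR R)%type.
Local Notation mu1 := (@leb1 R).
Local Notation leb2 := (@leb2 R).
Local Notation H := (halfplane : set R2).
Variables (eps : R) (heps : 0 < eps) (w : R * R -> R).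
Hypothesis lw : loc2 w.
Hypothesis hA : characteristic_limit eps w.

Lemma measurable_bounded_loc2 (f : R * R -> R) (K : R) : measurable_fun H (f : R2 -> R) -> (forall x, H x -> `|f x| <= K) -> loc2 f.
Proof.
move=> mf fK L; split; first by apply: measurable_funS mf => // x [].
apply: (@integrable_box R _ _ L (K ^+ 2)) => //.
- by apply: measurable_funX; apply: measurable_funS mf => // x [].
- by move=> x [_ b] nb; case: nb.
- move=> x [Hx _] _; rewrite normrX; have := fK x Hx; have := normr_ge0 (f x).
  by move=> f0 fk; rewrite ler_sqr ?nnegrE//; apply: le_trans fk.
Qed.

Let msin : measurable_fun H (fun x => sin (w x)).
Proof.
apply: (measurableT_comp _ (loc2_measurable lw)).
by apply: continuous_measurable_fun; exact: continuous_sin.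
Qed.

Let mcos : measurable_fun H (fun x => cos (w x)).
Proof.
apply: (measurableT_comp _ (loc2_measurable lw)).
by apply: continuous_measurable_fun; exact: continuous_cos.
Qed.

Let mk : measurable_fun H (fun x => kf eps x.2).
Proof.
apply: measurable_funTS; apply: continuous_measurable_fun2.
exact: C1g_cont (C1g_of2 (is_derive_kf heps) (dkf_cont heps)).
Qed.

Let mQ : measurable_fun H (fun x => Qf eps x (w x)).
Proof.
apply: measurable_funB; apply: measurable_funM => //; apply: measurable_funTS; apply: continuous_measurable_fun2.
  exact: C1g_cont (C1g_of2 (is_derive_yf heps) (@dyf_cont R eps)).
exact: C1g_cont (@C1g_fst R).
Qed.

Let mDi : measurable_fun H (fun x => (Df eps x (w x))^-1).
Proof.
apply: measurable_funVpos => //; last by move=> x _; exact: Df_gt0.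
by apply: measurable_funD; apply: measurable_funM.
Qed.

Lemma loc2_inv : loc2 (fun x => inv1 eps x (w x)) /\ loc2 (fun x => inv2 eps x (w x)).
Proof.
split; apply: (@measurable_bounded_loc2 _ 1).
- by apply: measurable_funM => //; exact: measurable_funM.
- by move=> x _; have [] := inv_bounds heps x (w x).
- by apply: measurable_funM => //; exact: measurable_funM.
- by move=> x _; have [] := inv_bounds heps x (w x).
Qed.

Lemma kf_le x : H x -> 0 <= kf eps x.2 <= eps^-1.
Proof.
move=> Hx; have x0 : 0 <= x.2 := ltW Hx; rewrite (ltW (kf_gt0 heps _))/= kfE//.
by rewrite lef_pV2 ?posrE ?ltr_wpDl// lerDr.
Qed.

Lemma loc2_F : loc2 (fun x => F1 eps x (w x)) /\ loc2 (fun x => F2 eps x (w x)).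
Proof.
have e0 : 0 <= eps^-1 by rewrite invr_ge0 ltW.
split; apply: (@measurable_bounded_loc2 _ (eps^-1 * (1 * 1))).
- by apply: measurable_funN; apply: measurable_funM => //; exact: measurable_funX.
- move=> x /kf_le/andP[k0 k1]; rewrite normrN !normrM (ger0_norm k0).
  by rewrite ler_pM ?mulr_ge0// ler_pM ?sin_max.
- by apply: measurable_funM => //; exact: measurable_funM.
- move=> x /kf_le/andP[k0 k1]; rewrite !normrM (ger0_norm k0).
  by rewrite ler_pM// ler_pM ?sin_max ?cos_max.
Qed.

(** The chain rule with [P1 = P2 = 0]: the gradient of an invariant along [W] is a locally bounded
    multiple of the defect. *)
Lemma zero_weak_grad_inv :
  zero_weak_grad (fun x => inv1 eps x (w x)) /\ zero_weak_grad (fun x => inv2 eps x (w x)).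
Proof.
have [l1 l2] := loc2_inv.
have l0 : loc2 (fun=> 0 : R) by apply: cont_loc2 => x; exact: cvg_cst.
have hK L : exists2 K, 0 <= K & forall x, (H `&` box L) x ->
    (1 + x.1 ^+ 2 + yf eps x.2 ^+ 2) / eps <= K.
  exists ((1 + L ^+ 2 + (L + eps) ^+ 2) / eps).
    by rewrite divr_ge0 ?ltW// -addrA ltr_pwDl// addr_ge0 ?sqr_ge0.
  move=> x [Hx [b1 b2]]; rewrite ler_pM2r ?invr_gt0//.
  have x0 : 0 < x.2 by [].
  have L0 : 0 <= L := le_trans (normr_ge0 _) b1.
  rewrite gtr0_norm// in b2.
  have -> : yf eps x.2 = x.2 + eps by rewrite /yf /q2 q1_ge ?ltW// subrr mulr0 addr0 addrC.
  apply: lerD; first by rewrite lerD2l -real_normK ?num_real// ler_sqr ?nnegrE.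
  by rewrite ler_sqr ?nnegrE ?lerD2r// addr_ge0// ltW.
have gen (h m : R * R -> R -> R) :
    (forall W W1 W2, C1g W W1 W2 -> exists G1 G2, C1g (fun x => h x (W x)) G1 G2 /\
      forall x, H x -> G1 x = 0 + m x (W x) * (W1 x - F1 eps x (W x)) /\
        G2 x = 0 + m x (W x) * (W2 x - F2 eps x (W x))) ->
    (forall x v, is_derive v (1 : R) (h x) (m x v)) ->
    (forall x v, 0 <= x.2 -> `|m x v| <= (1 + x.1 ^+ 2 + yf eps x.2 ^+ 2) / eps) ->
    loc2 (fun x => h x (w x)) -> zero_weak_grad (fun x => h x (w x)).
  move=> hC dh hm lh eta eta1 eta2 L c he v c0 vc.
  have [|z1 z2] := @chain_rule R eps w lw hA h m (fun _ _ => 0) (fun _ _ => 0) hC _ lh l0 l0 _ _ _ L he v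
    (ex_intro2 _ _ c c0 vc).
    move=> L'; have [K K0 hK'] := hK L'; exists K => // x a b Dx.
    have mK v' : `|m x v'| <= K by apply: le_trans (hm _ _ _) (hK' _ Dx); exact: ltW Dx.1.
    split; rewrite ?subrr ?normr0 ?mulr_ge0//.
    rewrite distrC [`|a - b|]distrC; exact: mvt_lip (dh x) mK.
  rewrite z1 z2 Rintegral0_eq ?oppr0// => x _; by rewrite mul0r.
split.
- apply: (gen (inv1 eps) (minv1 eps)); last exact: l1.
  + move=> W W1 W2 hW; have [G1 [G2 [K1 [K2 [g1 _ gE]]]]] := C1g_inv12 heps hW.
    by exists G1, G2; split=> // x Hx; have [a b _ _] := gE x Hx; rewrite !add0r.
  + by move=> x v; have [] := is_derive_inv heps x v.
  + by move=> x v x0; have [] := minv_bounds heps v x0.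
- apply: (gen (inv2 eps) (minv2 eps)); last exact: l2.
  + move=> W W1 W2 hW; have [G1 [G2 [K1 [K2 [_ g1 gE]]]]] := C1g_inv12 heps hW.
    by exists K1, K2; split=> // x Hx; have [_ _ a b] := gE x Hx; rewrite !add0r.
  + by move=> x v; have [] := is_derive_inv heps x v.
  + by move=> x v x0; have [] := minv_bounds heps v x0.
Qed.

(** The chain rule for the identity, with [m = 1] and [P = F]; the Lipschitz bounds in [v] come from
    [kf <= eps^-1] on the half-plane. *)
Lemma weak_grad_w eta eta1 eta2 L : C1g eta eta1 eta2 -> vanish L eta ->
  (exists2 c, 0 < c & forall x, x.2 < c -> eta x = 0) ->
  \int[leb2]_(x in H) (w x * eta1 x) = - (\int[leb2]_(x in H) (F1 eps x (w x) * eta x)) /\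
  \int[leb2]_(x in H) (w x * eta2 x) = - (\int[leb2]_(x in H) (F2 eps x (w x) * eta x)).
Proof.
have [f1 f2] := loc2_F.
apply: (@chain_rule R eps w lw hA (fun _ v => v) (fun _ _ => 1) (F1 eps) (F2 eps)) => //.
  move=> W W1 W2 hW; exists W1, W2; split=> // x _.
  by split; rewrite mul1r addrC subrK.
move=> L'; exists (1 + 2 * eps^-1); first by rewrite addr_ge0// mulr_ge0// invr_ge0 ltW.
move=> x a b [/kf_le/andP[k0 k1] _].
have e0 : 0 <= 2 * eps^-1 by rewrite mulr_ge0// invr_ge0 ltW.
have k2 : 2 * kf eps x.2 <= 1 + 2 * eps^-1 by lra.
split.
- by rewrite normr1; lra.
- by rewrite ler_peMl//; lra.
- have -> : F1 eps x a - F1 eps x b = kf eps x.2 * (sin b ^+ 2 - sin a ^+ 2) by rewrite /F1; ring.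
  rewrite (normrM (kf eps x.2)) (ger0_norm k0) [`|a - b|]distrC.
  apply: (@le_trans _ _ (kf eps x.2 * (2 * `|b - a|))).
    by rewrite ler_wpM2l//; exact: mvt_lip (@is_derive_sin2 R) (@s2_bound R).
  by rewrite mulrA [kf eps _ * 2]mulrC ler_wpM2r.
- have -> : F2 eps x a - F2 eps x b = kf eps x.2 * (sin a * cos a - sin b * cos b) by rewrite /F2; ring.
  rewrite (normrM (kf eps x.2)) (ger0_norm k0).
  apply: (@le_trans _ _ (kf eps x.2 * (2 * `|a - b|))).
    rewrite ler_wpM2l//; apply: le_trans (s2_lip b a); rewrite /s2 -mulrBr normrM (ger0_norm (_ : 0 <= 2))//.
    by rewrite ler_peMl// ler1n.
  by rewrite mulrA [kf eps _ * 2]mulrC ler_wpM2r.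
Qed.

Lemma rigid_const A A1 A2 : C1g A A1 A2 ->
  {ae leb2, forall x, H x -> F1 eps x (w x) = A1 x /\ F2 eps x (w x) = A2 x} ->
  exists kap, {ae leb2, forall x, H x -> w x = A x + kap}.
Proof.
move=> hAA aeF; have hd := H1d_C1g hAA; have [la l1 l2 _ wa1 wa2] := hd.
have [f1 f2] := loc2_F.
have lwA : loc2 (fun x => w x + -1 * A x) by apply: loc2D => //; exact: loc2Z.
have eqF F B eta L : loc2 F -> loc2 B -> continuous eta -> vanish L eta ->
    {ae leb2, forall x, H x -> F x = B x} ->
    \int[leb2]_(x in H) (F x * eta x) = \int[leb2]_(x in H) (B x * eta x).
  move=> lF lB ce v FB; congr fine; apply: ae_Rintegral => //.
  - by case/integrableP: (loc2_int lF ce v) => /measurable_EFinP.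
  - by case/integrableP: (loc2_int lB ce v) => /measurable_EFinP.
  - by apply: (ae_imp FB) => x h Hx; rewrite h.
have [kap hk] : exists kap, {ae leb2, forall x, H x -> w x + -1 * A x = kap}.
  apply: zero_weak_grad_const => // eta eta1 eta2 L c he v c0 vc.
  have [v1 v2] := vanish_d he v; have ce := C1g_cont he; have [_ ce1 ce2] := he.
  have [z1 z2] := weak_grad_w he v (ex_intro2 _ _ c c0 vc).
  have a1 := wa1 _ _ _ _ _ he v c0 vc; have a2 := wk2_wki la l2 wa2 he v c0 vc.
  have sp eta' : continuous eta' -> vanish L eta' ->
      \int[leb2]_(x in H) ((w x + -1 * A x) * eta' x) =
      \int[leb2]_(x in H) (w x * eta' x) - \int[leb2]_(x in H) (A x * eta' x).
    move=> c' v'; rewrite -RintegralB//; [|exact: loc2_int v'|exact: loc2_int v'].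
    by apply: eq_Rintegral => x _; ring.
  rewrite !sp// z1 z2 a1 a2.
  rewrite (eqF (fun x => F1 eps x (w x)) A1 eta L)//; last by apply: (ae_imp aeF) => x h /h[].
  rewrite (eqF (fun x => F2 eps x (w x)) A2 eta L)//; last by apply: (ae_imp aeF) => x h /h[].
  by rewrite !subrr.
by exists kap; apply: (ae_imp hk) => x h /h <-; ring.
Qed.

(** Constant invariants determine [F (x, w)], hence the weak gradient of [w]. The case [A = cst 0]
    is that of a constant phase with [sin w = 0]. *)
Lemma rigidity : exists A A1 A2 kap, [/\ C1g A A1 A2,
  {ae leb2, forall x, H x -> w x = A x + kap} &
  A = cst 0 \/ exists c, A = ang eps c].
Proof.
have [l1 l2] := loc2_inv; have [z1 z2] := zero_weak_grad_inv.
have [k1 h1] := zero_weak_grad_const l1 z1; have [k2 h2] := zero_weak_grad_const l2 z2.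
have [k10|k10] := eqVneq k1 0.
  have aeF : {ae leb2, forall x, H x -> F1 eps x (w x) = (cst 0 : R * R -> R) x /\ F2 eps x (w x) = (cst 0 : R * R -> R) x}.
    apply: (ae_imp2 h1 h2) => x a b Hx.
    by have := inv_angle heps (a Hx) (b Hx) (ltW Hx); rewrite k10 eqxx.
  have [kap hk] := rigid_const (C1g_cst 0) aeF.
  by exists (cst 0), (cst 0), (cst 0), kap; split=> //; [exact: C1g_cst|left].
have aeF : {ae leb2, forall x, H x -> F1 eps x (w x) = ang1 eps (k2 / k1) x /\ F2 eps x (w x) = ang2 eps (k2 / k1) x}.
  apply: (ae_imp2 h1 h2) => x a b Hx.
  have := inv_angle heps (a Hx) (b Hx) (ltW Hx); rewrite (negPf k10) => -[-> ->].
  by have [-> ->] := angF eps (k2 / k1) (ltW Hx).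
have [kap hk] := rigid_const (C1g_ang heps _) aeF.
exists (ang eps (k2 / k1)), (ang1 eps (k2 / k1)), (ang2 eps (k2 / k1)), kap.
by split=> //; [exact: C1g_ang|right; exists (k2 / k1)].
Qed.

End Rigidity.

(** * Uniqueness *)

Section Uniqueness.
Context {R : realType}.
Local Notation R2 := (measurableTypeR R * measurableTypeR R)%type.
Local Notation mu1 := (@leb1 R).
Local Notation leb2 := (@leb2 R).
Local Notation H := (halfplane : set R2).

Lemma ae_line_exists (P : R -> Prop) (a b : R) : a < b -> {ae mu1, forall s, P s} ->
  exists s, [/\ a < s, s < b & P s].
Proof.
move=> ab [N [mN N0 PN]]; apply: contrapT => nP.
have abN : `]a, b[%classic `<=` N.
  move=> s; rewrite /= in_itv/= => /andP[sa sb]; apply: PN => /= Ps.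
  by apply: nP; exists s.
have : (@lebesgue_measure R `]a, b[%classic <= mu1 N)%E.
  by apply: (@le_measure _ _ _ mu1) => //; rewrite inE//; exact: measurable_itv.
rewrite lebesgue_measure_itv/= lte_fin ab [X in (_ <= X)%E]N0 -EFinB lee_fin subr_le0 leNgt ab; exact.
Qed.

(** Once [f] vanishes almost everywhere so does its weak derivative [p2], and Green's formula leaves
    only the boundary integral. *)
Lemma H1d_null_trace (f p1 p2 : R * R -> R) (t : R -> R) : H1d f p1 p2 t ->
  {ae leb2, forall x, H x -> f x = 0} -> {ae mu1, forall s, t s = 0}.
Proof.
move=> [lf l1 l2 lt _ w2] f0.
have l0 : loc2 (fun=> 0 : R) by apply: cont_loc2 => x; exact: cvg_cst.
have If (k e : R * R -> R) L : loc2 k -> continuous e -> vanish L e -> {ae leb2, forall x, H x -> k x = 0} ->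
    \int[leb2]_(x in H) (k x * e x) = 0.
  move=> lk ce v k0; rewrite -[RHS](@Rintegral0_eq _ _ _ leb2 H (fun=> 0))//.
  congr fine; apply: ae_Rintegral => //.
  - by case/integrableP: (loc2_int lk ce v) => /measurable_EFinP.
  - by apply: (ae_imp k0) => x h Hx; rewrite h// mul0r.
have p0 : {ae leb2, forall x, H x -> p2 x = 0}.
  apply: (@wki_unique _ true f p2 (fun=> 0)) => //; first exact: wk2_wki w2.
  move=> eta eta1 eta2 L c he v c0 vc; have [v1 v2] := vanish_d he v; have [_ ce1 ce2] := he.
  rewrite (If f eta2 L)// Rintegral0_eq ?oppr0// => x _; by rewrite mul0r.
apply: fundamental1 => // eta eta1 eta2 L he v.
have [v1 v2] := vanish_d he v; have ce := C1g_cont he; have [_ ce1 ce2] := he.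
apply: oppr_inj; rewrite -(w2 _ _ _ _ he v) (Rintegral_split2 lf l2 ce2 ce v2 v).
by rewrite (If f eta2 L)// (If p2 eta L)// addr0 oppr0.
Qed.

(** If no trace existed, [trace phi] would be the default [cst 0], which does not tend to [pi]. The
    limit at [-oo] thus provides the trace itself. *)
Lemma ess_cvg_genuine_trace (phi : R * R -> R) : ess_cvg_ninfty (trace phi) pi ->
  is_trace phi (trace phi).
Proof.
move=> cvn; have [[t ht]|nt] := pselect (exists t, is_trace phi t).
  exact: (@xgetPex _ (cst 0) [set t | is_trace phi t] (ex_intro _ t ht)).
have t0 : trace phi = cst 0.
  by apply: xgetPN => t ht; apply: nt; exists t.
have [M hM] := cvn 1 ltr01.
have [|s [_ sM h]] := @ae_line_exists _ (M - 1) M _ hM; first by rewrite ltrBlDr ltrDl.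
move: (h sM); rewrite t0 /= sub0r normrN ger0_norm ?pi_ge0//.
by have := @pi_ge2 R; lra.
Qed.

Lemma uniqueness (eps : R) (delta : R * R) (phi : R * R -> R) : 0 < eps ->
  local_minimizer eps delta phi -> conditions_at_infinity delta phi ->
  exists a, {ae leb2, forall x, H x -> phi x = profile eps delta a x}.
Proof.
move=> heps hmin [cvp cvn [_ [M hM]]].
have hf := H1loc_H1d hmin.1 (ess_cvg_genuine_trace cvn).
have hJ := (minimizerP eps delta hf).1 hmin.
move: (weak_partial e1 phi) (weak_partial e2 phi) (trace phi) cvp cvn hf hJ => p1 p2 t cvp cvn hf hJ.
(* [1 / 4] is the radius around the wells on which [s2_mono0] and [s2_monopi] hold. *)
have q0 : 0 < 1 / 4 :> R by rewrite divr_gt0.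
have [Mp hMp] := cvp _ q0; have [Mn hMn] := cvn _ q0.
have [Np hNp] := @ang_pinfty R eps heps (eps * 0) _ q0; have [Nn hNn] := @ang_ninfty R eps heps (eps * 0) _ q0.
pose M0 : R := `|Mp| + `|Mn| + `|Np| + `|Nn|.
have := ler_norm Mp; have := ler_norm (- Mn); have := ler_norm Np; have := ler_norm (- Nn).
have := normr_ge0 Mp; have := normr_ge0 Mn; have := normr_ge0 Np; have := normr_ge0 Nn.
rewrite !normrN => z1 z2 z3 z4 y1 y2 y3 y4.
have tP : {ae mu1, forall s, M0 < s -> `|t s| <= 1 / 4}.
  apply: (ae_imp hMp) => s h sM; rewrite -[t s]subr0 ltW// h//.
  by apply: le_lt_trans sM; rewrite /M0; lra.
have tN : {ae mu1, forall s, s < - M0 -> `|t s - pi| <= 1 / 4}.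
  apply: (ae_imp hMn) => s h sM; rewrite ltW// h//.
  by apply: lt_le_trans sM _; rewrite /M0; lra.
have uP s : M0 < s -> `|ang eps (eps * 0) (s, 0)| <= 1 / 4.
  by move=> sM; rewrite ltW// hNp//; apply: le_lt_trans sM; rewrite /M0; lra.
have uN s : s < - M0 -> `|ang eps (eps * 0) (s, 0) - pi| <= 1 / 4.
  by move=> sM; rewrite ltW// hNn//; apply: lt_le_trans sM _; rewrite /M0; lra.
have [s1 s2 sb] := finite_energy heps hf hJ hM tP tN uP uN.
have dB := @diff_bounded R eps delta phi M hM.
have lx : loc2 (fun x : R * R => x.2) by apply: cont_loc2; exact: C1g_cont (@C1g_snd R).
have lw : loc2 (fun x => phi x - delta.2 * x.2).
  have := loc2D (H1d_f hf) (loc2Z (- delta.2) lx).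
  by apply: eq_loc2 => x; rewrite mulNr.
have hA := almost_characteristic heps hf hJ s1 s2 sb dB.
have [A [A1 [A2 [kap [hC aeA cA]]]]] := rigidity heps lw hA.
have hC' := C1gD (C1gD hC (C1g_cst kap)) (C1gZ delta.2 (@C1g_snd R)).
(* The conditions at infinity concern the trace, so the interior identity is carried to the boundary
   line by applying [H1d_null_trace] to the difference. *)
have tA : {ae mu1, forall s, t s = A (s, 0) + kap}.
  have := H1d_null_trace (H1dD (-1) hf (H1d_C1g hC')) => /(_ _)/ae_imp; apply.
    by apply: (ae_imp aeA) => x h Hx; have := h Hx => /= E; rewrite -E; ring.
  by move=> s /= E; apply/eqP; rewrite -subr_eq0 -[X in _ == X]E; apply/eqP; ring.
have limP : (forall e, 0 < e -> exists N, forall s, N < s -> `|A (s, 0)| < e) -> kap = 0.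
  move=> Alim; apply: normr0_eq0; apply/eqP; rewrite eq_le normr_ge0 andbT; apply/ler_addgt0Pl => e e0.
  have e2 : 0 < e / 2 by rewrite divr_gt0.
  have [N hN] := Alim _ e2; have [N' hN'] := cvp _ e2.
  have [|s [sa sb' [Es ts]]] := @ae_line_exists (fun s => t s = A (s, 0) + kap /\ (N' < s -> `|t s - 0| < e / 2))
    (Num.max N N') (Num.max N N' + 1) _ (ae_imp2 tA hN' (fun s a b => conj a b)).
    by rewrite ltrDl.
  move: sa; rewrite gt_max => /andP[/hN a1 /ts a2].
  have -> : kap = (t s - 0) - A (s, 0) by rewrite Es; ring.
  apply: le_trans (ler_normB _ _) _; lra.
(* A constant phase has the same limit at both ends, whereas the trace tends to [0] and to [pi]; in
   the other case the limit [0] at [+oo] forces [kap = 0]. *)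
case: cA => [A0|[c Ac]].
  have k0 : kap = 0.
    by apply: limP => e e0; exists 0 => s _; rewrite A0/= normr0.
  have [N hN] := cvn 1 ltr01.
  have [|s [_ sb' [Es ts]]] := @ae_line_exists (fun s => t s = A (s, 0) + kap /\ (s < N -> `|t s - pi| < 1))
    (N - 1) N _ (ae_imp2 tA hN (fun s a b => conj a b)).
    by rewrite ltrBlDr ltrDl.
  move: (ts sb'); rewrite Es k0 A0 /= addr0 sub0r normrN ger0_norm ?pi_ge0//.
  by have := @pi_ge2 R; lra.
have k0 : kap = 0 by apply: limP => e e0; rewrite Ac; exact: ang_pinfty.
exists (c / eps); apply: (ae_imp aeA) => x h Hx; have := h Hx.
rewrite k0 addr0 Ac /profile /ang kfE ?ltW// => /eqP; rewrite subr_eq => /eqP ->.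
by rewrite [eps * _]mulrC divfK// lt0r_neq0.
Qed.

End Uniqueness.

Theorem theorem1p9 (R : realType) (eps : R) (delta : R * R) (heps : 0 < eps) :
  (forall a : R,
      local_minimizer eps delta (profile eps delta a) /\
      conditions_at_infinity delta (profile eps delta a)) /\
  (forall phi : R * R -> R,
      local_minimizer eps delta phi ->
      conditions_at_infinity delta phi ->
      exists a : R,
        {ae lebesgue2, forall x : R * R,
          halfplane x -> phi x = profile eps delta a x}).
Proof.
split=> [a|phi hmin hinf]; first by split; [exact: profile_minimizer|exact: profile_conditions].
exact: uniqueness hmin hinf.
Qed.
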